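(* Let $m,N\in\mathbb{N}_0$ and let $l\in2\mathbb{N}$ with $l\ge4$ and $l\ge 2m+2$. Set $$\phi(\tau)=q^N\sum_{r=0}^m\binom{m}{r}\frac{(l+m-1)!}{(l+m-r-1)!}\left(-\frac{E_2(\tau)}{12}\right)^rN^{m-r}.$$ Then the $m$-th order Serre derivative of $P_{l,N}$ is $$\vartheta^{[m]}P_{l,N}=\mathbb{P}_{l+2m}(\phi).$$
   Context: Let $\mathbb{H}$ be the upper half-plane, $\tau\in\mathbb{H}$, $q=e^{2\pi i\tau}$, and $D=\frac{1}{2\pi i}\frac{d}{d\tau}=q\frac{d}{dq}$. Let $\Gamma=SL_2(\mathbb{Z})$ and let $\Gamma_\infty\le\Gamma$ be the subgroup generated by $\pm\begin{pmatrix}1&1\\0&1\end{pmatrix}$. $M_k$ is the space of holomorphic modular forms of weight $k$ for $\Gamma$. For $M=\begin{pmatrix}a&b\\c&d\end{pmatrix}\in\Gamma$ the weight $k$ slash operator is $(\phi|_kM)(\tau)=(c\tau+d)^{-k}\phi\left(\frac{a\tau+b}{c\tau+d}\right)$. $E_2(\tau)=1-24\sum_{n=1}^\infty\sigma_1(n)q^n$ and $E_4(\tau)=1+240\sum_{n=1}^\infty\sigma_3(n)q^n$, where $\sigma_j(n)=\sum_{d\mid n}d^j$. Poincaré series: for even $k\ge4$ and a $q$-series $\phi(\tau)=\sum_{n=0}^\infty a_nq^n$ on $\mathbb{H}$ whose coefficients grow slowly enough, $$\mathbb{P}_k(\phi;\tau)=\sum_{M\in\Gamma_\infty\backslash\Gamma}(\phi|_kM)(\tau)=\frac12\sum_{c,d}\sum_{n=0}^\infty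 a_n(c\tau+d)^{-k}e^{2\pi i n\frac{a\tau+b}{c\tau+d}},$$ where $(c,d)$ runs over all pairs of coprime integers and $a,b$ are chosen with $ad-bc=1$; the sum over cosets converges absolutely and uniformly on compact subsets. Write $P_{k,N}=\mathbb{P}_k(q^N)$ for $N\in\mathbb{N}_0$; in particular $P_{k,0}=E_k=\mathbb{P}_k(1)$ is the normalized Eisenstein series. Serre derivatives: $\vartheta^{[n]}:M_k\to M_{k+2n}$ are defined recursively by $\vartheta^{[0]}f=f$, $\vartheta^{[1]}f=\vartheta f=Df-\frac{k}{12}E_2f$ (where $k$ is the weight of the form to which $\vartheta$ is applied), and $$\vartheta^{[n+1]}f=\vartheta\vartheta^{[n]}f-\frac{n(k+n-1)}{144}E_4\,\vartheta^{[n-1]}f,\quad n\ge1,\ f\in M_k.$$ Equivalently, in closed form (for $k\ge1$), $$\vartheta^{[n]}f=\sum_{r=0}^n\binom nr\frac{(k+n-1)!}{(k+r-1)!}\left(-\frac{E_2}{12}\right)^{n-r}D^rf.$$ Convention: $0^0=1$. *)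

(* Defs.v *)
(* Stdlib reals, with Coquelicot for complex numbers, limits and series.

   Functions on the upper half-plane are represented by functions C -> C whose
   values at points with Im tau <= 0 are irrelevant: the half-plane is open and
   stable under SL_2(Z), so complex derivatives and slash operators at its
   points only depend on values at its points. *)
From Stdlib Require Import Reals ZArith Arith ClassicalEpsilon.
From Coquelicot Require Import Coquelicot.
From Stdlib Require Import List.
Open Scope R_scope.

Definition Cexp (z : C) : C := (exp (Re z) * cos (Im z), exp (Re z) * sin (Im z)).

Definition CSeries (a : nat -> C) : C :=
  (Series (fun n => Re (a n)), Series (fun n => Im (a n))).

(* Sum of f over the index set A, independent of any enumeration: the limit of
   the sums over finite subsets of A (duplicate-free lists of elements of A),
   ordered by inclusion. *)
Definition finite_subsets {I : Type} (A : I -> Prop) (P : list I -> Prop) : Prop :=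
  exists L0 : list I, Forall A L0 /\
    forall L : list I, NoDup L -> Forall A L -> incl L0 L -> P L.

Definition Csum_list {I : Type} (f : I -> C) (L : list I) : C :=
  fold_right Cplus (RtoC 0) (map f L).

Definition is_Csum {I : Type} (A : I -> Prop) (f : I -> C) (s : C) : Prop :=
  filterlim (Csum_list f) (finite_subsets A) (locally s).

Definition Csum {I : Type} (A : I -> Prop) (f : I -> C) : C :=
  epsilon (inhabits (RtoC 0)) (is_Csum A f).

Record mat2 : Set := Mat2 { m_a : Z; m_b : Z; m_c : Z; m_d : Z }.

Definition mat2_one : mat2 := Mat2 1 0 0 1.

Definition mat2_mul (M M' : mat2) : mat2 :=
  Mat2 (m_a M * m_a M' + m_b M * m_c M') (m_a M * m_b M' + m_b M * m_d M')
       (m_c M * m_a M' + m_d M * m_c M') (m_c M * m_b M' + m_d M * m_d M').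

(* The adjugate, which is the inverse on SL_2(Z). *)
Definition mat2_inv (M : mat2) : mat2 :=
  Mat2 (m_d M) (- m_b M) (- m_c M) (m_a M).

Definition SL2Z (M : mat2) : Prop := (m_a M * m_d M - m_b M * m_c M = 1)%Z.

Inductive Gamma_inf : mat2 -> Prop :=
| Gamma_inf_T : Gamma_inf (Mat2 1 1 0 1)
| Gamma_inf_mT : Gamma_inf (Mat2 (-1) (-1) 0 (-1))
| Gamma_inf_one : Gamma_inf mat2_one
| Gamma_inf_mul M M' : Gamma_inf M -> Gamma_inf M' -> Gamma_inf (mat2_mul M M')
| Gamma_inf_inv M : Gamma_inf M -> Gamma_inf (mat2_inv M).

Definition Gamma_inf_coset (M : mat2) : mat2 -> Prop :=
  fun M' => exists h, Gamma_inf h /\ M' = mat2_mul h M.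

Definition is_coset (X : mat2 -> Prop) : Prop :=
  exists M, SL2Z M /\ X = Gamma_inf_coset M.

Definition coset_repr (X : mat2 -> Prop) : mat2 := epsilon (inhabits mat2_one) X.

Definition slash (k : nat) (phi : C -> C) (M : mat2) (tau : C) : C :=
  (/ (IZR (m_c M) * tau + IZR (m_d M)) ^ k *
   phi ((IZR (m_a M) * tau + IZR (m_b M)) / (IZR (m_c M) * tau + IZR (m_d M))))%C.

(* For even k and 1-periodic phi, in particular for a q-series, the term does
   not depend on the representative of the coset. *)
Definition poincare (k : nat) (phi : C -> C) (tau : C) : C :=
  Csum is_coset (fun X => slash k phi (coset_repr X) tau).

Definition qexp (tau : C) : C := Cexp (2 * PI * Ci * tau)%C.

Definition sigma_pow (j n : nat) : nat :=
  list_sum (map (fun d => d ^ j)%nat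
                (filter (fun d => n mod d =? 0)%nat (seq 1 n))).

Definition E2 (tau : C) : C :=
  (1 - 24 * CSeries (fun n => INR (sigma_pow 1 (S n)) * qexp tau ^ (S n)))%C.

Definition E4 (tau : C) : C :=
  (1 + 240 * CSeries (fun n => INR (sigma_pow 3 (S n)) * qexp tau ^ (S n)))%C.

Definition Dq (f : C -> C) (tau : C) : C := (/ (2 * PI * Ci) * C_derive f tau)%C.

Definition theta (k : nat) (f : C -> C) (tau : C) : C :=
  (Dq f tau - INR k / 12 * E2 tau * f tau)%C.

(* [serre n k f] is the n-th order Serre derivative of f in weight k; the
   i-th one has weight k + 2 i. *)
Fixpoint serre (n k : nat) (f : C -> C) {struct n} : C -> C :=
  match n with
  | O => f
  | S p =>
      match p with
      | O => theta k f
      | S r => fun tau =>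
          (theta (k + 2 * p) (serre p k f) tau
           - INR p * (INR k + INR p - 1) / 144 * E4 tau * serre r k f tau)%C
      end
  end.

(* Main.v *)
Require Import Defs.
From Stdlib Require Import Reals ZArith Lra Lia ClassicalEpsilon
  FunctionalExtensionality PropExtensionality.
From Coquelicot Require Import Coquelicot.
From Stdlib Require Import List Permutation.
Import ListNotations.
Open Scope R_scope.

(** Let P be the Poincare series of q^N of weight l and, for each n, let phi_n be
   the function phi of the theorem for m = n. The claim is that the n-th Serre
   derivative of P is the sum of phi_n | M over the cosets, where | is the slash
   action of weight l + 2 n; it is proved by induction on n. Three facts make the
   induction work.

   - E2 is quasimodular of weight 2 ([E2_mobius]). Hence the failure of D to
     commute with the slash action of weight k is compensated by that of the
     multiplication by k E2 / 12.
   - Ramanujan's equation D E2 = (E2^2 - E4) / 12 ([cderiv_E2]). Together with the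
     first fact it shows that E4 is modular ([E4_mobius]), so that the recursion
     defining the Serre derivatives commutes with the slash action. It also shows
     that this recursion sends phi_n and phi_(n-1) to phi_(n+1): written as
     q^N p_n(- E2 / 12), they satisfy
     p_(n+1)(x) = (N + (l + 2 n) x) p_n(x) - x^2 p_n'(x), and p_n' is a multiple of
     p_(n-1), so the terms with E4 cancel ([cderiv_phi], [slash_phi_step]).
   - The sum over the cosets can be differentiated termwise ([termwise_phi]). By
     quasimodularity phi_n | M is a combination, with coefficients that are powers
     of E2 and do not depend on M, of the functions
     c^a (c tau + d)^-b q^N(M tau) with b - a >= l >= 4; these are differentiable
     termwise because their first two derivatives are of the same form and
     bounded near tau by a multiple of 1 / ((1 + c^2) (1 + d^2)).

   Both facts on E2 are proved from its q-series.

   Ramanujan's equation amounts to an evaluation of the square of the sum of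
   sigma_1(n) q^n, that is, of the sum of a b q^(a x + b y) over positive integers
   a, b, x, y ([lambert_sqr]). Since a x + b y = (a - b) x + b (x + y), the terms
   with a > b correspond to those with x < y; comparing this correspondence with
   the obvious symmetries reduces the sum to the terms with a = b.

   Quasimodularity under S comes from summing the double series of (c tau + d)^-2 in
   both orders. The rows are evaluated by the partial fractions of the squared
   cosecant ([Zsum_sq_eq]), which follow from the duplication formula and
   boundedness near the real axis. Subtracting 1/(x - 1/2) - 1/(x + 1/2) from 1/x^2
   makes the double series absolutely convergent; what is subtracted vanishes when
   summed over d first, and leaves a limit of symmetric sums when summed over c
   first. That limit, times tau, is invariant under the scaling of tau by ratios of
   odd integers, hence has derivative zero and is constant, and its value at i is
   an arctangent integral ([E2_inv]).

   All infinite sums, single or multiple, are treated as unconditional sums; the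
   rearrangements are instances of [is_Csum_reindex] and [is_Csum_fiber]. *)

(** * Unconditional sums *)

Definition eq_dec_classic {I : Type} (i j : I) : {i = j} + {i <> j} :=
  excluded_middle_informative (i = j).

Definition Rsum_list {I : Type} (g : I -> R) (L : list I) : R :=
  fold_right Rplus 0 (map g L).

(** A bound on all finite sums: for the nonnegative families to which it is
   applied, this is unconditional convergence. *)
Definition summable {I : Type} (A : I -> Prop) (g : I -> R) : Prop :=
  exists B, forall L, NoDup L -> Forall A L -> Rsum_list g L <= B.

Definition filterP {I : Type} (A : I -> Prop) (L : list I) : list I :=
  filter (fun i => if excluded_middle_informative (A i) then true else false) L.

Lemma filterP_In {I : Type} (A : I -> Prop) L i :
  In i (filterP A L) <-> In i L /\ A i.
Proof.
unfold filterP; rewrite filter_In.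
destruct (excluded_middle_informative (A i)); intuition congruence.
Qed.

Lemma filterP_NoDup {I : Type} (A : I -> Prop) L : NoDup L -> NoDup (filterP A L).
Proof. apply NoDup_filter. Qed.

Lemma Csum_list_app {I : Type} (f : I -> C) L L' :
  Csum_list f (L ++ L') = (Csum_list f L + Csum_list f L')%C.
Proof.
unfold Csum_list; induction L as [|i L IH]; simpl; [ring|rewrite IH; ring].
Qed.

Lemma Csum_list_ext {I : Type} (A : I -> Prop) (f g : I -> C) L :
  (forall i, A i -> f i = g i) -> Forall A L -> Csum_list f L = Csum_list g L.
Proof.
intros H HL; induction HL as [|i L Hi HL IH]; [easy|].
unfold Csum_list in *; simpl; rewrite IH, (H i Hi); easy.
Qed.

Lemma Csum_list_plus {I : Type} (f g : I -> C) L :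
  Csum_list (fun i => f i + g i)%C L = (Csum_list f L + Csum_list g L)%C.
Proof.
unfold Csum_list; induction L as [|i L IH]; simpl; [ring|rewrite IH; ring].
Qed.

Lemma Csum_list_scal {I : Type} (c : C) (f : I -> C) L :
  Csum_list (fun i => c * f i)%C L = (c * Csum_list f L)%C.
Proof.
unfold Csum_list; induction L as [|i L IH]; simpl; [ring|rewrite IH; ring].
Qed.

Lemma Csum_list_map {I J : Type} (p : I -> J) (f : J -> C) L :
  Csum_list f (map p L) = Csum_list (fun i => f (p i)) L.
Proof. unfold Csum_list; now rewrite map_map. Qed.

Lemma Csum_list_single {I : Type} (f : I -> C) i : Csum_list f [i] = f i.
Proof. unfold Csum_list; simpl; ring. Qed.

Lemma Csum_list_factor {I : Type} (f : I -> C) (g : I -> R) (c : C) L :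
  (forall i, In i L -> f i = (g i * c)%C) -> Csum_list f L = (Rsum_list g L * c)%C.
Proof.
intros H; unfold Csum_list, Rsum_list; induction L as [|i L IH]; simpl; [ring|].
rewrite IH, (H i), RtoC_plus; [ring|now left|intros j Hj; apply H; now right].
Qed.

Lemma Csum_list_split {I : Type} (A : I -> Prop) (f : I -> C) L :
  Csum_list f L
  = (Csum_list f (filterP A L) + Csum_list f (filterP (fun i => ~ A i) L))%C.
Proof.
unfold filterP; induction L as [|i L IH]; [unfold Csum_list; simpl; ring|].
unfold Csum_list in *; simpl.
destruct (excluded_middle_informative (A i)) as [H|H];
destruct (excluded_middle_informative (~ A i)) as [H'|H']; try tauto;
simpl; rewrite IH; ring.
Qed.

Lemma Csum_list_Cmod {I : Type} (f : I -> C) L :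
  Cmod (Csum_list f L) <= Rsum_list (fun i => Cmod (f i)) L.
Proof.
unfold Csum_list, Rsum_list; induction L as [|i L IH]; simpl.
- rewrite Cmod_0; lra.
- eapply Rle_trans; [apply Cmod_triangle|lra].
Qed.

Lemma Rsum_list_app {I : Type} (g : I -> R) L L' :
  Rsum_list g (L ++ L') = Rsum_list g L + Rsum_list g L'.
Proof.
unfold Rsum_list; induction L as [|i L IH]; simpl; [ring|rewrite IH; ring].
Qed.

Lemma Rsum_list_map {I J : Type} (p : I -> J) (g : J -> R) L :
  Rsum_list g (map p L) = Rsum_list (fun i => g (p i)) L.
Proof. unfold Rsum_list; now rewrite map_map. Qed.

Lemma Rsum_list_scal {I : Type} (c : R) (g : I -> R) L :
  Rsum_list (fun i => c * g i) L = c * Rsum_list g L.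
Proof.
unfold Rsum_list; induction L as [|i L IH]; simpl; [ring|rewrite IH; ring].
Qed.

Lemma Rsum_list_plus {I : Type} (g h : I -> R) L :
  Rsum_list (fun i => g i + h i) L = Rsum_list g L + Rsum_list h L.
Proof.
unfold Rsum_list; induction L as [|i L IH]; simpl; [ring|rewrite IH; ring].
Qed.

Lemma Rsum_list_le {I : Type} (A : I -> Prop) (g h : I -> R) L :
  (forall i, A i -> g i <= h i) -> Forall A L -> Rsum_list g L <= Rsum_list h L.
Proof.
intros H HL; induction HL as [|i L Hi HL IH]; unfold Rsum_list in *; simpl; [lra|].
specialize (H i Hi); lra.
Qed.

Lemma Rsum_list_eq_in {I : Type} (g h : I -> R) L :
  (forall i, In i L -> g i = h i) -> Rsum_list g L = Rsum_list h L.
Proof. intros H; unfold Rsum_list; f_equal; now apply map_ext_in. Qed.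

Lemma Rsum_list_ge0 {I : Type} (g : I -> R) L :
  (forall i, In i L -> 0 <= g i) -> 0 <= Rsum_list g L.
Proof.
intros H; induction L as [|i L IH]; unfold Rsum_list in *; simpl; [lra|].
assert (0 <= g i) by (apply H; now left).
assert (0 <= fold_right Rplus 0 (map g L)) by (apply IH; intros; apply H; now right).
lra.
Qed.

Lemma Rsum_list_incl {I : Type} (g : I -> R) L M :
  NoDup L -> incl L M -> (forall i, In i M -> 0 <= g i) ->
  Rsum_list g L <= Rsum_list g M.
Proof.
intros HL; revert M; induction HL as [|i L Hi HL IH]; intros M Hinc Hg.
- unfold Rsum_list at 1; simpl; now apply Rsum_list_ge0.
- destruct (in_split i M) as (M1 & M2 & ->); [apply Hinc; now left|].
  assert (H : Rsum_list g L <= Rsum_list g (M1 ++ M2)).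
  { apply IH.
    - intros j Hj.
      assert (Hj' : In j (M1 ++ i :: M2)) by (apply Hinc; now right).
      rewrite in_app_iff in Hj' |- *; destruct Hj' as [|[->|]]; tauto.
    - intros j Hj; apply Hg; rewrite in_app_iff in *; simpl; tauto. }
  rewrite Rsum_list_app in *; unfold Rsum_list in *; simpl; lra.
Qed.

#[global] Instance finite_subsets_filter {I : Type} (A : I -> Prop) :
  ProperFilter (finite_subsets A).
Proof.
constructor.
- intros P (L0 & H0 & HP); exists (nodup eq_dec_classic L0); apply HP.
  + apply NoDup_nodup.
  + apply Forall_forall; intros i Hi; rewrite Forall_forall in H0.
    apply H0; now apply nodup_In in Hi.
  + intros i Hi; now apply nodup_In.
- constructor.
  + exists nil; split; auto.
  + intros P Q (L0 & H0 & HP) (L1 & H1 & HQ); exists (L0 ++ L1); split.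
    * now apply Forall_app.
    * intros L HL HA Hi; split; [apply HP|apply HQ]; trivial;
      intros i Hi'; apply Hi, in_app_iff; tauto.
  + intros P Q HPQ (L0 & H0 & HP); exists L0; split; auto.
Qed.

(** The topology of C is given by boxes; with the modulus, convergence has the
   usual form. *)
Lemma is_Csum_eps {I : Type} (A : I -> Prop) (f : I -> C) (s : C) :
  is_Csum A f s <->
  forall eps, 0 < eps -> exists L0, Forall A L0 /\
    forall L, NoDup L -> Forall A L -> incl L0 L -> Cmod (Csum_list f L - s) < eps.
Proof.
unfold is_Csum; split.
- intros H eps Heps.
  assert (Hs := proj1 (@filterlim_locally_ball_norm C_AbsRing _ C_NormedModule _ _ (Csum_list f) s) H
            (mkposreal eps Heps)).
  destruct Hs as (L0 & H0 & Hs); exists L0; split; trivial.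
- intros H.
  apply (proj2 (@filterlim_locally_ball_norm C_AbsRing _ C_NormedModule _ _ (Csum_list f) s)).
  intros eps; destruct (H eps (cond_pos eps)) as (L0 & H0 & Hs); exists L0; split; trivial.
Qed.

Lemma is_Csum_unique {I : Type} (A : I -> Prop) (f : I -> C) (s t : C) :
  is_Csum A f s -> is_Csum A f t -> s = t.
Proof.
intros Hs Ht.
exact (@filterlim_locally_unique _ C_AbsRing C_NormedModule _ _ (Csum_list f) s t Hs Ht).
Qed.

Lemma Csum_eq {I : Type} (A : I -> Prop) (f : I -> C) (s : C) :
  is_Csum A f s -> Csum A f = s.
Proof.
intros H; apply (is_Csum_unique A f); trivial.
unfold Csum; apply epsilon_spec; now exists s.
Qed.

Lemma is_Csum_ext {I : Type} (A : I -> Prop) (f g : I -> C) s :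
  (forall i, A i -> f i = g i) -> is_Csum A f s -> is_Csum A g s.
Proof.
intros H; rewrite !is_Csum_eps; intros Hs eps Heps.
destruct (Hs eps Heps) as (L0 & H0 & H1); exists L0; split; trivial.
intros L HL HA Hi; rewrite <- (Csum_list_ext A f g); auto.
Qed.

Lemma Csum_ext {I : Type} (A : I -> Prop) (f g : I -> C) :
  (forall i, A i -> f i = g i) -> Csum A f = Csum A g.
Proof.
intros H; unfold Csum; f_equal; extensionality s; apply propositional_extensionality.
split; apply is_Csum_ext; auto; intros; symmetry; auto.
Qed.

Lemma is_Csum_plus {I : Type} (A : I -> Prop) (f g : I -> C) s t :
  is_Csum A f s -> is_Csum A g t -> is_Csum A (fun i => f i + g i)%C (s + t)%C.
Proof.
rewrite !is_Csum_eps; intros Hs Ht eps Heps.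
destruct (Hs (eps / 2)) as (L0 & H0 & H1); [lra|].
destruct (Ht (eps / 2)) as (L0' & H0' & H1'); [lra|].
exists (L0 ++ L0'); split; [now apply Forall_app|].
intros L HL HA Hi; rewrite Csum_list_plus.
replace (_ - _)%C with ((Csum_list f L - s) + (Csum_list g L - t))%C by ring.
eapply Rle_lt_trans; [apply Cmod_triangle|].
assert (K : Cmod (Csum_list f L - s) < eps / 2).
{ apply H1; trivial; intros i Hi'; apply Hi, in_app_iff; tauto. }
assert (K' : Cmod (Csum_list g L - t) < eps / 2).
{ apply H1'; trivial; intros i Hi'; apply Hi, in_app_iff; tauto. }
lra.
Qed.

Lemma is_Csum_scal {I : Type} (A : I -> Prop) (c : C) (f : I -> C) s :
  is_Csum A f s -> is_Csum A (fun i => c * f i)%C (c * s)%C.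
Proof.
rewrite !is_Csum_eps; intros Hs eps Heps.
assert (Hc := Cmod_ge_0 c).
destruct (Hs (eps / (Cmod c + 1))) as (L0 & H0 & H1); [apply Rdiv_lt_0_compat; lra|].
exists L0; split; trivial; intros L HL HA Hi; rewrite Csum_list_scal.
replace (_ - _)%C with (c * (Csum_list f L - s))%C by ring.
rewrite Cmod_mult; specialize (H1 L HL HA Hi).
assert (Hm := Cmod_ge_0 (Csum_list f L - s)).
apply (Rmult_lt_compat_r (Cmod c + 1)) in H1; [|lra].
replace (eps / (Cmod c + 1) * (Cmod c + 1)) with eps in H1 by (field; lra).
nra.
Qed.

Lemma is_Csum_opp {I : Type} (A : I -> Prop) (f : I -> C) s :
  is_Csum A f s -> is_Csum A (fun i => - f i)%C (- s)%C.
Proof.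
intros H; replace (- s)%C with (- (1) * s)%C by ring.
eapply is_Csum_ext; [|apply is_Csum_scal, H]; intros; simpl; ring.
Qed.

Lemma is_Csum_minus {I : Type} (A : I -> Prop) (f g : I -> C) s t :
  is_Csum A f s -> is_Csum A g t -> is_Csum A (fun i => f i - g i)%C (s - t)%C.
Proof. intros H H'; apply is_Csum_plus; trivial; now apply is_Csum_opp. Qed.

Lemma is_Csum_zero {I : Type} (A : I -> Prop) : is_Csum A (fun _ => RtoC 0) (RtoC 0).
Proof.
apply is_Csum_eps; intros eps Heps; exists nil; split; [easy|].
intros L _ _ _; replace (Csum_list _ L) with (RtoC 0).
- replace (RtoC 0 - RtoC 0)%C with (RtoC 0) by ring; now rewrite Cmod_0.
- unfold Csum_list; induction L as [|i L IH]; simpl; [easy|rewrite <- IH; ring].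
Qed.

Lemma Csum_list_perm {I : Type} (f : I -> C) L L' :
  Permutation L L' -> Csum_list f L = Csum_list f L'.
Proof.
intros P; unfold Csum_list; induction P; simpl; try congruence; ring.
Qed.

Lemma is_Csum_finite {I : Type} (f : I -> C) (L : list I) :
  NoDup L -> is_Csum (fun i => In i L) f (Csum_list f L).
Proof.
intros HL; apply is_Csum_eps; intros eps Heps; exists L; split.
- apply Forall_forall; auto.
- intros L' HL' HA Hi.
  rewrite (Csum_list_perm f L' L).
  + replace (_ - _)%C with (RtoC 0) by ring; now rewrite Cmod_0.
  + apply NoDup_Permutation; trivial; intros i; split; [|apply Hi].
    rewrite Forall_forall in HA; apply HA.
Qed.

Lemma is_Csum_iff {I : Type} (A B : I -> Prop) (f : I -> C) s :
  (forall i, A i <-> B i) -> is_Csum A f s -> is_Csum B f s.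
Proof.
intros H; replace B with A; trivial.
extensionality i; apply propositional_extensionality, H.
Qed.

Lemma is_Csum_reindex {I J : Type} (p : I -> J) (A : I -> Prop) (B : J -> Prop) f s :
  (forall i, A i -> B (p i)) ->
  (forall i j, A i -> A j -> p i = p j -> i = j) ->
  (forall j, B j -> exists i, A i /\ p i = j) ->
  is_Csum B f s -> is_Csum A (fun i => f (p i)) s.
Proof.
intros HAB Hinj Hsurj; rewrite !is_Csum_eps; intros Hs eps Heps.
destruct (Hs eps Heps) as (L0 & H0 & H1).
assert (HL0 : exists L1, Forall A L1 /\ map p L1 = L0).
{ clear H1; induction H0 as [|j L Hj HL (L1 & H1 & H2)]; [now exists nil|].
  destruct (Hsurj j Hj) as (i & Hi & Hij).
  exists (i :: L1); split; [now constructor|simpl; congruence]. }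
destruct HL0 as (L1 & HL1 & HL1'); exists L1; split; trivial.
intros L HL HA Hi; rewrite <- Csum_list_map; apply H1.
- clear Hi; induction HL as [|i L Hi HL IH]; simpl; [constructor|].
  inversion_clear HA as [|? ? HAi HAL]; constructor; [|now apply IH].
  intros Hm; apply in_map_iff in Hm; destruct Hm as (i' & Hp & Hi').
  rewrite Forall_forall in HAL.
  apply Hi; rewrite <- (Hinj i' i); auto.
- rewrite Forall_forall in *; intros j Hj; apply in_map_iff in Hj.
  destruct Hj as (i & <- & Hi'); auto.
- rewrite <- HL1'; intros j Hj; apply in_map_iff in Hj.
  destruct Hj as (i & <- & Hi'); apply in_map; auto.
Qed.

Lemma is_Csum_split {I : Type} (A B : I -> Prop) (f : I -> C) s t :
  is_Csum (fun i => A i /\ B i) f s -> is_Csum (fun i => A i /\ ~ B i) f t ->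
  is_Csum A f (s + t)%C.
Proof.
rewrite !is_Csum_eps; intros Hs Ht eps Heps.
destruct (Hs (eps / 2)) as (L0 & H0 & H1); [lra|].
destruct (Ht (eps / 2)) as (L1 & H0' & H1'); [lra|].
exists (L0 ++ L1); split.
{ apply Forall_app; split; [eapply Forall_impl; [|exact H0]|eapply Forall_impl; [|exact H0']];
  simpl; tauto. }
intros L HL HA Hi; rewrite (Csum_list_split B).
replace (_ - _)%C with ((Csum_list f (filterP B L) - s) +
  (Csum_list f (filterP (fun i => ~ B i) L) - t))%C by ring.
eapply Rle_lt_trans; [apply Cmod_triangle|].
rewrite Forall_forall in *.
assert (Cmod (Csum_list f (filterP B L) - s) < eps / 2).
{ apply H1; [now apply filterP_NoDup| |].
  - apply Forall_forall; intros i Hi'; apply filterP_In in Hi'; split; [apply HA|]; tauto.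
  - intros i Hi'; apply filterP_In; split; [apply Hi, in_app_iff; tauto|now apply H0]. }
assert (Cmod (Csum_list f (filterP (fun i => ~ B i) L) - t) < eps / 2).
{ apply H1'; [now apply filterP_NoDup| |].
  - apply Forall_forall; intros i Hi'; apply filterP_In in Hi'; split; [apply HA|]; tauto.
  - intros i Hi'; apply filterP_In; split; [apply Hi, in_app_iff; tauto|now apply H0']. }
lra.
Qed.

Lemma is_Csum_list {I J : Type} (A : I -> Prop) (f : J -> I -> C) (b : J -> C) (L : list J) :
  (forall j, In j L -> is_Csum A (f j) (b j)) ->
  is_Csum A (fun i => Csum_list (fun j => f j i) L) (Csum_list b L).
Proof.
induction L as [|j L IH]; intros H; [apply is_Csum_zero|].
apply (is_Csum_plus A (f j) (fun i => Csum_list (fun j => f j i) L) (b j) (Csum_list b L)).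
- apply H; now left.
- apply IH; intros; apply H; now right.
Qed.

Lemma is_Csum_single {I : Type} (f : I -> C) i0 : is_Csum (fun i => i = i0) f (f i0).
Proof.
apply (is_Csum_iff (fun i => In i [i0])); [simpl; intuition|].
rewrite <- (Csum_list_single f i0); apply is_Csum_finite; constructor; [easy|constructor].
Qed.

Lemma is_Csum_add {I : Type} (f : I -> C) i0 s :
  is_Csum (fun i => i <> i0) f s -> is_Csum (fun _ => True) f (f i0 + s)%C.
Proof.
intros H; apply (is_Csum_split _ (fun i => i = i0)).
- apply (is_Csum_iff (fun i => i = i0)); [tauto|apply is_Csum_single].
- apply (is_Csum_iff (fun i => i <> i0)); [tauto|trivial].
Qed.

(** Summation by fibers: this single statement covers Fubini's theorem for
   products of index sets and the grouping of terms of a multiple series. *)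
Lemma is_Csum_fiber {I J : Type} (p : I -> J) (A : I -> Prop) (B : J -> Prop)
  (f : I -> C) (g : J -> C) s :
  (forall i, A i -> B (p i)) -> is_Csum A f s ->
  (forall j, B j -> is_Csum (fun i => A i /\ p i = j) f (g j)) ->
  is_Csum B g s.
Proof.
intros HAB Hs Hg.
(* A finite set J0 of fibers can be filled up to any precision, starting from a
   prescribed finite set L0 of indices. *)
assert (K : forall J0, NoDup J0 -> Forall B J0 -> forall L0, Forall A L0 ->
  forall eps, 0 < eps -> exists L, NoDup L /\ Forall (fun i => A i /\ In (p i) J0) L /\
    (forall i, In i L0 -> In (p i) J0 -> In i L) /\
    Cmod (Csum_list f L - Csum_list g J0) < eps).
{ induction 1 as [|j J0 Hj HJ0 IH]; intros HB L0 HL0 eps Heps.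
  - exists nil; repeat split; try easy; [constructor|].
    replace (_ - _)%C with (RtoC 0) by (unfold Csum_list; simpl; ring).
    now rewrite Cmod_0.
  - inversion_clear HB as [|? ? HBj HBJ].
    destruct (IH HBJ L0 HL0 (eps / 2)) as (L & H1 & H2 & H3 & H4); [lra|].
    assert (Hj' := proj1 (is_Csum_eps _ _ _) (Hg j HBj) (eps / 2)).
    destruct Hj' as (M0 & HM0 & HM); [lra|].
    set (M := nodup eq_dec_classic (M0 ++ filterP (fun i => p i = j) L0)).
    assert (HMf : Forall (fun i => A i /\ p i = j) M).
    { apply Forall_forall; intros i Hi; apply nodup_In, in_app_iff in Hi.
      rewrite Forall_forall in HM0, HL0; destruct Hi as [Hi|Hi]; [now apply HM0|].
      apply filterP_In in Hi; split; [apply HL0|]; tauto. }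
    assert (HMs : Cmod (Csum_list f M - g j) < eps / 2).
    { apply HM; trivial; [apply NoDup_nodup|].
      intros i Hi; apply nodup_In, in_app_iff; tauto. }
    rewrite Forall_forall in HMf, H2.
    exists (M ++ L); repeat split.
    + apply NoDup_app; trivial; [apply NoDup_nodup|].
      intros i Hi Hi'; apply Hj; destruct (HMf i Hi) as (_ & <-).
      now apply (H2 i Hi').
    + apply Forall_forall; intros i Hi; apply in_app_iff in Hi; destruct Hi as [Hi|Hi].
      * destruct (HMf i Hi); split; [easy|left; easy].
      * destruct (H2 i Hi); split; [easy|right; easy].
    + intros i Hi [Hpi|Hpi]; apply in_app_iff; [left|right; auto].
      apply nodup_In, in_app_iff; right; apply filterP_In; auto.
    + rewrite Csum_list_app.
      replace (Csum_list g (j :: J0)) with (g j + Csum_list g J0)%C by easy.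
      replace (_ - _)%C with ((Csum_list f M - g j) + (Csum_list f L - Csum_list g J0))%C
        by ring.
      eapply Rle_lt_trans; [apply Cmod_triangle|lra]. }
apply is_Csum_eps; intros eps Heps.
destruct (proj1 (is_Csum_eps _ _ _) Hs (eps / 2)) as (L0 & HL0 & H1); [lra|].
exists (map p L0); split.
{ rewrite Forall_forall in *; intros j Hj; apply in_map_iff in Hj.
  destruct Hj as (i & <- & Hi); auto. }
intros J0 HJ0 HB Hi.
destruct (K J0 HJ0 HB L0 HL0 (eps / 2)) as (L & K1 & K2 & K3 & K4); [lra|].
replace (_ - _)%C with (- (Csum_list f L - Csum_list g J0) + (Csum_list f L - s))%C by ring.
eapply Rle_lt_trans; [apply Cmod_triangle|]; rewrite Cmod_opp.
assert (Cmod (Csum_list f L - s) < eps / 2).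
{ apply H1; trivial.
  - eapply Forall_impl; [|exact K2]; simpl; tauto.
  - intros i Hi'; apply K3; trivial; apply Hi, in_map; trivial. }
lra.
Qed.

Lemma is_Csum_Cmod_le {I : Type} (A : I -> Prop) (f : I -> C) s b :
  is_Csum A f s -> (forall L, NoDup L -> Forall A L -> Cmod (Csum_list f L) <= b) ->
  Cmod s <= b.
Proof.
rewrite is_Csum_eps; intros Hs Hb; apply le_epsilon; intros eps Heps.
destruct (Hs eps Heps) as (L0 & H0 & H1).
assert (HN : NoDup (nodup eq_dec_classic L0)) by apply NoDup_nodup.
assert (HF : Forall A (nodup eq_dec_classic L0)).
{ rewrite Forall_forall in *; intros i Hi; apply H0; now apply nodup_In in Hi. }
specialize (H1 _ HN HF); specialize (Hb _ HN HF).
replace s with (- (Csum_list f (nodup eq_dec_classic L0) - s) +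
  Csum_list f (nodup eq_dec_classic L0))%C by ring.
eapply Rle_trans; [apply Cmod_triangle|]; rewrite Cmod_opp.
enough (Cmod (Csum_list f (nodup eq_dec_classic L0) - s) < eps) by lra.
apply H1; intros i Hi; now apply nodup_In.
Qed.

(** * Absolute summability *)

Lemma summable_le {I : Type} (A : I -> Prop) (g h : I -> R) :
  (forall i, A i -> g i <= h i) -> summable A h -> summable A g.
Proof.
intros H (B & HB); exists B; intros L HL HA.
eapply Rle_trans; [apply (Rsum_list_le A g h)|]; auto.
Qed.

Lemma summable_scal {I : Type} (A : I -> Prop) (c : R) (g : I -> R) :
  0 <= c -> summable A g -> summable A (fun i => c * g i).
Proof.
intros Hc (B & HB); exists (c * B); intros L HL HA.
rewrite Rsum_list_scal; apply Rmult_le_compat_l; auto.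
Qed.

Lemma summable_plus {I : Type} (A : I -> Prop) (g h : I -> R) :
  summable A g -> summable A h -> summable A (fun i => g i + h i).
Proof.
intros (B & HB) (B' & HB'); exists (B + B'); intros L HL HA.
rewrite Rsum_list_plus; apply Rplus_le_compat; auto.
Qed.

Lemma summable_sub {I : Type} (A B : I -> Prop) (g : I -> R) :
  (forall i, A i -> B i) -> summable B g -> summable A g.
Proof.
intros H (b & Hb); exists b; intros L HL HA; apply Hb; trivial.
eapply Forall_impl; eauto.
Qed.

Lemma summable_list {I : Type} (A : I -> Prop) (M : list I) (g : I -> R) :
  (forall i, A i -> In i M) -> (forall i, 0 <= g i) -> summable A g.
Proof.
intros H Hg; exists (Rsum_list g M); intros L HL HA.
apply Rsum_list_incl; auto.
rewrite Forall_forall in HA; intros i Hi; auto.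
Qed.

Lemma summable_inj {I J : Type} (p : I -> J) (A : I -> Prop) (B : J -> Prop) g :
  (forall i, A i -> B (p i)) ->
  (forall i j, A i -> A j -> p i = p j -> i = j) ->
  summable B g -> summable A (fun i => g (p i)).
Proof.
intros HAB Hinj (b & Hb); exists b; intros L HL HA.
rewrite <- Rsum_list_map; apply Hb.
- induction HL as [|i L Hi HL IH]; simpl; [constructor|].
  inversion_clear HA as [|? ? HAi HAL]; constructor; [|now apply IH].
  intros Hm; apply in_map_iff in Hm; destruct Hm as (i' & Hp & Hi').
  rewrite Forall_forall in HAL.
  apply Hi; rewrite <- (Hinj i' i); auto.
- rewrite Forall_forall in *; intros j Hj; apply in_map_iff in Hj.
  destruct Hj as (i & <- & Hi'); auto.
Qed.

Lemma summable_split {I : Type} (A B : I -> Prop) (g : I -> R) :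
  summable (fun i => A i /\ B i) g -> summable (fun i => A i /\ ~ B i) g -> summable A g.
Proof.
intros (b & Hb) (b' & Hb'); exists (b + b'); intros L HL HA.
replace (Rsum_list g L) with
  (Rsum_list g (filterP B L) + Rsum_list g (filterP (fun i => ~ B i) L)).
- rewrite Forall_forall in HA; apply Rplus_le_compat; [apply Hb|apply Hb'];
  try (now apply filterP_NoDup); apply Forall_forall; intros i Hi;
  apply filterP_In in Hi; destruct Hi; auto.
- clear; unfold filterP; induction L as [|i L IH]; [unfold Rsum_list; simpl; ring|].
  unfold Rsum_list in *; simpl.
  destruct (excluded_middle_informative (B i)) as [H|H];
  destruct (excluded_middle_informative (~ B i)) as [H'|H']; try tauto;
  simpl; rewrite <- IH; ring.
Qed.

(** A finite set of pairs lies in a finite box, whose sum factors. *)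
Lemma summable_prod {I J : Type} (A : I -> Prop) (B : J -> Prop) g h :
  (forall i, A i -> 0 <= g i) -> (forall j, B j -> 0 <= h j) ->
  summable A g -> summable B h ->
  summable (fun ij => A (fst ij) /\ B (snd ij)) (fun ij => g (fst ij) * h (snd ij)).
Proof.
intros Hg Hh (b & Hb) (c & Hc); exists (b * c); intros L HL HA.
rewrite Forall_forall in HA.
set (LI := nodup eq_dec_classic (map fst L)); set (LJ := nodup eq_dec_classic (map snd L)).
assert (HLI : Forall A LI).
{ apply Forall_forall; intros i Hi; apply nodup_In, in_map_iff in Hi.
  destruct Hi as (x & <- & Hx); now apply HA. }
assert (HLJ : Forall B LJ).
{ apply Forall_forall; intros j Hj; apply nodup_In, in_map_iff in Hj.
  destruct Hj as (x & <- & Hx); now apply HA. }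
assert (E : forall K, Rsum_list (fun ij => g (fst ij) * h (snd ij)) (list_prod K LJ)
  = Rsum_list g K * Rsum_list h LJ).
{ induction K as [|i K IH]; [unfold Rsum_list; simpl; ring|].
  simpl list_prod; rewrite Rsum_list_app, IH, Rsum_list_map; simpl.
  rewrite Rsum_list_scal; unfold Rsum_list; simpl; ring. }
apply Rle_trans with (Rsum_list (fun ij => g (fst ij) * h (snd ij)) (list_prod LI LJ)).
- apply Rsum_list_incl; trivial.
  + intros [i j] Hij; apply in_prod; apply nodup_In, in_map_iff; now exists (i, j).
  + intros [i j] Hij; apply in_prod_iff in Hij; simpl.
    rewrite Forall_forall in HLI, HLJ; apply Rmult_le_pos; [apply Hg|apply Hh]; intuition.
- rewrite E; rewrite Forall_forall in HLI, HLJ; apply Rmult_le_compat.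
  + apply Rsum_list_ge0; auto.
  + apply Rsum_list_ge0; auto.
  + apply Hb; [apply NoDup_nodup|now apply Forall_forall].
  + apply Hc; [apply NoDup_nodup|now apply Forall_forall].
Qed.

(** A list of terms whose absolute sum is nearly the supremum of all such sums
   leaves only a small tail; hence the partial sums are Cauchy. *)
Lemma summable_is_Csum {I : Type} (A : I -> Prop) (f : I -> C) :
  summable A (fun i => Cmod (f i)) -> is_Csum A f (Csum A f).
Proof.
intros (B & HB).
set (E := fun x => exists L, NoDup L /\ Forall A L /\ x = Rsum_list (fun i => Cmod (f i)) L).
destruct (completeness E) as (m & Hub & Hlub).
{ exists B; intros x (L & HL & HA & ->); auto. }
{ exists 0, nil; repeat constructor. }
assert (Hf : exists s, is_Csum A f s).
{ apply (proj1 (@filterlim_locally_cauchy (list I) C_CompleteNormedModule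
    (finite_subsets A) _ (Csum_list f))).
  intros eps.
  assert (HL0 : exists L0, NoDup L0 /\ Forall A L0 /\
    m - eps / 2 < Rsum_list (fun i => Cmod (f i)) L0).
  { apply NNPP; intros Hn.
    assert (m <= m - eps / 2); [|destruct eps; simpl in *; lra].
    apply Hlub; intros x (L & HL & HA & ->); apply Rnot_lt_le; intros Hlt.
    apply Hn; exists L; auto. }
  destruct HL0 as (L0 & HN0 & HA0 & H0).
  assert (T : forall L, NoDup L -> Forall A L -> incl L0 L ->
    Cmod (Csum_list f L - Csum_list f L0) < eps / 2).
  { intros L HL HA Hi.
    rewrite (Csum_list_split (fun i => In i L0) f L).
    rewrite (Csum_list_perm f (filterP _ L) L0).
    2:{ apply NoDup_Permutation; trivial; [now apply filterP_NoDup|].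
        intros i; rewrite filterP_In; specialize (Hi i); tauto. }
    set (T := filterP (fun i => ~ In i L0) L).
    replace (_ - _)%C with (Csum_list f T) by ring.
    eapply Rle_lt_trans; [apply Csum_list_Cmod|].
    assert (Rsum_list (fun i => Cmod (f i)) (L0 ++ T) <= m).
    { apply Hub; exists (L0 ++ T); repeat split.
      - apply NoDup_app; trivial; [now apply filterP_NoDup|].
        intros i Hi1 Hi2; apply filterP_In in Hi2; tauto.
      - apply Forall_app; split; trivial.
        rewrite Forall_forall in *; intros i Hi'; apply filterP_In in Hi'.
        apply HA; tauto. }
    rewrite Rsum_list_app in H; lra. }
  exists (fun L => Cmod (Csum_list f L - Csum_list f L0) < eps / 2); split.
  - exists L0; split; trivial.
  - intros u v Hu Hv.
    apply (@norm_compat1 C_AbsRing C_NormedModule).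
    change (Cmod (Csum_list f v + - Csum_list f u) < eps).
    replace (Csum_list f v + - Csum_list f u)%C with
      ((Csum_list f v - Csum_list f L0) + - (Csum_list f u - Csum_list f L0))%C by ring.
    eapply Rle_lt_trans; [apply Cmod_triangle|]; rewrite Cmod_opp; lra. }
destruct Hf as (s & Hs); now rewrite (Csum_eq _ _ _ Hs).
Qed.

Lemma is_Csum_reindex_snd {I J : Type} (i : I) (A : I -> Prop) (f : I -> J -> C) s : A i ->
  is_Csum (fun _ => True) (f i) s ->
  is_Csum (fun ij => (A (fst ij) /\ True) /\ fst ij = i) (fun ij => f (fst ij) (snd ij)) s.
Proof.
intros Hi H; apply is_Csum_ext with (fun ij => f i (snd ij)).
{ intros [i' j] [_ E]; simpl in *; now subst. }
apply (is_Csum_reindex snd _ (fun _ => True) (f i)); trivial.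
- intros [a b] [a' b'] [_ E] [_ E']; simpl in *; congruence.
- intros j _; exists (i, j); simpl; auto.
Qed.

Lemma is_Csum_reindex_fst {I J : Type} (j : J) (A : I -> Prop) (f : I -> J -> C) s :
  is_Csum A (fun i => f i j) s ->
  is_Csum (fun ij => (A (fst ij) /\ True) /\ snd ij = j) (fun ij => f (fst ij) (snd ij)) s.
Proof.
intros H; apply is_Csum_ext with (fun ij => f (fst ij) j).
{ intros [i j'] [_ E]; simpl in *; now subst. }
apply (is_Csum_reindex fst _ A (fun i => f i j)); trivial.
- intros [a b]; simpl; tauto.
- intros [a b] [a' b'] [_ E] [_ E']; simpl in *; congruence.
- intros i Hi; exists (i, j); simpl; auto.
Qed.

(** By fibers over the first component. *)
Lemma is_Csum_prod {I J : Type} (A : I -> Prop) (B : J -> Prop) (f : I -> C) (g : J -> C) s t :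
  summable A (fun i => Cmod (f i)) -> summable B (fun j => Cmod (g j)) ->
  is_Csum A f s -> is_Csum B g t ->
  is_Csum (fun ij => A (fst ij) /\ B (snd ij)) (fun ij => f (fst ij) * g (snd ij))%C (s * t)%C.
Proof.
intros Sf Sg Hs Ht.
set (AB := fun ij => A (fst ij) /\ B (snd ij)).
set (fg := fun ij => (f (fst ij) * g (snd ij))%C).
assert (H : is_Csum AB fg (Csum AB fg)).
{ apply summable_is_Csum.
  apply summable_le with (fun ij => Cmod (f (fst ij)) * Cmod (g (snd ij))).
  - intros; unfold fg; rewrite Cmod_mult; lra.
  - apply (summable_prod A B (fun i => Cmod (f i)) (fun j => Cmod (g j))); auto;
    intros; apply Cmod_ge_0. }
assert (H' : is_Csum A (fun i => f i * t)%C (Csum AB fg)).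
{ apply (is_Csum_fiber fst AB A fg); trivial.
  - intros ij; unfold AB; tauto.
  - intros i Hi.
    apply is_Csum_ext with (fun ij => f i * g (snd ij))%C.
    { intros [i' j] [_ Hj]; unfold fg; simpl in *; congruence. }
    apply is_Csum_scal; apply (is_Csum_reindex snd _ B g); trivial.
    + intros [i' j] [[_ Hj] _]; easy.
    + intros [i1 j1] [i2 j2] [_ H1] [_ H2]; simpl in *; congruence.
    + intros j Hj; exists (i, j); unfold AB; simpl; auto. }
replace (s * t)%C with (Csum AB fg); trivial.
apply (is_Csum_unique A (fun i => f i * t)%C); trivial.
rewrite (Cmult_comm s).
eapply is_Csum_ext; [|apply (is_Csum_scal A t f s Hs)]; intros; simpl; ring.
Qed.

(** The initial segments of nat eventually contain any given finite set. *)
Lemma is_Csum_is_series (f : nat -> C) s :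
  is_Csum (fun _ => True) f s -> @is_series C_AbsRing C_NormedModule f s.
Proof.
intros Hs; unfold is_series.
apply filterlim_ext with (fun n => Csum_list f (rev (seq 0 (S n)))).
{ intros n; induction n as [|n IH]; [unfold Csum_list; simpl; rewrite sum_O; ring|].
  rewrite sum_Sn, <- IH, (seq_S (S n)), rev_app_distr; simpl rev at 1.
  unfold Csum_list; simpl; unfold plus; simpl; ring. }
apply (filterlim_comp _ _ _ _ (Csum_list f) _ (finite_subsets (fun _ => True))); trivial.
intros P (L0 & _ & HP).
exists (list_max L0); intros n Hn; apply HP.
- apply NoDup_rev, seq_NoDup.
- now apply Forall_forall.
- intros i Hi; rewrite <- in_rev; apply in_seq.
  assert (H := proj1 (list_max_le L0 (list_max L0)) (Nat.le_refl _)).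
  rewrite Forall_forall in H; specialize (H i Hi); lia.
Qed.

Lemma is_Csum_CSeries (f : nat -> C) s :
  is_Csum (fun _ => True) f s -> CSeries f = s.
Proof.
intros Hs; apply is_Csum_is_series in Hs.
assert (Hl := filterlim_locally (F := eventually) (sum_n f) s).
destruct s as [x y]; unfold CSeries; f_equal.
- apply is_series_unique; unfold is_series.
  apply filterlim_ext with (fun n => fst (sum_n f n)).
  { intros n; induction n as [|n IH]; [now rewrite !sum_O|].
    rewrite !sum_Sn, <- IH; easy. }
  apply filterlim_locally; intros eps.
  generalize (proj1 Hl Hs eps); apply filter_imp; intros n Hn; apply Hn.
- apply is_series_unique; unfold is_series.
  apply filterlim_ext with (fun n => snd (sum_n f n)).
  { intros n; induction n as [|n IH]; [now rewrite !sum_O|].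
    rewrite !sum_Sn, <- IH; easy. }
  apply filterlim_locally; intros eps.
  generalize (proj1 Hl Hs eps); apply filter_imp; intros n Hn; apply Hn.
Qed.

(** * Complex derivatives *)

Lemma RtoC_neq_0 x : x <> 0 -> RtoC x <> 0.
Proof. intros H E; now apply RtoC_inj in E. Qed.

Lemma Ceq_eps z w : (forall eps, 0 < eps -> Cmod (z - w) <= eps) -> z = w.
Proof.
intros H; apply Ceq_minus, Cmod_eq_0, Rle_antisym; [|apply Cmod_ge_0].
apply le_epsilon; intros eps He; rewrite Rplus_0_l; auto.
Qed.

(** The derivative with respect to the modulus; unlike [is_derive] it does not
   mention which of the two normed modules on C is meant. *)
Definition cderiv (f : C -> C) (z l : C) : Prop :=
  forall eps, 0 < eps -> exists d, 0 < d /\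
    forall w, Cmod (w - z) < d -> Cmod (f w - f z - (w - z) * l) <= eps * Cmod (w - z).

Lemma cderiv_is_derive f z l :
  cderiv f z l <-> @is_derive C_AbsRing (AbsRing_NormedModule C_AbsRing) f z l.
Proof.
split.
- intros H; split; [apply is_linear_scal_l|].
  intros x Hx.
  assert (E : z = x).
  { apply (@is_filter_lim_locally_unique C_AbsRing (AbsRing_NormedModule C_AbsRing)), Hx. }
  subst x; intros eps; destruct (H eps (cond_pos eps)) as (d & Hd & Hw).
  exists (mkposreal d Hd); intros w Hw'; exact (Hw w Hw').
- intros [_ H] eps Heps.
  assert (H' := H z (fun P HP => HP) (mkposreal eps Heps)).
  destruct H' as (d & Hd); exists d; split; [apply cond_pos|].
  intros w Hw; exact (Hd w Hw).
Qed.

Lemma cderiv_C_derive f z l : cderiv f z l -> C_derive f z = l.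
Proof.
intros H; apply is_C_derive_unique; split; [apply is_linear_scal_l|].
exact (proj2 (proj1 (cderiv_is_derive f z l) H)).
Qed.

Lemma cderiv_unique f z l l' : cderiv f z l -> cderiv f z l' -> l = l'.
Proof.
intros H H'; rewrite <- (cderiv_C_derive _ _ _ H); now apply cderiv_C_derive.
Qed.

Lemma cderiv_const c z : cderiv (fun _ => c) z 0.
Proof.
intros eps He; exists 1; split; [lra|]; intros w _.
replace (_ - _)%C with (RtoC 0) by ring; rewrite Cmod_0.
apply Rmult_le_pos; [lra|apply Cmod_ge_0].
Qed.

Lemma cderiv_id z : cderiv (fun w => w) z 1.
Proof.
intros eps He; exists 1; split; [lra|]; intros w _.
replace (_ - _)%C with (RtoC 0) by ring; rewrite Cmod_0.
apply Rmult_le_pos; [lra|apply Cmod_ge_0].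
Qed.

Lemma cderiv_plus f g z a b :
  cderiv f z a -> cderiv g z b -> cderiv (fun w => f w + g w)%C z (a + b)%C.
Proof. rewrite !cderiv_is_derive; apply @is_derive_plus. Qed.

Lemma cderiv_mult f g z a b :
  cderiv f z a -> cderiv g z b -> cderiv (fun w => f w * g w)%C z (a * g z + f z * b)%C.
Proof.
rewrite !cderiv_is_derive; intros Hf Hg; apply (@is_derive_mult C_AbsRing f g); trivial.
apply Cmult_comm.
Qed.

Lemma cderiv_comp f g z a b :
  cderiv f (g z) a -> cderiv g z b -> cderiv (fun w => f (g w)) z (b * a)%C.
Proof. rewrite !cderiv_is_derive; apply (@is_derive_comp C_AbsRing). Qed.

Lemma cderiv_ext_near f g z l d :
  0 < d -> (forall w, Cmod (w - z) < d -> f w = g w) -> cderiv f z l -> cderiv g z l.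
Proof.
intros Hd E H eps He; destruct (H eps He) as (d' & Hd' & Hw).
exists (Rmin d d'); split; [now apply Rmin_glb_lt|]; intros w H'.
rewrite <- !E; [apply Hw| |].
- eapply Rlt_le_trans; [exact H'|apply Rmin_r].
- replace (z - z)%C with (RtoC 0) by ring; now rewrite Cmod_0.
- eapply Rlt_le_trans; [exact H'|apply Rmin_l].
Qed.

Lemma cderiv_ext f g z l : (forall w, f w = g w) -> cderiv f z l -> cderiv g z l.
Proof. intros E; apply (cderiv_ext_near f g z l 1); auto; lra. Qed.

Lemma cderiv_scal c f z a : cderiv f z a -> cderiv (fun w => c * f w)%C z (c * a)%C.
Proof.
intros H; replace (c * a)%C with (0 * f z + c * a)%C by ring.
apply (cderiv_mult (fun _ => c)); trivial; apply cderiv_const.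
Qed.

Lemma cderiv_opp f z a : cderiv f z a -> cderiv (fun w => - f w)%C z (- a)%C.
Proof.
intros H; replace (- a)%C with (- (1) * a)%C by ring.
apply cderiv_ext with (fun w => - (1) * f w)%C; [intros; ring|now apply cderiv_scal].
Qed.

Lemma cderiv_minus f g z a b :
  cderiv f z a -> cderiv g z b -> cderiv (fun w => f w - g w)%C z (a - b)%C.
Proof. intros H H'; apply cderiv_plus; trivial; now apply cderiv_opp. Qed.

Lemma cderiv_pow f z a n :
  cderiv f z a -> cderiv (fun w => f w ^ n)%C z (INR n * f z ^ (n - 1) * a)%C.
Proof.
intros H; induction n as [|n IH].
- simpl; replace (0 * 1 * a)%C with (RtoC 0) by ring; apply cderiv_const.
- replace (INR (S n) * f z ^ (S n - 1) * a)%C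
    with (a * f z ^ n + f z * (INR n * f z ^ (n - 1) * a))%C.
  + now apply (cderiv_mult f (fun w => f w ^ n)%C).
  + rewrite S_INR, RtoC_plus; replace (S n - 1)%nat with n by lia.
    destruct n as [|n]; [simpl; ring|].
    replace (S n - 1)%nat with n by lia; simpl; ring.
Qed.

Lemma cderiv_inv (f : C -> C) z a : f z <> 0 -> cderiv f z a ->
  cderiv (fun w => / f w)%C z (- a / f z ^ 2)%C.
Proof.
intros Hz H.
assert (Hi : cderiv (fun w => / w)%C (f z) (- / (f z * f z))%C).
{ set (u := f z) in *; assert (Hu : 0 < Cmod u) by (apply Cmod_gt_0; exact Hz).
  intros eps He.
  exists (Rmin (Cmod u / 2) (eps * (Cmod u ^ 3 / 2))); split.
  { apply Rmin_glb_lt; [lra|]; apply Rmult_lt_0_compat; trivial.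
    apply Rdiv_lt_0_compat; [now apply pow_lt|lra]. }
  intros w Hw.
  assert (H1 : Cmod (w - u) < Cmod u / 2) by (eapply Rlt_le_trans; [exact Hw|apply Rmin_l]).
  assert (H2 : Cmod (w - u) < eps * (Cmod u ^ 3 / 2))
    by (eapply Rlt_le_trans; [exact Hw|apply Rmin_r]).
  assert (Hwl : Cmod u / 2 < Cmod w).
  { assert (T := Cmod_triangle w (- (w - u))); rewrite Cmod_opp in T.
    replace (w + - (w - u))%C with u in T by ring; lra. }
  assert (Hw0 : w <> 0) by (apply Cmod_gt_0; lra).
  replace (/ w - / u - (w - u) * - / (u * u))%C
    with ((w - u) * ((w - u) * / (w * u * u)))%C by (field; auto).
  rewrite !Cmod_mult, Cmod_inv, !Cmod_mult by (repeat apply Cmult_neq_0; auto).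
  rewrite (Rmult_comm eps); apply Rmult_le_compat_l; [apply Cmod_ge_0|].
  apply (Rmult_le_reg_r (Cmod w * Cmod u * Cmod u));
    [repeat apply Rmult_lt_0_compat; lra|].
  rewrite Rmult_assoc, Rinv_l, Rmult_1_r
    by (repeat apply Rmult_integral_contrapositive_currified; lra).
  apply Rle_trans with (eps * (Cmod u ^ 3 / 2)); [lra|].
  apply Rmult_le_compat_l; [lra|].
  assert (0 < Cmod u * Cmod u) by nra; nra. }
apply (cderiv_comp _ _ _ _ _ Hi) in H.
replace (- a / f z ^ 2)%C with (a * - / (f z * f z))%C; trivial.
simpl; field; trivial.
Qed.

Lemma Rabs_sin_le x : Rabs (sin x) <= Rabs x.
Proof.
destruct (MVT_gen sin 0 x cos) as (c & _ & E).
- intros; apply is_derive_Reals, derivable_pt_lim_sin.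
- intros; apply continuity_sin.
- rewrite sin_0, !Rminus_0_r in E; rewrite E, Rabs_mult.
  assert (B := COS_bound c).
  assert (Rabs (cos c) <= 1) by (apply Rabs_le; lra).
  assert (T := Rabs_pos x); nra.
Qed.

Lemma one_minus_cos_le x : 0 <= 1 - cos x <= x ^ 2 / 2.
Proof.
split; [assert (B := COS_bound x); lra|].
replace x with (2 * (x / 2)) at 1 by field; rewrite cos_2a_sin.
assert (H := Rabs_sin_le (x / 2)).
apply Rsqr_le_abs_1 in H; unfold Rsqr in H; nra.
Qed.

Lemma sin_minus_id_le x : Rabs (sin x - x) <= Rabs x ^ 3 / 2.
Proof.
destruct (MVT_gen (fun x => sin x - x) 0 x (fun x => cos x - 1)) as (c & Hc & E).
- intros; auto_derive; trivial; ring.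
- intros; apply continuity_pt_minus; [apply continuity_sin|apply continuity_pt_id].
- rewrite sin_0, !Rminus_0_r in E; rewrite E, Rabs_mult.
  assert (B := one_minus_cos_le c).
  assert (Hcx : Rabs c <= Rabs x).
  { unfold Rmin, Rmax in Hc; destruct (Rle_dec 0 x) as [H|H].
    - rewrite !Rabs_pos_eq; lra.
    - rewrite !Rabs_left1; lra. }
  assert (Hc2 : c ^ 2 <= Rabs x ^ 2).
  { rewrite <- (pow2_abs c); apply pow_incr; split; [apply Rabs_pos|trivial]. }
  assert (Rabs (cos c - 1) <= Rabs x ^ 2 / 2) by (apply Rabs_le; lra).
  assert (T := Rabs_pos x).
  replace (Rabs x ^ 3 / 2) with ((Rabs x ^ 2 / 2) * Rabs x) by field.
  now apply Rmult_le_compat_r.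
Qed.

(** The upper bound on exp x is the inverse of exp (- x) >= 1 - x. *)
Lemma exp_minus_le x : Rabs x <= 1 / 2 -> Rabs (exp x - 1 - x) <= 2 * x ^ 2.
Proof.
intros H; apply Rabs_le_between in H.
assert (H1 := exp_ineq1_le x); assert (H2 := exp_ineq1_le (- x)).
rewrite exp_Ropp in H2.
apply Rabs_le; split; [assert (T := pow2_ge_0 x); lra|].
enough (exp x <= 1 + x + 2 * x ^ 2) by lra.
assert (E := exp_pos x).
apply (Rmult_le_reg_r (1 - x)); [lra|].
apply Rle_trans with 1; [|nra].
apply (Rmult_le_compat_l (exp x)) in H2; [|lra].
rewrite Rinv_r in H2 by lra; lra.
Qed.

Lemma Cexp_plus z w : Cexp (z + w) = (Cexp z * Cexp w)%C.
Proof.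
unfold Cexp, Re, Im; destruct z as [a b], w as [c d]; simpl.
rewrite exp_plus, cos_plus, sin_plus.
unfold Cmult; simpl; f_equal; ring.
Qed.

Lemma Cexp_0 : Cexp 0 = 1.
Proof. unfold Cexp; simpl; rewrite exp_0, cos_0, sin_0; apply injective_projections; simpl; ring. Qed.

Lemma Cmod_Cexp z : Cmod (Cexp z) = exp (Re z).
Proof.
unfold Cexp, Cmod; simpl fst; simpl snd.
replace (_ + _) with (exp (Re z) ^ 2).
- apply sqrt_pow2, Rlt_le, exp_pos.
- assert (T := sin2_cos2 (Im z)); unfold Rsqr in T.
  transitivity (exp (Re z) ^ 2 * (sin (Im z) * sin (Im z) + cos (Im z) * cos (Im z)));
    [rewrite T|]; ring.
Qed.

Lemma Cexp_neq_0 z : Cexp z <> 0.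
Proof. apply Cmod_gt_0; rewrite Cmod_Cexp; apply exp_pos. Qed.

Lemma Cmod_le_abs x y : Cmod (x, y) <= Rabs x + Rabs y.
Proof.
replace (x, y) with (RtoC x + Ci * RtoC y)%C.
- eapply Rle_trans; [apply Cmod_triangle|].
  rewrite Cmod_mult, Cmod_Ci, !Cmod_R; lra.
- apply injective_projections; simpl; ring.
Qed.

Lemma im_le_Cmod z : Rabs (Im z) <= Cmod z.
Proof. eapply Rle_trans; [|apply Rmax_Cmod]; apply Rmax_r. Qed.

Lemma Cexp_minus_le h : Cmod h <= 1 / 2 -> Cmod (Cexp h - 1 - h) <= 10 * Cmod h ^ 2.
Proof.
intros H; destruct h as [x y].
assert (Hx := re_le_Cmod (x, y)); assert (Hy := im_le_Cmod (x, y)); simpl in Hx, Hy.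
set (r := Cmod (x, y)) in *.
assert (Px := Rabs_pos x); assert (Py := Rabs_pos y).
assert (Ex := exp_minus_le x ltac:(lra)).
assert (Ec := one_minus_cos_le y); assert (Es := sin_minus_id_le y).
assert (X2 : x ^ 2 <= r ^ 2) by (rewrite <- (pow2_abs x); apply pow_incr; lra).
assert (Y2 : y ^ 2 <= r ^ 2) by (rewrite <- (pow2_abs y); apply pow_incr; lra).
assert (Y3 : Rabs y ^ 3 <= r ^ 2).
{ apply Rle_trans with (r ^ 3); [apply pow_incr; lra|].
  assert (T := pow2_ge_0 r); simpl in *; nra. }
assert (Hex : exp x <= 2).
{ apply Rabs_le_between in Ex.
  assert (x <= 1 / 2) by (apply Rle_trans with (Rabs x); [apply RRle_abs|lra]).
  assert (r ^ 2 <= 1 / 4) by (assert (0 <= r) by lra; simpl; nra); lra. }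
assert (Hep := exp_pos x).
replace (Cexp (x, y) - 1 - (x, y))%C
  with (exp x * (cos y - 1) + (exp x - 1 - x), exp x * (sin y - y) + y * (exp x - 1)).
2:{ unfold Cexp; apply injective_projections; simpl; ring. }
eapply Rle_trans; [apply Cmod_le_abs|].
assert (A1 : Rabs (exp x * (cos y - 1)) <= r ^ 2).
{ rewrite Rabs_mult, (Rabs_pos_eq (exp x)) by lra.
  rewrite (Rabs_left1 (cos y - 1)) by lra; nra. }
assert (A2 : Rabs (exp x * (sin y - y)) <= r ^ 2).
{ rewrite Rabs_mult, (Rabs_pos_eq (exp x)) by lra.
  assert (T := Rabs_pos (sin y - y)); nra. }
assert (A3 : Rabs (y * (exp x - 1)) <= 4 * r ^ 2).
{ rewrite Rabs_mult.
  assert (Rabs (exp x - 1) <= 2 * r).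
  { replace (exp x - 1) with ((exp x - 1 - x) + x) by ring.
    eapply Rle_trans; [apply Rabs_triang|]; nra. }
  assert (T := Rabs_pos (exp x - 1)); nra. }
assert (B1 := Rabs_triang (exp x * (cos y - 1)) (exp x - 1 - x)).
assert (B2 := Rabs_triang (exp x * (sin y - y)) (y * (exp x - 1))).
lra.
Qed.

Lemma cderiv_Cexp z : cderiv Cexp z (Cexp z).
Proof.
intros eps He.
assert (Hm : 0 < Cmod (Cexp z)) by apply Cmod_gt_0, Cexp_neq_0.
exists (Rmin (1 / 2) (eps / (10 * Cmod (Cexp z)))); split.
{ apply Rmin_glb_lt; [lra|apply Rdiv_lt_0_compat; lra]. }
intros w Hw.
assert (H1 : Cmod (w - z) < 1 / 2) by (eapply Rlt_le_trans; [exact Hw|apply Rmin_l]).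
assert (H2 : Cmod (w - z) < eps / (10 * Cmod (Cexp z)))
  by (eapply Rlt_le_trans; [exact Hw|apply Rmin_r]).
replace w with (z + (w - z))%C at 1 by ring; rewrite Cexp_plus.
replace (_ - _)%C with (Cexp z * (Cexp (w - z) - 1 - (w - z)))%C by ring.
rewrite Cmod_mult.
apply Rle_trans with (Cmod (Cexp z) * (10 * Cmod (w - z) ^ 2)).
- apply Rmult_le_compat_l; [lra|]; apply Cexp_minus_le; lra.
- apply (Rmult_lt_compat_r (10 * Cmod (Cexp z))) in H2; [|lra].
  replace (eps / (10 * Cmod (Cexp z)) * (10 * Cmod (Cexp z))) with eps in H2 by (field; lra).
  assert (H3 := Cmod_ge_0 (w - z)); simpl; nra.
Qed.

(** * Mean value estimates and termwise differentiation *)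

(** Restricting to a segment reduces mean value estimates to the real mean value
   theorem. *)
Lemma cderiv_Re_segment f z h (t : R) l :
  cderiv f (z + t * h) l -> is_derive (fun t : R => Re (f (z + t * h)%C)) t (Re (h * l)).
Proof.
intros H; apply is_derive_Reals; intros eps He.
assert (Hh := Cmod_ge_0 h).
destruct (H (eps / (2 * (Cmod h + 1)))) as (d & Hd & Hw).
{ apply Rdiv_lt_0_compat; lra. }
assert (Hd' : 0 < d / (Cmod h + 1)) by (apply Rdiv_lt_0_compat; lra).
exists (mkposreal _ Hd'); intros k Hk Hkd; simpl pos in Hkd.
assert (E : (z + (t + k)%R * h - (z + t * h))%C = (k * h)%C) by (rewrite RtoC_plus; ring).
specialize (Hw (z + (t + k)%R * h)%C); rewrite E, Cmod_mult, Cmod_R in Hw.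
assert (Pk : 0 < Rabs k) by now apply Rabs_pos_lt.
assert (Hlt : Rabs k * Cmod h < d).
{ apply (Rmult_lt_compat_r (Cmod h + 1)) in Hkd; [|lra].
  replace (d / (Cmod h + 1) * (Cmod h + 1)) with d in Hkd by (field; lra); nra. }
specialize (Hw Hlt).
replace ((Re (f (z + (t + k)%R * h)%C) - Re (f (z + t * h)%C)) / k - Re (h * l))
  with (Re (f (z + (t + k)%R * h)%C - f (z + t * h)%C - k * h * l)%C / k).
2:{ unfold Cminus; rewrite !re_plus, !re_opp, <- Cmult_assoc, re_scal_l; field; trivial. }
unfold Rdiv at 1; rewrite Rabs_mult, Rabs_inv.
apply (Rmult_lt_reg_r (Rabs k)); trivial.
rewrite Rmult_assoc, Rinv_l, Rmult_1_r by lra.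
eapply Rle_lt_trans; [apply re_le_Cmod|].
eapply Rle_lt_trans; [exact Hw|].
replace (eps / (2 * (Cmod h + 1)) * (Rabs k * Cmod h))
  with (eps * Rabs k * (Cmod h / (2 * (Cmod h + 1)))) by (field; lra).
assert (Cmod h / (2 * (Cmod h + 1)) < 1) by (apply Rlt_div_l; lra).
assert (0 < eps * Rabs k) by nra; nra.
Qed.

Lemma cderiv_Re_bound f f' z h B :
  (forall t : R, 0 <= t <= 1 -> cderiv f (z + t * h)%C (f' (z + t * h)%C) /\
     Cmod (f' (z + t * h)%C) <= B) ->
  Rabs (Re (f (z + h)%C - f z)) <= B * Cmod h.
Proof.
intros H.
destruct (MVT_gen (fun t : R => Re (f (z + t * h)%C)) 0 1 (fun t => Re (h * f' (z + t * h)%C)))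
  as (c & Hc & E).
- intros t Ht; rewrite Rmin_left, Rmax_right in Ht by lra.
  apply cderiv_Re_segment, H; lra.
- intros t Ht; rewrite Rmin_left, Rmax_right in Ht by lra.
  apply derivable_continuous_pt; exists (Re (h * f' (z + t * h)%C)).
  apply is_derive_Reals, cderiv_Re_segment, H; lra.
- rewrite Rmin_left, Rmax_right in Hc by lra.
  rewrite Cmult_1_l, Cmult_0_l, Cplus_0_r, Rminus_0_r, Rmult_1_r in E.
  unfold Cminus; rewrite re_plus, re_opp; change (_ + - ?x) with (Re (f (z + h)%C) - x).
  rewrite E; eapply Rle_trans; [apply re_le_Cmod|]; rewrite Cmod_mult, Rmult_comm.
  apply Rmult_le_compat_r; [apply Cmod_ge_0|]; now apply H.
Qed.

(** Real and imaginary parts are estimated separately, whence the factor 2. *)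
Lemma cderiv_bound f f' z h B :
  (forall t : R, 0 <= t <= 1 -> cderiv f (z + t * h)%C (f' (z + t * h)%C) /\
     Cmod (f' (z + t * h)%C) <= B) ->
  Cmod (f (z + h)%C - f z) <= 2 * B * Cmod h.
Proof.
intros H.
assert (H1 := cderiv_Re_bound f f' z h B H).
assert (H2 : Rabs (Im (f (z + h)%C - f z)) <= B * Cmod h).
{ replace (Im _) with (Re (- Ci * f (z + h)%C - - Ci * f z)).
  - apply (cderiv_Re_bound (fun w => - Ci * f w)%C (fun w => - Ci * f' w)%C).
    intros t Ht; destruct (H t Ht) as (Ha & Hb); split; [now apply cderiv_scal|].
    rewrite Cmod_mult, Cmod_opp, Cmod_Ci; lra.
  - destruct (f (z + h)%C), (f z); simpl; ring. }
rewrite (surjective_pairing (f (z + h)%C - f z)%C).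
eapply Rle_trans; [apply Cmod_le_abs|]; unfold Re, Im in *; lra.
Qed.

Lemma Cball_segment z0 w (t : R) r :
  Cmod (w - z0) < r -> 0 <= t <= 1 -> Cmod (z0 + t * (w - z0) - z0) < r.
Proof.
intros H Ht; replace (_ - _)%C with (t * (w - z0))%C by ring.
rewrite Cmod_mult, Cmod_R, Rabs_pos_eq by lra.
assert (T := Cmod_ge_0 (w - z0)); nra.
Qed.

(** The mean value estimate is applied to f' and then to f minus its linear part. *)
Lemma cderiv_taylor2 f f' f'' z0 r B :
  (forall w, Cmod (w - z0) < r -> cderiv f w (f' w) /\ cderiv f' w (f'' w) /\ Cmod (f'' w) <= B) ->
  forall w, Cmod (w - z0) < r ->
  Cmod (f w - f z0 - (w - z0) * f' z0) <= 4 * B * Cmod (w - z0) ^ 2.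
Proof.
intros H w Hw.
assert (HB : 0 <= B).
{ eapply Rle_trans; [apply (Cmod_ge_0 (f'' w))|]; now apply H. }
assert (H1 : forall v, Cmod (v - z0) < r -> Cmod (f' v - f' z0) <= 2 * B * Cmod (v - z0)).
{ intros v Hv; replace v with (z0 + (v - z0))%C at 1 by ring.
  apply (cderiv_bound f' f''); intros t Ht; apply H, Cball_segment; trivial. }
assert (H2 : Cmod ((f (z0 + (w - z0))%C - (z0 + (w - z0)) * f' z0) - (f z0 - z0 * f' z0))
  <= 2 * (2 * B * Cmod (w - z0)) * Cmod (w - z0)).
{ apply (cderiv_bound (fun v => f v - v * f' z0)%C (fun v => f' v - f' z0)%C).
  intros t Ht; assert (Hb := Cball_segment z0 w t r Hw Ht); split.
  - apply cderiv_minus; [now apply H|].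
    apply cderiv_ext with (fun v => f' z0 * v)%C; [intros; ring|].
    assert (Q := cderiv_scal (f' z0) _ _ _ (cderiv_id (z0 + t * (w - z0))%C)).
    now rewrite Cmult_1_r in Q.
  - eapply Rle_trans; [now apply H1|].
    apply Rmult_le_compat_l; [lra|].
    replace (_ - _)%C with (t * (w - z0))%C by ring.
    rewrite Cmod_mult, Cmod_R, Rabs_pos_eq by lra.
    assert (T := Cmod_ge_0 (w - z0)); nra. }
replace (z0 + (w - z0))%C with w in H2 by ring.
replace (f w - f z0 - (w - z0) * f' z0)%C
  with ((f w - w * f' z0) - (f z0 - z0 * f' z0))%C by ring.
simpl; lra.
Qed.

(** A locally uniform summable bound on the second
   derivatives controls the remainders of the first order expansions of all the
   terms at once. *)
Lemma Csum_cderiv {I : Type} (A : I -> Prop) (f f' f'' : I -> C -> C) (K : I -> R) z0 r :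
  0 < r -> summable A K ->
  (forall i w, A i -> Cmod (w - z0) < r ->
     cderiv (f i) w (f' i w) /\ cderiv (f' i) w (f'' i w) /\
     Cmod (f i w) <= K i /\ Cmod (f' i w) <= K i /\ Cmod (f'' i w) <= K i) ->
  cderiv (fun w => Csum A (fun i => f i w)) z0 (Csum A (fun i => f' i z0)).
Proof.
intros Hr HK H.
assert (Hz0 : Cmod (z0 - z0) < r).
{ replace (z0 - z0)%C with (RtoC 0) by ring; now rewrite Cmod_0. }
assert (S : forall w, Cmod (w - z0) < r -> is_Csum A (fun i => f i w) (Csum A (fun i => f i w))).
{ intros w Hw; apply summable_is_Csum; apply summable_le with K; trivial.
  intros i Hi; now apply H. }
assert (S' : is_Csum A (fun i => f' i z0) (Csum A (fun i => f' i z0))).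
{ apply summable_is_Csum; apply summable_le with K; trivial.
  intros i Hi; now apply H. }
destruct HK as (B & HB).
assert (HB0 : 0 <= B).
{ eapply Rle_trans; [|apply (HB nil)]; [unfold Rsum_list; simpl; lra| |]; constructor. }
intros eps He; exists (Rmin r (eps / (4 * (B + 1)))); split.
{ apply Rmin_glb_lt; trivial; apply Rdiv_lt_0_compat; lra. }
intros w Hw.
assert (H1 : Cmod (w - z0) < r) by (eapply Rlt_le_trans; [exact Hw|apply Rmin_l]).
assert (H2 : Cmod (w - z0) < eps / (4 * (B + 1)))
  by (eapply Rlt_le_trans; [exact Hw|apply Rmin_r]).
assert (T := Cmod_ge_0 (w - z0)).
apply Rle_trans with (4 * Cmod (w - z0) ^ 2 * B).
- eapply is_Csum_Cmod_le.
  + apply is_Csum_minus; [apply is_Csum_minus; apply S; trivial|].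
    apply is_Csum_scal, S'.
  + intros L HL HA; eapply Rle_trans; [apply Csum_list_Cmod|].
    apply Rle_trans with (Rsum_list (fun i => 4 * Cmod (w - z0) ^ 2 * K i) L).
    * apply (Rsum_list_le A); trivial; intros i Hi.
      replace (4 * Cmod (w - z0) ^ 2 * K i) with (4 * K i * Cmod (w - z0) ^ 2) by ring.
      apply (cderiv_taylor2 (f i) (f' i) (f'' i) z0 r); trivial.
      intros v Hv; destruct (H i v Hi Hv); tauto.
    * rewrite Rsum_list_scal; apply Rmult_le_compat_l; auto.
      assert (Q := pow2_ge_0 (Cmod (w - z0))); lra.
- apply (Rmult_lt_compat_r (4 * (B + 1))) in H2; [|lra].
  replace (eps / (4 * (B + 1)) * (4 * (B + 1))) with eps in H2 by (field; lra).
  simpl; nra.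
Qed.

(** * Basic absolutely convergent families *)

Lemma summable_of_series (g : nat -> R) :
  (forall n, 0 <= g n) -> ex_series g -> summable (fun _ => True) g.
Proof.
intros Hg (s & Hs); exists s; intros L HL _.
set (N := list_max L).
apply Rle_trans with (sum_n g N).
- apply Rle_trans with (Rsum_list g (seq 0 (S N))).
  + apply Rsum_list_incl; auto; intros i Hi; apply in_seq.
    assert (H := proj1 (list_max_le L N) (Nat.le_refl _)).
    rewrite Forall_forall in H; specialize (H i Hi); lia.
  + apply Req_le; clear; induction N as [|N IH]; [unfold Rsum_list; simpl; rewrite sum_O; ring|].
    rewrite seq_S, Rsum_list_app, IH, sum_Sn; unfold Rsum_list; simpl; unfold plus; simpl; ring.
- apply (is_lim_seq_incr_compare (sum_n g)); [exact Hs|].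
  intros n; rewrite sum_Sn; unfold plus; simpl; specialize (Hg (S n)); lra.
Qed.

(** Comparison with the telescoping terms 3 (1/(n+1) - 1/(n+2)). *)
Lemma summable_nat_inv_sq : summable (fun _ => True) (fun n : nat => / (1 + INR n ^ 2)).
Proof.
assert (T : forall N, Rsum_list (fun n => / (1 + INR n ^ 2)) (seq 0 N) <= 3 * (1 - / (INR N + 1))).
{ induction N as [|N IH]; [unfold Rsum_list; simpl; rewrite Rplus_0_l, Rinv_1; lra|].
  rewrite seq_S, Rsum_list_app, S_INR.
  change (Rsum_list (fun n => / (1 + INR n ^ 2)) [(0 + N)%nat]) with (/ (1 + INR N ^ 2) + 0).
  set (x := INR N) in *.
  assert (Hx : 0 <= x) by apply pos_INR.
  assert (Hx1 : 0 <= (2 * x - 1) * (x - 1)).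
  { unfold x; destruct N as [|[|N]]; [simpl; lra|simpl; lra|].
    rewrite !S_INR; assert (P := pos_INR N); nra. }
  assert (/ (1 + x ^ 2) <= 3 * (/ (x + 1) - / (x + 1 + 1))).
  { apply (Rmult_le_reg_r ((1 + x ^ 2) * ((x + 1) * (x + 1 + 1)))); [nra|].
    replace (/ (1 + x ^ 2) * ((1 + x ^ 2) * ((x + 1) * (x + 1 + 1))))
      with ((x + 1) * (x + 1 + 1)) by (field; nra).
    replace (3 * (/ (x + 1) - / (x + 1 + 1)) * ((1 + x ^ 2) * ((x + 1) * (x + 1 + 1))))
      with (3 * (1 + x ^ 2)) by (field; lra).
    nra. }
  lra. }
exists 3; intros L HL _; apply Rle_trans with (Rsum_list (fun n => / (1 + INR n ^ 2)) (seq 0 (S (list_max L)))).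
- apply Rsum_list_incl; auto.
  + intros i Hi; apply in_seq.
    assert (H := proj1 (list_max_le L (list_max L)) (Nat.le_refl _)).
    rewrite Forall_forall in H; specialize (H i Hi); lia.
  + intros i _; apply Rlt_le, Rinv_0_lt_compat; assert (P := pow2_ge_0 (INR i)); lra.
- eapply Rle_trans; [apply T|].
  assert (0 < / (INR (S (list_max L)) + 1)).
  { apply Rinv_0_lt_compat; assert (P := pos_INR (S (list_max L))); lra. }
  lra.
Qed.

Lemma summable_Z_inv_sq : summable (fun _ => True) (fun n : Z => / (1 + IZR n ^ 2)).
Proof.
assert (E : forall n, / (1 + IZR n ^ 2) = / (1 + INR (Z.abs_nat n) ^ 2)).
{ intros n; rewrite INR_IZR_INZ, Zabs2Nat.id_abs, abs_IZR, pow2_abs; easy. }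
apply (summable_split _ (fun n => (0 <= n)%Z)).
- apply summable_le with (fun n => / (1 + INR (Z.abs_nat n) ^ 2)).
  { intros; rewrite E; lra. }
  apply (summable_inj Z.abs_nat _ (fun _ => True) (fun n => / (1 + INR n ^ 2))); trivial;
    [|exact summable_nat_inv_sq]; intros; lia.
- apply summable_le with (fun n => / (1 + INR (Z.abs_nat n) ^ 2)).
  { intros; rewrite E; lra. }
  apply (summable_inj Z.abs_nat _ (fun _ => True) (fun n => / (1 + INR n ^ 2))); trivial;
    [|exact summable_nat_inv_sq]; intros; lia.
Qed.

Lemma ex_series_pow_geom k r : 0 < r < 1 ->
  ex_series (fun n : nat => (INR n + 1) ^ k * r ^ n).
Proof.
intros Hr.
assert (Hp : forall n, 0 < INR n + 1) by (intros n; assert (P := pos_INR n); lra).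
assert (L : is_lim_seq (fun n => 1 + / (INR n + 1)) 1).
{ replace (Finite 1) with (Finite (1 + 0)) by (f_equal; ring).
  apply is_lim_seq_plus'; [apply is_lim_seq_const|].
  apply is_lim_seq_ext with (fun n => / INR (S n)).
  { intros n; now rewrite S_INR. }
  replace (Finite 0) with (Rbar_inv p_infty) by easy.
  apply is_lim_seq_inv; [|easy]; apply (is_lim_seq_incr_1 INR), is_lim_seq_INR. }
apply ex_series_ext with (fun n => Rabs ((INR n + 1) ^ k * r ^ n)).
{ intros n; apply Rabs_pos_eq, Rmult_le_pos; apply pow_le; specialize (Hp n); lra. }
apply (ex_series_DAlembert _ r); [lra| |].
- intros n; apply Rmult_integral_contrapositive_currified; apply pow_nonzero;
  specialize (Hp n); lra.
- apply is_lim_seq_ext with (fun n => (1 + / (INR n + 1)) ^ k * r).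
  + intros n; rewrite S_INR; specialize (Hp n).
    replace (1 + / (INR n + 1)) with ((INR n + 1 + 1) / (INR n + 1)) by (field; lra).
    unfold Rdiv at 1; rewrite Rpow_mult_distr, pow_inv.
    assert (0 < (INR n + 1) ^ k) by now apply pow_lt.
    assert (0 < (INR n + 1 + 1) ^ k) by (apply pow_lt; lra).
    assert (0 < r ^ n) by (apply pow_lt; lra).
    rewrite Rabs_pos_eq.
    * simpl (r ^ S n); field; lra.
    * simpl (r ^ S n); apply Rlt_le, Rdiv_lt_0_compat; [|nra].
      apply Rmult_lt_0_compat; nra.
  + replace (Finite r) with (Finite (1 * r)) by (f_equal; ring).
    apply is_lim_seq_mult'; [|apply is_lim_seq_const].
    clear -L; induction k as [|k IH]; [simpl; apply is_lim_seq_const|].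
    replace (Finite 1) with (Finite (1 * 1)) by (f_equal; ring).
    simpl; now apply is_lim_seq_mult'.
Qed.

Lemma summable_pow_geom k r : 0 <= r < 1 ->
  summable (fun _ => True) (fun n : nat => INR n ^ k * r ^ n).
Proof.
intros Hr.
apply summable_le with (fun n => (INR n + 1) ^ k * ((1 + r) / 2) ^ n).
- intros n _; assert (P := pos_INR n).
  apply Rmult_le_compat; try (apply pow_le; lra); apply pow_incr; lra.
- apply summable_of_series; [|apply ex_series_pow_geom; lra].
  intros n; assert (P := pos_INR n); apply Rmult_le_pos; apply pow_le; lra.
Qed.

(** * Partial fractions of the squared cosecant *)

Lemma exp_monotone x y : x <= y -> exp x <= exp y.
Proof.
intros [H| ->]; [left; now apply exp_increasing|lra].
Qed.

Lemma Cexp_scal_inv z : (Cexp z * Cexp (- z))%C = 1.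
Proof. rewrite <- Cexp_plus, <- Cexp_0; f_equal; ring. Qed.

Lemma qexp_plus z w : qexp (z + w) = (qexp z * qexp w)%C.
Proof. unfold qexp; rewrite <- Cexp_plus; f_equal; ring. Qed.

Lemma qexp_0 : qexp 0 = 1.
Proof. unfold qexp; rewrite <- Cexp_0; f_equal; ring. Qed.

Lemma qexp_neq_0 z : qexp z <> 0.
Proof. apply Cexp_neq_0. Qed.

Lemma qexp_half : qexp (/ 2) = (- (1))%C.
Proof.
unfold qexp; replace (2 * PI * Ci * / 2)%C with (0, PI).
- unfold Cexp; simpl; rewrite cos_PI, sin_PI, exp_0; apply injective_projections; simpl; ring.
- replace (2 * PI * Ci * / 2)%C with (PI * Ci)%C by field.
  apply injective_projections; simpl; ring.
Qed.

Lemma qexp_1 : qexp 1 = 1.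
Proof.
replace (RtoC 1) with (/ 2 + / 2)%C at 1 by field.
rewrite qexp_plus, qexp_half; ring.
Qed.

Lemma qexp_Z n : qexp (IZR n) = 1.
Proof.
induction n as [|n IH|n IH] using Z.peano_ind; [apply qexp_0| |].
- unfold Z.succ; rewrite plus_IZR, RtoC_plus, qexp_plus, IH, qexp_1; ring.
- assert (E : qexp (IZR n) = (qexp (IZR (Z.pred n)) * qexp 1)%C).
  { rewrite <- qexp_plus, <- RtoC_plus, <- plus_IZR; do 3 f_equal; lia. }
  rewrite IH, qexp_1, Cmult_1_r in E; easy.
Qed.

Lemma qexp_shift z n : qexp (z + IZR n) = qexp z.
Proof. rewrite qexp_plus, qexp_Z; ring. Qed.

Lemma qexp_opp z : qexp (- z) = (/ qexp z)%C.
Proof.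
assert (E : (qexp z * qexp (- z))%C = 1).
{ rewrite <- qexp_plus, <- qexp_0; f_equal; ring. }
replace (qexp (- z)) with (/ qexp z * (qexp z * qexp (- z)))%C.
- rewrite E; ring.
- field; apply qexp_neq_0.
Qed.

Lemma Cmod_qexp z : Cmod (qexp z) = exp (- (2 * PI * Im z)).
Proof.
unfold qexp; rewrite Cmod_Cexp; f_equal.
replace (2 * PI * Ci * z)%C with ((2 * PI)%R * (z * Ci))%C by (rewrite RtoC_mult; ring).
rewrite re_scal_l, re_mult_Ci; ring.
Qed.

Lemma Cmod_qexp_lt_1 z : 0 < Im z -> Cmod (qexp z) < 1.
Proof.
intros H; rewrite Cmod_qexp, <- exp_0; apply exp_increasing.
assert (P := PI_RGT_0); nra.
Qed.

Lemma qexp_neq_1 z : 0 < Im z -> qexp z <> 1.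
Proof.
intros H E; apply Cmod_qexp_lt_1 in H; rewrite E, Cmod_1 in H; lra.
Qed.

(** Poles of the lattice sum, at the integers, are points where q = 1; stating
   the domain as q <> 1 makes it visibly stable under halving. *)
Lemma qexp_neq_1_shift z n : qexp z <> 1 -> (z + IZR n)%C <> 0.
Proof.
intros H E; apply H; rewrite <- (qexp_shift z n), E; apply qexp_0.
Qed.

(** The sum over a >= 1 of a q^a, in closed form. *)
Definition geom2 (z : C) : C := (qexp z / (1 - qexp z) ^ 2)%C.

Definition Csin (w : C) : C := ((Cexp (Ci * w) - Cexp (- (Ci * w))) / (2 * Ci))%C.
Definition Ccos (w : C) : C := ((Cexp (Ci * w) + Cexp (- (Ci * w))) / 2)%C.

Lemma Ci_sqr : (Ci * Ci)%C = (- (1))%C.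
Proof. apply injective_projections; simpl; ring. Qed.

(** From 1 - q = -2i e^(i pi z) sin (pi z). *)
Lemma geom2_Csin z : qexp z <> 1 ->
  Csin (PI * z) <> 0 /\ (4 * PI ^ 2 * geom2 z)%C = (- (PI ^ 2 / Csin (PI * z) ^ 2))%C.
Proof.
intros Hz.
set (x := Cexp (Ci * (PI * z))); set (y := Cexp (- (Ci * (PI * z)))).
assert (Exy : (x * y)%C = 1) by apply Cexp_scal_inv.
assert (Eq : qexp z = (x * x)%C).
{ unfold qexp, x; rewrite <- Cexp_plus; f_equal; ring. }
assert (Hx : x <> 0) by apply Cexp_neq_0.
assert (Ey : y = (/ x)%C).
{ replace y with (/ x * (x * y))%C by (field; trivial); rewrite Exy; ring. }
assert (Hd : (1 - x * x)%C <> 0).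
{ intros E; apply Hz; rewrite Eq; replace (x * x)%C with (1 - (1 - x * x))%C by ring.
  rewrite E; ring. }
assert (Es : Csin (PI * z) = (Ci * ((1 - x * x) / (2 * x)))%C).
{ unfold Csin; fold x y; rewrite Ey.
  transitivity (- (1) * ((x - / x) / (2 * (- (1) * Ci))))%C; [field; split; trivial; apply Ci_nz|].
  rewrite <- Ci_sqr at 1; field; split; trivial; apply Ci_nz. }
assert (Hs : Csin (PI * z) <> 0).
{ rewrite Es; apply Cmult_neq_0; [apply Ci_nz|].
  apply Cmult_neq_0; trivial.
  intros E; apply C1_nz; rewrite <- (Cinv_l (2 * x)), E; [ring|].
  apply Cmult_neq_0; trivial; apply RtoC_neq_0; lra. }
split; trivial.
unfold geom2; rewrite Eq, Es.
replace ((Ci * ((1 - x * x) / (2 * x))) ^ 2)%C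
  with ((Ci * Ci) * ((1 - x * x) / (2 * x)) ^ 2)%C by (simpl; ring).
rewrite Ci_sqr; field; repeat split; trivial; apply RtoC_neq_0; lra.
Qed.

Lemma cderiv_Cexp_scal c w : cderiv (fun w => Cexp (c * w)) w (c * Cexp (c * w))%C.
Proof.
apply cderiv_comp with (f := Cexp); [apply cderiv_Cexp|].
assert (Q := cderiv_scal c _ _ _ (cderiv_id w)); now rewrite Cmult_1_r in Q.
Qed.

Lemma cderiv_Csin w : cderiv Csin w (Ccos w).
Proof.
unfold Csin, Ccos.
apply cderiv_ext with (fun v => / (2 * Ci) * (Cexp (Ci * v) - Cexp (- Ci * v)))%C.
{ intros v; replace (- Ci * v)%C with (- (Ci * v))%C by ring; field; apply Ci_nz. }
replace ((Cexp (Ci * w) + Cexp (- (Ci * w))) / 2)%C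
  with (/ (2 * Ci) * (Ci * Cexp (Ci * w) - - Ci * Cexp (- Ci * w)))%C.
- apply cderiv_scal, cderiv_minus; apply cderiv_Cexp_scal.
- replace (- Ci * w)%C with (- (Ci * w))%C by ring; field; apply Ci_nz.
Qed.

Lemma cderiv_Ccos w : cderiv Ccos w (- Csin w)%C.
Proof.
unfold Csin, Ccos.
apply cderiv_ext with (fun v => / 2 * (Cexp (Ci * v) + Cexp (- Ci * v)))%C.
{ intros v; replace (- Ci * v)%C with (- (Ci * v))%C by ring; field. }
replace (- ((Cexp (Ci * w) - Cexp (- (Ci * w))) / (2 * Ci)))%C
  with (/ 2 * (Ci * Cexp (Ci * w) + - Ci * Cexp (- Ci * w)))%C.
- apply cderiv_scal, cderiv_plus; apply cderiv_Cexp_scal.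
- replace (- Ci * w)%C with (- (Ci * w))%C by ring.
  transitivity ((Ci * Ci) * ((Cexp (Ci * w) - Cexp (- (Ci * w))) / (2 * Ci)))%C;
    [field; apply Ci_nz|rewrite Ci_sqr; ring].
Qed.

Lemma Csin_0 : Csin 0 = 0.
Proof.
unfold Csin; replace (Ci * 0)%C with (RtoC 0) by ring.
replace (- 0)%C with (RtoC 0) by ring; field; apply Ci_nz.
Qed.

Lemma Ccos_0 : Ccos 0 = 1.
Proof.
unfold Ccos; replace (Ci * 0)%C with (RtoC 0) by ring.
replace (- 0)%C with (RtoC 0) by ring; rewrite Cexp_0; field.
Qed.

Lemma Cmod_Ccos_le w r : Cmod w <= r -> Cmod (Ccos w) <= exp r.
Proof.
intros H; assert (Hw := im_le_Cmod w); apply Rabs_le_between in Hw.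
unfold Ccos; rewrite Cmod_div by (apply RtoC_neq_0; lra).
rewrite Cmod_R, Rabs_pos_eq by lra.
apply Rle_div_l; [lra|].
eapply Rle_trans; [apply Cmod_triangle|]; rewrite !Cmod_Cexp.
assert (E1 : Re (Ci * w) = - Im w) by (destruct w; simpl; ring).
rewrite re_opp, E1, Ropp_involutive.
assert (exp (- Im w) <= exp r) by (apply exp_monotone; lra).
assert (exp (Im w) <= exp r) by (apply exp_monotone; lra).
lra.
Qed.

(** Three mean value estimates, starting from the bound on the cosine and using
   that sine and cosine are, up to sign, the derivatives of each other. *)
Lemma Csin_taylor w r : Cmod w <= r -> Cmod (Csin w - w) <= 8 * exp r * Cmod w ^ 3.
Proof.
intros Hr.
assert (Seg : forall v (t : R), Cmod v <= r -> 0 <= t <= 1 -> Cmod (0 + t * v) <= Cmod v).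
{ intros v t Hv Ht; rewrite Cplus_0_l, Cmod_mult, Cmod_R, Rabs_pos_eq by lra.
  assert (T := Cmod_ge_0 v); nra. }
assert (H1 : forall v, Cmod v <= r -> Cmod (Csin v) <= 2 * exp r * Cmod v).
{ intros v Hv; replace (Csin v) with (Csin (0 + v) - Csin 0)%C by (rewrite Csin_0, Cplus_0_l; ring).
  apply (cderiv_bound Csin Ccos); intros t Ht; split; [apply cderiv_Csin|].
  apply Cmod_Ccos_le; eapply Rle_trans; [apply Seg|]; trivial. }
assert (Pe := exp_pos r).
assert (H2 : forall v, Cmod v <= r -> Cmod (Ccos v - 1) <= 4 * exp r * Cmod v ^ 2).
{ intros v Hv; replace (Ccos v - 1)%C with (Ccos (0 + v) - Ccos 0)%C by (rewrite Ccos_0, Cplus_0_l; ring).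
  replace (4 * exp r * Cmod v ^ 2) with (2 * (2 * exp r * Cmod v) * Cmod v) by ring.
  apply (cderiv_bound Ccos (fun v => - Csin v)%C); intros t Ht; split; [apply cderiv_Ccos|].
  assert (S := Seg v t Hv Ht).
  rewrite Cmod_opp; eapply Rle_trans; [apply H1; lra|]; nra. }
replace (Csin w - w)%C with ((Csin (0 + w) - (0 + w)) - (Csin 0 - 0))%C
  by (rewrite Csin_0, Cplus_0_l; ring).
replace (8 * exp r * Cmod w ^ 3) with (2 * (4 * exp r * Cmod w ^ 2) * Cmod w) by ring.
apply (cderiv_bound (fun v => Csin v - v)%C (fun v => Ccos v - 1)%C); intros t Ht; split.
- apply cderiv_minus; [apply cderiv_Csin|apply cderiv_id].
- assert (S := Seg w t Hr Ht); eapply Rle_trans; [apply H2; lra|].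
  apply Rmult_le_compat_l; [lra|]; apply pow_incr; split; [apply Cmod_ge_0|trivial].
Qed.

(** Up to pi/3 the slope is at least cos (pi/3) = 1/2; from pi/3 to pi/2 <= 2 the
   sine is at least sqrt 3 / 2 > 4/5. *)
Lemma sin_lower x : Rabs x <= PI / 2 -> 2 / 5 * Rabs x <= Rabs (sin x).
Proof.
assert (K : forall y, 0 <= y <= PI / 2 -> 2 / 5 * y <= sin y).
{ intros y Hy; destruct (Rle_dec y (PI / 3)) as [H|H].
  - destruct (MVT_gen sin 0 y cos) as (c & Hc & E).
    + intros; apply is_derive_Reals, derivable_pt_lim_sin.
    + intros; apply continuity_sin.
    + rewrite sin_0, !Rminus_0_r in E; rewrite E.
      rewrite Rmin_left, Rmax_right in Hc by lra.
      assert (1 / 2 <= cos c).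
      { rewrite <- cos_PI3; apply cos_decr_1; lra. }
      nra.
  - assert (sin (PI / 3) <= sin y) by (apply sin_incr_1; lra).
    rewrite sin_PI3 in H0.
    assert (1.6 <= sqrt 3).
    { rewrite <- (sqrt_pow2 1.6) by lra; apply sqrt_le_1_alt; lra. }
    assert (P := PI_4); lra. }
intros Hx; destruct (Rle_dec 0 x) as [H|H].
- rewrite (Rabs_pos_eq x) in * by lra; eapply Rle_trans; [apply K; lra|apply RRle_abs].
- rewrite (Rabs_left1 x) in * by lra; rewrite <- Rabs_Ropp, <- sin_neg.
  eapply Rle_trans; [apply K; lra|apply RRle_abs].
Qed.

Lemma exp_minus_exp_lower y : Rabs y <= Rabs (exp y - exp (- y)).
Proof.
assert (K : forall y, 0 <= y -> y <= exp y - exp (- y)).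
{ intros x Hx; assert (H1 := exp_ineq1_le x).
  assert (exp (- x) <= 1) by (rewrite <- exp_0; apply exp_monotone; lra); lra. }
destruct (Rle_dec 0 y) as [H|H].
- rewrite (Rabs_pos_eq y) by lra; eapply Rle_trans; [apply K, H|apply RRle_abs].
- rewrite (Rabs_left1 y) by lra; rewrite <- Rabs_Ropp.
  specialize (K (- y)); rewrite Ropp_involutive in K.
  eapply Rle_trans; [apply K; lra|]; eapply Rle_trans; [|apply RRle_abs]; lra.
Qed.

(** From |sin (x + i y)|^2 = sin^2 x + sinh^2 y. *)
Lemma Csin_lower w : Rabs (Re w) <= PI / 2 -> 2 / 5 * Cmod w <= Cmod (Csin w).
Proof.
destruct w as [x y]; simpl; intros Hx.
assert (E : Csin (x, y) = (sin x * ((exp y + exp (- y)) / 2), cos x * ((exp y - exp (- y)) / 2))).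
{ assert (Ed : forall a b : R, ((a, b) / (2 * Ci))%C = (b / 2, - a / 2)).
  { intros a b; unfold Cdiv, Cinv; apply injective_projections; simpl; field. }
  unfold Csin; replace (Ci * (x, y))%C with (- y, x)
    by (apply injective_projections; simpl; ring).
  replace (Copp (- y, x)) with (y, - x) by (apply injective_projections; simpl; ring).
  unfold Cexp, Re, Im; simpl fst; simpl snd; rewrite cos_neg, sin_neg.
  unfold Cminus, Cplus, Copp; simpl fst; simpl snd; rewrite Ed.
  apply injective_projections; simpl; field. }
apply Rsqr_incr_0; [|apply Rmult_le_pos; [lra|apply Cmod_ge_0]|apply Cmod_ge_0].
unfold Rsqr.
replace (2 / 5 * Cmod (x, y) * (2 / 5 * Cmod (x, y))) with (4 / 25 * Cmod (x, y) ^ 2) by field.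
replace (Cmod (Csin (x, y)) * Cmod (Csin (x, y))) with (Cmod (Csin (x, y)) ^ 2) by ring.
rewrite !Cmod2_alt, E; unfold Re, Im; simpl fst; simpl snd.
assert (T := sin2_cos2 x); unfold Rsqr in T.
set (s := sin x) in *; set (c := cos x) in *.
assert (Ep : exp y * exp (- y) = 1) by (rewrite <- exp_plus, Rplus_opp_r; apply exp_0).
replace ((s * ((exp y + exp (- y)) / 2)) ^ 2 + (c * ((exp y - exp (- y)) / 2)) ^ 2)
  with (s * s * (exp y * exp (- y)) + (s * s + c * c) * ((exp y - exp (- y)) / 2) ^ 2) by field.
rewrite Ep, T.
assert (S := sin_lower x Hx); fold s in S.
assert (S2 : (2 / 5 * Rabs x) ^ 2 <= Rabs s ^ 2)
  by (apply pow_incr; split; [assert (P := Rabs_pos x); lra|trivial]).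
rewrite Rpow_mult_distr, !pow2_abs in S2.
assert (Y := exp_minus_exp_lower y).
assert (Y2 : Rabs y ^ 2 <= Rabs (exp y - exp (- y)) ^ 2)
  by (apply pow_incr; split; [apply Rabs_pos|trivial]).
rewrite !pow2_abs in Y2.
assert (P := pow2_ge_0 y); lra.
Qed.

(** By evenness the double pole of 1/sin^2 has no residue, so that subtracting
   1/z^2 removes it entirely: sin w - w is cubic in w. *)
Lemma geom2_pole : exists B, forall z, qexp z <> 1 -> Rabs (Re z) <= 1 / 2 ->
  Rabs (Im z) <= 1 -> Cmod (/ z ^ 2 + 4 * PI ^ 2 * geom2 z) <= B.
Proof.
set (K := 8 * exp 8); assert (HK : 0 < K) by (unfold K; assert (P := exp_pos 8); lra).
exists (PI ^ 2 * (K * (K * 64 + 2) * (25 / 4))).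
intros z Hz Hre Him.
destruct (geom2_Csin z Hz) as (Hs & E).
assert (Hz0 : z <> 0).
{ intros E0; apply Hz; rewrite E0; apply qexp_0. }
assert (HPI := PI_RGT_0); assert (HPI4 := PI_4).
set (w := (PI * z)%C) in *.
assert (Hpi0 : RtoC PI <> 0) by (intros E0; apply RtoC_inj in E0; lra).
assert (Hw0 : w <> 0) by (apply Cmult_neq_0; trivial).
assert (Hmw : Cmod w <= 8).
{ unfold w; rewrite Cmod_mult, Cmod_R, Rabs_pos_eq by lra.
  assert (Cmod z <= 3 / 2).
  { rewrite (surjective_pairing z); eapply Rle_trans; [apply Cmod_le_abs|].
    unfold Re, Im in *; lra. }
  assert (P := Cmod_ge_0 z); nra. }
rewrite E.
replace (/ z ^ 2 + - (PI ^ 2 / Csin w ^ 2))%C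
  with (PI ^ 2 * ((Csin w - w) * (Csin w + w) * / (w ^ 2 * Csin w ^ 2)))%C.
2:{ unfold w at 3; field_simplify_eq.
    - unfold w; ring.
    - repeat split; trivial. }
rewrite !Cmod_mult, Cmod_pow, Cmod_R, (Rabs_pos_eq PI) by lra.
rewrite Cmod_inv, Cmod_mult, !Cmod_pow by (apply Cmult_neq_0; apply Cpow_nz; trivial).
apply Rmult_le_compat_l; [apply pow_le; lra|].
assert (T := Csin_taylor w 8 Hmw); fold K in T.
assert (L := Csin_lower w).
assert (Hpw : 0 < Cmod w) by now apply Cmod_gt_0.
assert (Hps : 0 < Cmod (Csin w)) by now apply Cmod_gt_0.
assert (L' : 2 / 5 * Cmod w <= Cmod (Csin w)).
{ apply L; unfold w; rewrite re_scal_l, Rabs_mult, Rabs_pos_eq by lra; nra. }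
assert (T2 : Cmod (Csin w + w) <= (K * 64 + 2) * Cmod w).
{ replace (Csin w + w)%C with ((Csin w - w) + 2 * w)%C by ring.
  eapply Rle_trans; [apply Cmod_triangle|].
  rewrite Cmod_mult, Cmod_R, Rabs_pos_eq by lra.
  assert (Cmod w ^ 2 <= 64) by (simpl; nra).
  assert (K * Cmod w ^ 3 <= K * 64 * Cmod w); [|lra].
  replace (K * Cmod w ^ 3) with (K * Cmod w * Cmod w ^ 2) by ring.
  assert (0 < K * Cmod w) by nra; nra. }
assert (L2 : (2 / 5 * Cmod w) ^ 2 <= Cmod (Csin w) ^ 2) by (apply pow_incr; lra).
apply Rle_div_l; [apply Rmult_lt_0_compat; now apply pow_lt|].
apply Rle_trans with ((K * Cmod w ^ 3) * ((K * 64 + 2) * Cmod w)).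
- apply Rmult_le_compat; trivial; apply Cmod_ge_0.
- replace ((K * Cmod w ^ 3) * ((K * 64 + 2) * Cmod w))
    with (K * (K * 64 + 2) * (25 / 4) * (Cmod w ^ 2 * (2 / 5 * Cmod w) ^ 2)) by field.
  apply Rmult_le_compat_l; [nra|].
  apply Rmult_le_compat_l; [apply pow_le; lra|trivial].
Qed.

Lemma Cmod_shift_lower z d : 2 * Cmod z + 1 <= Rabs (IZR d) ->
  Cmod (/ (z + IZR d) ^ 2) <= 8 * / (1 + IZR d ^ 2).
Proof.
intros Hd; assert (Hz := Cmod_ge_0 z).
assert (H1 : Rabs (IZR d) / 2 <= Cmod (z + IZR d)).
{ assert (T := Cmod_triangle (z + IZR d) (- z)); rewrite Cmod_opp in T.
  replace (z + IZR d + - z)%C with (RtoC (IZR d)) in T by ring; rewrite Cmod_R in T; lra. }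
assert (H2 : 0 < Cmod (z + IZR d)) by lra.
rewrite Cmod_inv, Cmod_pow by (apply Cpow_nz; now apply Cmod_gt_0).
assert (H3 : 1 + IZR d ^ 2 <= 8 * Cmod (z + IZR d) ^ 2).
{ rewrite <- (pow2_abs (IZR d)).
  assert ((Rabs (IZR d) / 2) ^ 2 <= Cmod (z + IZR d) ^ 2) by (apply pow_incr; lra).
  assert (1 <= Rabs (IZR d) ^ 2) by (simpl; nra).
  simpl in *; lra. }
assert (H4 := pow2_ge_0 (IZR d)).
apply (Rmult_le_reg_r (1 + IZR d ^ 2)); [lra|].
rewrite Rmult_assoc, Rinv_l, Rmult_1_r by lra.
apply (Rmult_le_reg_l (Cmod (z + IZR d) ^ 2)); [now apply pow_lt|].
rewrite <- Rmult_assoc, Rinv_r by (apply pow_nonzero; lra); lra.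
Qed.

(** Away from finitely many d, the term is at most 8 / (1 + d^2). *)
Lemma summable_shift_sq z :
  summable (fun _ => True) (fun d => Cmod (/ (z + IZR d) ^ 2)).
Proof.
apply (summable_split _ (fun d => Rabs (IZR d) < 2 * Cmod z + 1)).
- set (n := Z.to_nat (up (2 * Cmod z + 1))).
  apply (summable_list _ (map (fun k => (Z.of_nat k - Z.of_nat n)%Z) (seq 0 (2 * n + 1)))).
  + intros d [_ Hd]; assert (Hu := archimed (2 * Cmod z + 1)).
    assert (Hn : (Z.abs d < up (2 * Cmod z + 1))%Z).
    { apply lt_IZR; rewrite abs_IZR; lra. }
    apply in_map_iff; exists (Z.to_nat (d + Z.of_nat n)); split; [lia|].
    apply in_seq; unfold n; lia.
  + intros; apply Cmod_ge_0.
- apply summable_le with (fun d => 8 * / (1 + IZR d ^ 2)).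
  + intros d [_ Hd]; apply Cmod_shift_lower; lra.
  + apply summable_scal; [lra|].
    apply (summable_sub _ (fun _ => True)); [easy|apply summable_Z_inv_sq].
Qed.

Definition Zsum_sq (z : C) : C := Csum (fun _ : Z => True) (fun d => / (z + IZR d) ^ 2)%C.

Lemma is_Csum_Zsum_sq z :
  is_Csum (fun _ : Z => True) (fun d => / (z + IZR d) ^ 2)%C (Zsum_sq z).
Proof. apply summable_is_Csum, summable_shift_sq. Qed.

Lemma Zsum_sq_shift z n : Zsum_sq (z + IZR n) = Zsum_sq z.
Proof.
apply Csum_eq.
apply is_Csum_ext with (fun d => / (z + IZR (n + d)) ^ 2)%C.
{ intros d _; rewrite plus_IZR, RtoC_plus; do 2 f_equal; ring. }
apply (is_Csum_reindex (fun d => n + d)%Z _ (fun _ => True) (fun d => / (z + IZR d) ^ 2)%C);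
  trivial; [intros; lia| |apply is_Csum_Zsum_sq].
intros j _; exists (j - n)%Z; split; trivial; lia.
Qed.

Lemma is_Csum_parity (A : Z -> Prop) (f : Z -> C) s t :
  is_Csum (fun k => A (2 * k)%Z) (fun k => f (2 * k)%Z) s ->
  is_Csum (fun k => A (2 * k + 1)%Z) (fun k => f (2 * k + 1)%Z) t ->
  is_Csum A f (s + t)%C.
Proof.
intros Hs Ht; apply (is_Csum_split _ Z.Even).
- assert (E : forall d, Z.Even d -> d = (2 * (d / 2))%Z).
  { intros d [k ->]; rewrite (Z.mul_comm 2 k), Z.div_mul; lia. }
  apply is_Csum_ext with (fun d => f (2 * (d / 2))%Z).
  { intros d [_ Hd]; now rewrite <- (E d Hd). }
  apply (is_Csum_reindex (fun d => d / 2)%Z _ (fun k => A (2 * k)%Z) (fun k => f (2 * k)%Z) s); trivial.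
  + intros d [Hd He]; now rewrite <- (E d He).
  + intros i j [_ Hi] [_ Hj] Hij; rewrite (E i Hi), (E j Hj); congruence.
  + intros k Hk; exists (2 * k)%Z; split; [split; trivial; now exists k|].
    rewrite Z.mul_comm, Z.div_mul; lia.
- assert (E : forall d, ~ Z.Even d -> d = (2 * ((d - 1) / 2) + 1)%Z).
  { intros d Hd; destruct (Z.Even_or_Odd d) as [|[k ->]]; [tauto|].
    replace (2 * k + 1 - 1)%Z with (k * 2)%Z by ring; rewrite Z.div_mul; lia. }
  apply is_Csum_ext with (fun d => f (2 * ((d - 1) / 2) + 1)%Z).
  { intros d [_ Hd]; now rewrite <- (E d Hd). }
  apply (is_Csum_reindex (fun d => (d - 1) / 2)%Z _ (fun k => A (2 * k + 1)%Z)
    (fun k => f (2 * k + 1)%Z) t); trivial.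
  + intros d [Hd He]; now rewrite <- (E d He).
  + intros i j [_ Hi] [_ Hj] Hij; rewrite (E i Hi), (E j Hj); congruence.
  + intros k Hk; exists (2 * k + 1)%Z; split; [split; trivial; intros [m Hm]; lia|].
    replace (2 * k + 1 - 1)%Z with (k * 2)%Z by ring; rewrite Z.div_mul; lia.
Qed.

Lemma Zsum_sq_double z : qexp z <> 1 ->
  (Zsum_sq (z / 2) + Zsum_sq ((z + 1) / 2))%C = (4 * Zsum_sq z)%C.
Proof.
intros Hz.
apply (is_Csum_unique (fun _ : Z => True) (fun d => 4 * / (z + IZR d) ^ 2)%C);
  [|apply is_Csum_scal, is_Csum_Zsum_sq].
assert (N2 : RtoC 2 <> 0) by (apply RtoC_neq_0; lra).
apply is_Csum_parity.
- apply is_Csum_ext with (fun k => / (z / 2 + IZR k) ^ 2)%C; [|apply is_Csum_Zsum_sq].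
  intros k _; assert (H := qexp_neq_1_shift z (2 * k) Hz).
  rewrite mult_IZR, RtoC_mult in *.
  replace (z / 2 + IZR k)%C with ((z + 2 * IZR k) / 2)%C by (field; trivial).
  field; trivial.
- apply is_Csum_ext with (fun k => / ((z + 1) / 2 + IZR k) ^ 2)%C; [|apply is_Csum_Zsum_sq].
  intros k _; assert (H := qexp_neq_1_shift z (2 * k + 1) Hz).
  rewrite plus_IZR, mult_IZR, RtoC_plus, RtoC_mult in *.
  replace ((z + 1) / 2 + IZR k)%C with ((z + (2 * IZR k + 1)) / 2)%C by (field; trivial).
  field; trivial.
Qed.

Lemma qexp_half_sqr z : (qexp (z / 2) * qexp (z / 2))%C = qexp z.
Proof. rewrite <- qexp_plus; f_equal; field; apply RtoC_neq_0; lra. Qed.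

Lemma qexp_half_shift z : qexp ((z + 1) / 2) = (- qexp (z / 2))%C.
Proof.
replace ((z + 1) / 2)%C with (z / 2 + / 2)%C
  by (field; apply RtoC_neq_0; lra).
rewrite qexp_plus, qexp_half; ring.
Qed.

Lemma qexp_half_neq_1 z : qexp z <> 1 -> qexp (z / 2) <> 1 /\ qexp ((z + 1) / 2) <> 1.
Proof.
intros Hz; rewrite qexp_half_shift; split; intros E; apply Hz; rewrite <- qexp_half_sqr.
- rewrite E; ring.
- replace (qexp (z / 2)) with (- - qexp (z / 2))%C by ring; rewrite E; ring.
Qed.

Lemma geom2_double z : qexp z <> 1 -> (geom2 (z / 2) + geom2 ((z + 1) / 2))%C = (4 * geom2 z)%C.
Proof.
intros Hz; destruct (qexp_half_neq_1 z Hz) as (H1 & H2); revert H1 H2.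
unfold geom2; rewrite qexp_half_shift, <- (qexp_half_sqr z).
set (x := qexp (z / 2)); intros H1 H2.
assert (N1 : (1 - x)%C <> 0) by (apply Cminus_eq_contra; auto).
assert (N2 : (1 - - x)%C <> 0) by (apply Cminus_eq_contra; auto).
replace (1 - x * x)%C with ((1 - x) * (1 - - x))%C by ring.
field; split; [|trivial].
replace (1 + x)%C with (1 - - x)%C by ring; trivial.
Qed.

Lemma nearest_Z x : exists n : Z, Rabs (x - IZR n) <= 1 / 2.
Proof.
exists (up (x - 1 / 2)); assert (H := archimed (x - 1 / 2)); apply Rabs_le; lra.
Qed.

(** Herglotz's argument: the difference H of the two sides satisfies
   4 H(z) = H(z/2) + H((z+1)/2), and is bounded near the real axis, so its bound
   can be halved indefinitely. *)
Theorem Zsum_sq_eq z : qexp z <> 1 -> Zsum_sq z = (- (4 * PI ^ 2 * geom2 z))%C.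
Proof.
set (H := fun z => (Zsum_sq z + 4 * PI ^ 2 * geom2 z)%C).
assert (Hdouble : forall z, qexp z <> 1 -> (4 * H z)%C = (H (z / 2) + H ((z + 1) / 2))%C).
{ clear z; intros z Hz; unfold H.
  replace (4 * (Zsum_sq z + 4 * PI ^ 2 * geom2 z))%C
    with (4 * Zsum_sq z + 4 * PI ^ 2 * (4 * geom2 z))%C by ring.
  rewrite <- (geom2_double z Hz), <- (Zsum_sq_double z Hz); ring. }
assert (Hbound : exists B, forall z, qexp z <> 1 -> Rabs (Im z) <= 1 -> Cmod (H z) <= B).
{ destruct geom2_pole as (B0 & HB0).
  destruct summable_Z_inv_sq as (S & HS).
  exists (B0 + 16 * S); clear z; intros z Hz Him.
  destruct (nearest_Z (Re z)) as (n & Hn).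
  assert (E : H z = H (z + IZR (- n))%C).
  { unfold H, geom2; now rewrite Zsum_sq_shift, qexp_shift. }
  rewrite E; set (w := (z + IZR (- n))%C).
  assert (Hw : qexp w <> 1) by (unfold w; now rewrite qexp_shift).
  assert (Hre : Rabs (Re w) <= 1 / 2).
  { unfold w; rewrite re_plus, re_RtoC, opp_IZR; trivial. }
  assert (Him' : Rabs (Im w) <= 1).
  { unfold w; rewrite im_plus, im_RtoC, Rplus_0_r; trivial. }
  clearbody w; clear E Him Hn Hz z n; rename w into z.
  assert (Hd : forall d, d <> 0%Z -> Cmod (/ (z + IZR d) ^ 2) <= 16 * / (1 + IZR d ^ 2)).
  { intros d Hd.
    assert (Hd1 : 1 <= Rabs (IZR d)) by (rewrite <- abs_IZR; apply IZR_le; lia).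
    assert (Hm : Rabs (IZR d) / 2 <= Cmod (z + IZR d)).
    { eapply Rle_trans; [|apply re_le_Cmod]; rewrite re_plus, re_RtoC.
      assert (T := Rabs_triang (Re z + IZR d) (- Re z)); rewrite Rabs_Ropp in T.
      replace (Re z + IZR d + - Re z) with (IZR d) in T by ring; lra. }
    assert (Hp : 0 < Cmod (z + IZR d)) by lra.
    rewrite Cmod_inv, Cmod_pow by (apply Cpow_nz; now apply Cmod_gt_0).
    rewrite <- (pow2_abs (IZR d)); set (a := Rabs (IZR d)) in *.
    assert (H1 : (a / 2) ^ 2 <= Cmod (z + IZR d) ^ 2) by (apply pow_incr; lra).
    assert (H2 : 1 <= a ^ 2) by (simpl; nra).
    apply (Rmult_le_reg_r (1 + a ^ 2)); [lra|].
    rewrite Rmult_assoc, Rinv_l, Rmult_1_r by lra.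
    apply (Rmult_le_reg_l (Cmod (z + IZR d) ^ 2)); [now apply pow_lt|].
    rewrite <- Rmult_assoc, Rinv_r by (apply pow_nonzero; lra); simpl in *; lra. }
  set (t := Csum (fun d => d <> 0%Z) (fun d => / (z + IZR d) ^ 2)%C).
  assert (Ht : is_Csum (fun d => d <> 0%Z) (fun d => / (z + IZR d) ^ 2)%C t).
  { apply summable_is_Csum, (summable_sub _ (fun _ => True)); [easy|apply summable_shift_sq]. }
  assert (Hbt : Cmod t <= 16 * S).
  { eapply is_Csum_Cmod_le; [exact Ht|]; intros L HL HA.
    eapply Rle_trans; [apply Csum_list_Cmod|].
    apply Rle_trans with (Rsum_list (fun d => 16 * / (1 + IZR d ^ 2)) L).
    - now apply (Rsum_list_le (fun d => d <> 0%Z)).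
    - rewrite Rsum_list_scal; apply Rmult_le_compat_l; [lra|]; apply HS; trivial.
      now apply Forall_forall. }
  assert (E : Zsum_sq z = (t + / z ^ 2)%C).
  { apply Csum_eq; rewrite Cplus_comm, <- (Cplus_0_r z) at 1.
    now apply (is_Csum_add (fun d => / (z + IZR d) ^ 2)%C 0%Z). }
  unfold H; rewrite E.
  replace (t + / z ^ 2 + 4 * PI ^ 2 * geom2 z)%C
    with (t + (/ z ^ 2 + 4 * PI ^ 2 * geom2 z))%C by ring.
  eapply Rle_trans; [apply Cmod_triangle|].
  specialize (HB0 z Hw Hre Him'); lra. }
destruct Hbound as (B & HB).
assert (Imh : forall z, Im (z / 2) = Im z / 2 /\ Im ((z + 1) / 2) = Im z / 2).
{ clear; intros [x y]; unfold Cdiv, Cinv; simpl; split; field. }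
assert (Hhalf : forall j z, qexp z <> 1 -> Rabs (Im z) <= 1 -> Cmod (H z) <= B * (/ 2) ^ j).
{ clear z; induction j as [|j IH]; intros z Hz Him; [rewrite pow_O, Rmult_1_r; auto|].
  destruct (qexp_half_neq_1 z Hz) as (H1 & H2).
  destruct (Imh z) as (I1 & I2).
  assert (Hi : Rabs (Im z / 2) <= 1).
  { unfold Rdiv; rewrite Rabs_mult, (Rabs_pos_eq (/ 2)) by lra; lra. }
  assert (K1 := IH _ H1); rewrite I1 in K1; specialize (K1 Hi).
  assert (K2 := IH _ H2); rewrite I2 in K2; specialize (K2 Hi).
  assert (K := Cmod_triangle (H (z / 2)%C) (H ((z + 1) / 2)%C)).
  rewrite <- Hdouble, Cmod_mult, Cmod_R, Rabs_pos_eq in K by (trivial; lra).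
  simpl pow; lra. }
assert (Hzero : forall z, qexp z <> 1 -> Rabs (Im z) <= 1 -> H z = 0).
{ clear z; intros z Hz Him; apply Cmod_eq_0.
  assert (P := Cmod_ge_0 (H z)); destruct P as [P|P]; [exfalso|easy].
  assert (HB0 : 0 < B) by (specialize (HB z Hz Him); lra).
  destruct (pow_lt_1_zero (/ 2) ltac:(rewrite Rabs_pos_eq; lra) (Cmod (H z) / B)) as (j & Hj).
  { now apply Rdiv_lt_0_compat. }
  specialize (Hj j (Nat.le_refl _)); rewrite Rabs_pos_eq in Hj by (apply pow_le; lra).
  specialize (Hhalf j z Hz Him).
  apply (Rmult_lt_compat_l B) in Hj; trivial.
  replace (B * (Cmod (H z) / B)) with (Cmod (H z)) in Hj by (field; lra); lra. }
assert (Hall : forall k z, qexp z <> 1 -> Rabs (Im z) <= INR k + 1 -> H z = 0).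
{ clear z; induction k as [|k IH]; intros z Hz Him; [apply Hzero; trivial; simpl in Him; lra|].
  destruct (qexp_half_neq_1 z Hz) as (H1 & H2).
  destruct (Imh z) as (I1 & I2).
  assert (Hi : Rabs (Im z / 2) <= INR k + 1).
  { unfold Rdiv; rewrite Rabs_mult, (Rabs_pos_eq (/ 2)) by lra.
    rewrite S_INR in Him; assert (P := pos_INR k); lra. }
  replace (H z) with (4 * H z / 4)%C
    by (field; apply RtoC_neq_0; lra).
  rewrite Hdouble, (IH _ H1), (IH _ H2) by (rewrite ?I1, ?I2; trivial).
  field; apply RtoC_neq_0; lra. }
intros Hz.
destruct (nfloor_ex (Rabs (Im z)) (Rabs_pos _)) as (k & Hk).
replace (Zsum_sq z) with (H z - 4 * PI ^ 2 * geom2 z)%C by (unfold H; ring).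
rewrite (Hall k z Hz) by lra; ring.
Qed.

(** The terms with d odd add up to a quarter of the squared cosecant series at
   z = 1/2, whose value is pi^2, and those with d even to a quarter of the whole. *)
Theorem is_Csum_zeta2 :
  is_Csum (fun d : Z => d <> 0%Z) (fun d => / IZR d ^ 2)%C (PI ^ 2 / 3)%C.
Proof.
assert (N2 : RtoC 2 <> 0) by (apply RtoC_neq_0; lra).
assert (N3 : RtoC 3 <> 0) by (apply RtoC_neq_0; lra).
assert (N4 : RtoC 4 <> 0) by (apply RtoC_neq_0; lra).
assert (S : is_Csum (fun d : Z => d <> 0%Z) (fun d => / IZR d ^ 2)%C
  (Csum (fun d : Z => d <> 0%Z) (fun d => / IZR d ^ 2)%C)).
{ apply summable_is_Csum, (summable_sub _ (fun _ => True)); [easy|].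
  apply (summable_le _ _ (fun d => Cmod (/ (0 + IZR d) ^ 2))); [|apply summable_shift_sq].
  intros d _; rewrite Cplus_0_l; lra. }
set (Z2 := Csum _ _) in *.
replace (PI ^ 2 / 3)%C with Z2; trivial.
assert (Hq : qexp (/ 2) <> 1).
{ rewrite qexp_half; intros E; apply (f_equal Re) in E; simpl in E; lra. }
assert (E : Z2 = (/ 4 * Z2 + / 4 * Zsum_sq (/ 2))%C).
{ apply (is_Csum_unique _ _ _ _ S), is_Csum_parity.
  - apply (is_Csum_iff (fun k => k <> 0%Z)); [intros; lia|].
    apply is_Csum_ext with (fun k => / 4 * / IZR k ^ 2)%C; [|now apply is_Csum_scal].
    intros k Hk; rewrite mult_IZR, RtoC_mult.
    assert (RtoC (IZR k) <> 0) by now apply RtoC_neq_0, eq_IZR_contrapositive.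
    field; repeat split; trivial.
  - apply (is_Csum_iff (fun _ => True)); [intros; lia|].
    apply is_Csum_ext with (fun k => / 4 * / (/ 2 + IZR k) ^ 2)%C;
      [|apply is_Csum_scal, is_Csum_Zsum_sq].
    intros k _; assert (Hn := qexp_neq_1_shift _ k Hq).
    rewrite plus_IZR, mult_IZR, RtoC_plus, RtoC_mult.
    replace (/ 2 + IZR k)%C with ((2 * IZR k + 1) / 2)%C in * by (field; trivial).
    assert ((2 * IZR k + 1)%C <> 0) by (intros E; apply Hn; rewrite E; field; trivial).
    field; repeat split; trivial. }
rewrite Zsum_sq_eq in E by trivial.
unfold geom2 in E; rewrite qexp_half in E.
replace Z2 with (4 / 3 * (Z2 - / 4 * Z2))%C by (field; split; trivial).
rewrite E at 1; field; repeat split; trivial.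
Qed.

(** * Lambert series and Ramanujan's differential equation *)

Definition pos2 (p : nat * nat) : Prop := (1 <= fst p)%nat /\ (1 <= snd p)%nat.

Definition lambert_term (i j : nat) (q : C) (p : nat * nat) : C :=
  (INR (fst p) ^ i * INR (snd p) ^ j * q ^ (fst p * snd p))%C.

(** Grouped by n = a x these are the power series of divisor sums, such as the
   sum of sigma_1(n) q^n for i = 1, j = 0; the derivation q d/dq raises both
   exponents by one. *)
Definition lambert (i j : nat) (q : C) : C := Csum pos2 (lambert_term i j q).

Definition lambert_bound (i j : nat) (r : R) (p : nat * nat) : R :=
  (INR (fst p) ^ i * sqrt r ^ fst p) * (INR (snd p) ^ j * sqrt r ^ snd p).

Lemma pow_le_pow_sub1 r m n : 0 <= r <= 1 -> (n <= m)%nat -> r ^ m <= r ^ n.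
Proof.
intros Hr H; replace m with (n + (m - n))%nat by lia; rewrite pow_add.
assert (P := pow_le r n ltac:(lra)).
assert (r ^ (m - n) <= 1) by (rewrite <- (pow1 (m - n)); apply pow_incr; lra).
nra.
Qed.

(** Since 2 a x >= a + x, the double series is dominated by a product. *)
Lemma pow_mul_le_sqrt r a x : 0 <= r <= 1 -> (1 <= a)%nat -> (1 <= x)%nat ->
  r ^ (a * x) <= sqrt r ^ a * sqrt r ^ x.
Proof.
intros Hr Ha Hx.
rewrite <- (sqrt_sqrt r) at 1 by lra.
replace (sqrt r * sqrt r) with (sqrt r ^ 2) by ring.
rewrite <- pow_mult, <- pow_add; apply pow_le_pow_sub1; [|nia].
split; [apply sqrt_pos|]; rewrite <- sqrt_1; apply sqrt_le_1_alt; lra.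
Qed.

Lemma sqrt_lt_1' r : 0 <= r < 1 -> 0 <= sqrt r < 1.
Proof.
intros H; split; [apply sqrt_pos|]; rewrite <- sqrt_1; apply sqrt_lt_1_alt; lra.
Qed.

Lemma summable_lambert_bound i j r : 0 <= r < 1 -> summable pos2 (lambert_bound i j r).
Proof.
intros Hr; apply sqrt_lt_1' in Hr.
apply (summable_sub _ (fun p : nat * nat => True /\ True)); [easy|].
apply (summable_prod (fun _ => True) (fun _ => True)
  (fun a => INR a ^ i * sqrt r ^ a) (fun a => INR a ^ j * sqrt r ^ a));
try (intros; apply Rmult_le_pos; apply pow_le; [apply pos_INR|lra]);
now apply summable_pow_geom.
Qed.

Lemma Cmod_lambert_term i j q r p : pos2 p -> Cmod q <= r -> r <= 1 ->
  Cmod (lambert_term i j q p) <= lambert_bound i j r p.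
Proof.
intros [Ha Hx] Hq Hr; unfold lambert_term, lambert_bound.
assert (Hq0 := Cmod_ge_0 q).
rewrite !Cmod_mult, !Cmod_pow, !Cmod_R, !(Rabs_pos_eq (INR _)) by apply pos_INR.
replace (INR (fst p) ^ i * sqrt r ^ fst p * (INR (snd p) ^ j * sqrt r ^ snd p))
  with (INR (fst p) ^ i * INR (snd p) ^ j * (sqrt r ^ fst p * sqrt r ^ snd p)) by ring.
apply Rmult_le_compat_l; [apply Rmult_le_pos; apply pow_le, pos_INR|].
eapply Rle_trans; [|apply pow_mul_le_sqrt; trivial; lra].
apply pow_incr; lra.
Qed.

Lemma is_Csum_lambert i j q : Cmod q < 1 -> is_Csum pos2 (lambert_term i j q) (lambert i j q).
Proof.
intros Hq; apply summable_is_Csum.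
apply summable_le with (lambert_bound i j (Cmod q)).
- intros p Hp; apply Cmod_lambert_term; trivial; lra.
- apply summable_lambert_bound; split; [apply Cmod_ge_0|trivial].
Qed.

Lemma lambert_sym i j q : Cmod q < 1 -> lambert i j q = lambert j i q.
Proof.
intros Hq; apply Csum_eq.
apply is_Csum_ext with (fun p => lambert_term j i q (snd p, fst p)).
{ intros [a x] _; unfold lambert_term; simpl; rewrite (Nat.mul_comm x a); ring. }
apply (is_Csum_reindex (fun p => (snd p, fst p)) _ pos2 (lambert_term j i q)).
- intros p; unfold pos2; simpl; tauto.
- intros [a x] [b y] _ _ E; simpl in E; congruence.
- intros [a x] Hp; exists (x, a); unfold pos2 in *; simpl in *; tauto.
- now apply is_Csum_lambert.
Qed.

Lemma INR_list_sum (h : nat -> nat) l : INR (list_sum (map h l)) = Rsum_list (fun d => INR (h d)) l.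
Proof.
unfold Rsum_list; induction l as [|d l IH]; simpl; [easy|now rewrite plus_INR, IH].
Qed.

(** Grouping the terms with the same exponent gives the divisor sums. *)
Lemma CSeries_sigma j q : Cmod q < 1 ->
  CSeries (fun n => INR (sigma_pow j (S n)) * q ^ S n)%C = lambert j 0 q.
Proof.
intros Hq; apply is_Csum_CSeries.
apply (is_Csum_fiber (fun p : nat * nat => (fst p * snd p - 1)%nat) pos2 (fun _ => True)
  (lambert_term j 0 q)); trivial.
{ now apply is_Csum_lambert. }
intros n _.
set (D := filter (fun d => S n mod d =? 0)%nat (seq 1 (S n))).
set (L := map (fun d => (d, (S n / d)%nat)) D).
assert (HD : forall d, In d D <-> (1 <= d <= S n)%nat /\ (S n mod d = 0)%nat).
{ intros d; unfold D; rewrite filter_In, in_seq, Nat.eqb_eq; intuition lia. }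
replace (INR (sigma_pow j (S n)) * q ^ S n)%C with (Csum_list (lambert_term j 0 q) L).
- apply (is_Csum_iff (fun p => In p L)).
  + intros [a x]; unfold L; rewrite in_map_iff; unfold pos2; simpl; split.
    * intros (d & E & Hd); injection E as <- <-; apply HD in Hd; destruct Hd as [Hd Hm].
      assert (E := Nat.div_mod_eq (S n) d); rewrite Hm in E.
      assert (Hq0 : (S n / d <> 0)%nat) by (intros E0; rewrite E0 in E; lia).
      repeat split; lia.
    * intros [[Ha Hx] E]; exists a; assert (Hax : S n = (x * a)%nat) by nia.
      split; [rewrite Hax, Nat.div_mul by lia; easy|].
      apply HD; rewrite Hax, Nat.Div0.mod_mul; split; [nia|easy].
  + apply is_Csum_finite, NoDup_map_NoDup_ForallPairs.
    * intros d d' _ _ E; congruence.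
    * apply NoDup_filter, seq_NoDup.
- unfold sigma_pow; fold D; rewrite INR_list_sum; unfold L; rewrite Csum_list_map.
  apply Csum_list_factor; intros d Hd; apply HD in Hd; destruct Hd as [Hd Hm].
  assert (E := Nat.div_mod_eq (S n) d); rewrite Hm, Nat.add_0_r in E.
  unfold lambert_term; simpl fst; simpl snd; rewrite <- E, pow_INR, RtoC_pow; simpl (_ ^ 0)%C; ring.
Qed.

Lemma E2_lambert tau : 0 < Im tau -> E2 tau = (1 - 24 * lambert 1 0 (qexp tau))%C.
Proof. intros H; unfold E2; rewrite CSeries_sigma; trivial; now apply Cmod_qexp_lt_1. Qed.

Lemma E4_lambert tau : 0 < Im tau -> E4 tau = (1 + 240 * lambert 3 0 (qexp tau))%C.
Proof. intros H; unfold E4; rewrite CSeries_sigma; trivial; now apply Cmod_qexp_lt_1. Qed.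

Lemma cderiv_qexp tau : cderiv qexp tau (2 * PI * Ci * qexp tau)%C.
Proof.
unfold qexp; apply (cderiv_comp Cexp (fun w => 2 * PI * Ci * w)%C); [apply cderiv_Cexp|].
assert (Q := cderiv_scal (2 * PI * Ci) _ _ _ (cderiv_id tau)); now rewrite Cmult_1_r in Q.
Qed.

Lemma cderiv_lambert_term i j tau p :
  cderiv (fun tau => lambert_term i j (qexp tau) p) tau
    (2 * PI * Ci * lambert_term (S i) (S j) (qexp tau) p)%C.
Proof.
unfold lambert_term; set (n := (fst p * snd p)%nat).
replace (2 * PI * Ci * (INR (fst p) ^ S i * INR (snd p) ^ S j * qexp tau ^ n))%C
  with (INR (fst p) ^ i * INR (snd p) ^ j *
    (INR n * qexp tau ^ (n - 1) * (2 * PI * Ci * qexp tau)))%C.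
- apply cderiv_scal, cderiv_pow, cderiv_qexp.
- replace (INR n * qexp tau ^ (n - 1) * (2 * PI * Ci * qexp tau))%C
    with (2 * PI * Ci * (INR n * qexp tau ^ n))%C.
  + unfold n at 1; rewrite mult_INR, RtoC_mult; simpl; ring.
  + destruct n as [|n]; [simpl; ring|].
    replace (S n - 1)%nat with n by lia; simpl (qexp tau ^ S n)%C; ring.
Qed.

Lemma Im_near tau w r : Cmod (w - tau) < r -> Im tau - r < Im w < Im tau + r.
Proof.
intros H; assert (T := im_le_Cmod (w - tau)).
unfold Cminus in T; rewrite im_plus, im_opp in T.
assert (Rabs (Im w + - Im tau) < r) by (eapply Rle_lt_trans; eassumption).
apply Rabs_def2 in H0; lra.
Qed.

Lemma cderiv_lambert i j tau : 0 < Im tau ->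
  cderiv (fun tau => lambert i j (qexp tau)) tau
    (2 * PI * Ci * lambert (S i) (S j) (qexp tau))%C.
Proof.
intros Ht.
set (c := (2 * PI * Ci)%C).
assert (HP := PI_RGT_0); assert (HP2 := PI2_3_2).
assert (Hc : 1 <= Cmod c).
{ unfold c; rewrite !Cmod_mult, Cmod_Ci, !Cmod_R, !Rabs_pos_eq by lra; lra. }
set (r := exp (- (2 * PI * (Im tau / 2)))).
assert (Hr : 0 <= r < 1).
{ unfold r; split; [apply Rlt_le, exp_pos|]; rewrite <- exp_0; apply exp_increasing; nra. }
replace (c * lambert (S i) (S j) (qexp tau))%C
  with (Csum pos2 (fun p => c * lambert_term (S i) (S j) (qexp tau) p)%C).
2:{ apply Csum_eq, is_Csum_scal, is_Csum_lambert; now apply Cmod_qexp_lt_1. }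
apply (Csum_cderiv pos2 (fun p w => lambert_term i j (qexp w) p)
  (fun p w => c * lambert_term (S i) (S j) (qexp w) p)%C
  (fun p w => c * (c * lambert_term (S (S i)) (S (S j)) (qexp w) p))%C
  (fun p => Cmod c ^ 2 * lambert_bound (S (S i)) (S (S j)) r p) tau (Im tau / 2)); [lra| |].
- apply summable_scal; [apply pow_le; lra|now apply summable_lambert_bound].
- intros p w Hp Hw.
  assert (Hq : Cmod (qexp w) <= r).
  { apply Im_near in Hw; rewrite Cmod_qexp; apply exp_monotone; nra. }
  assert (B : forall i j, 0 <= lambert_bound i j r p <= lambert_bound (S i) (S j) r p).
  { intros i' j'; unfold lambert_bound; destruct Hp as [Ha Hx].
    apply le_INR in Ha; apply le_INR in Hx; simpl in Ha, Hx.
    assert (P1 := pow_le (sqrt r) (fst p) (sqrt_pos r)).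
    assert (P2 := pow_le (sqrt r) (snd p) (sqrt_pos r)).
    assert (Q1 := pow_le (INR (fst p)) i' (pos_INR _)).
    assert (Q2 := pow_le (INR (snd p)) j' (pos_INR _)).
    simpl pow; split; [repeat apply Rmult_le_pos; trivial|].
    apply Rmult_le_compat; try (apply Rmult_le_pos; trivial);
    apply Rmult_le_compat_r; trivial; nra. }
  assert (B0 := B i j); assert (B1 := B (S i) (S j)).
  assert (T : forall i j, Cmod (lambert_term i j (qexp w) p) <= lambert_bound i j r p)
    by (intros; apply Cmod_lambert_term; trivial; lra).
  assert (T0 := T i j); assert (T1 := T (S i) (S j)); assert (T2 := T (S (S i)) (S (S j))).
  assert (Q0 := Cmod_ge_0 (lambert_term (S i) (S j) (qexp w) p)).
  assert (Q2 := Cmod_ge_0 (lambert_term (S (S i)) (S (S j)) (qexp w) p)).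
  rewrite !Cmod_mult; set (m := Cmod c) in *; simpl pow.
  set (b := lambert_bound (S (S i)) (S (S j)) r p) in *.
  assert (1 <= m * m) by nra.
  repeat split.
  + apply cderiv_lambert_term.
  + apply cderiv_scal, cderiv_lambert_term.
  + nra.
  + rewrite Rmult_1_r, Rmult_assoc; apply Rmult_le_compat_l; nra.
  + rewrite Rmult_1_r, Rmult_assoc; apply Rmult_le_compat_l; [lra|].
    apply Rmult_le_compat_l; lra.
Qed.

(** * The square of the Lambert series of sigma_1 *)

Definition quad : Type := ((nat * nat) * (nat * nat))%type.

Definition weight : Type := nat -> nat -> nat -> nat -> R.

Section Quadruples.

Variable q : C.
Hypothesis Hq : Cmod q < 1.

Definition quad_term (w : weight) (u : quad) : C :=
  let '((a, x), (b, y)) := u in (w a x b y * q ^ (a * x + b * y))%C.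

Definition pos4 (u : quad) : Prop := pos2 (fst u) /\ pos2 (snd u).

(** A crude polynomial bound, which makes the quadruple series absolutely
   convergent; every monomial of degree at most 2 in each variable satisfies it. *)
Definition tame (w : weight) : Prop :=
  forall a x b y, (1 <= a)%nat -> (1 <= x)%nat -> (1 <= b)%nat -> (1 <= y)%nat ->
    Rabs (w a x b y) <= (INR a * INR x * (INR b * INR y)) ^ 2.

Definition quad_lt (u : quad) : Prop := pos4 u /\ (fst (snd u) < fst (fst u))%nat.
Definition quad_eq (u : quad) : Prop := pos4 u /\ (fst (snd u) = fst (fst u))%nat.

Lemma summable_quad w : tame w -> summable pos4 (fun u => Cmod (quad_term w u)).
Proof.
intros Hw.
apply summable_le with (fun u => lambert_bound 2 2 (Cmod q) (fst u) * lambert_bound 2 2 (Cmod q) (snd u)).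
- intros [[a x] [b y]] [[Ha Hx] [Hb Hy]]; simpl in *.
  rewrite Cmod_mult, Cmod_R, Cpow_add_r, Cmod_mult.
  apply Rle_trans with ((INR a * INR x * (INR b * INR y)) ^ 2 * (Cmod (q ^ (a * x)) * Cmod (q ^ (b * y)))).
  + apply Rmult_le_compat_r; [apply Rmult_le_pos; apply Cmod_ge_0|now apply Hw].
  + assert (P : forall p, pos2 p -> Cmod (lambert_term 2 2 q p) <= lambert_bound 2 2 (Cmod q) p)
      by (intros; apply Cmod_lambert_term; trivial; lra).
    assert (P1 := P (a, x) (conj Ha Hx)); assert (P2 := P (b, y) (conj Hb Hy)).
    unfold lambert_term in P1, P2; simpl fst in *; simpl snd in *.
    rewrite !Cmod_mult, <- !RtoC_pow, !Cmod_R in P1, P2.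
    rewrite !(Rabs_pos_eq (INR _ ^ _)) in P1 by apply pow_le, pos_INR.
    rewrite !(Rabs_pos_eq (INR _ ^ _)) in P2 by apply pow_le, pos_INR.
    replace ((INR a * INR x * (INR b * INR y)) ^ 2 * (Cmod (q ^ (a * x)) * Cmod (q ^ (b * y))))
      with ((INR a ^ 2 * INR x ^ 2 * Cmod (q ^ (a * x))) * (INR b ^ 2 * INR y ^ 2 * Cmod (q ^ (b * y)))) by ring.
    apply Rmult_le_compat; trivial;
    (apply Rmult_le_pos; [apply Rmult_le_pos; apply pow_le, pos_INR|apply Cmod_ge_0]).
- assert (N : forall p, 0 <= lambert_bound 2 2 (Cmod q) p).
  { intros p; unfold lambert_bound; apply Rmult_le_pos; apply Rmult_le_pos; apply pow_le;
    try apply pos_INR; apply sqrt_pos. }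
  assert (Hb : summable pos2 (lambert_bound 2 2 (Cmod q)))
    by (apply summable_lambert_bound; split; [apply Cmod_ge_0|trivial]).
  now apply (summable_prod pos2 pos2).
Qed.

Definition quad_sum (A : quad -> Prop) (w : weight) : C := Csum A (quad_term w).

Lemma is_Csum_quad A w : (forall u, A u -> pos4 u) -> tame w ->
  is_Csum A (quad_term w) (quad_sum A w).
Proof.
intros HA Hw; apply summable_is_Csum, (summable_sub _ pos4); trivial.
now apply summable_quad.
Qed.

Lemma quad_sum_reindex (p : quad -> quad) (p' : quad -> quad) A B w w' :
  tame w -> (forall u, B u -> pos4 u) ->
  (forall u, A u -> B (p u) /\ p' (p u) = u /\ quad_term w (p u) = quad_term w' u) ->
  (forall u, B u -> A (p' u) /\ p (p' u) = u) ->
  quad_sum A w' = quad_sum B w.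
Proof.
intros Hw HB Hp Hp'; apply Csum_eq.
apply is_Csum_ext with (fun u => quad_term w (p u)); [intros u Hu; now apply Hp|].
apply (is_Csum_reindex p A B (quad_term w)).
- intros u Hu; now apply Hp.
- intros u v Hu Hv E; destruct (Hp u Hu) as (_ & <- & _), (Hp v Hv) as (_ & <- & _); congruence.
- intros v Hv; exists (p' v); now apply Hp'.
- now apply is_Csum_quad.
Qed.

Lemma quad_sum_lin A c1 c2 c3 w1 w2 w3 w : (forall u, A u -> pos4 u) ->
  tame w1 -> tame w2 -> tame w3 ->
  (forall a x b y, A ((a, x), (b, y)) ->
     w a x b y = c1 * w1 a x b y + c2 * w2 a x b y + c3 * w3 a x b y) ->
  quad_sum A w = (c1 * quad_sum A w1 + c2 * quad_sum A w2 + c3 * quad_sum A w3)%C.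
Proof.
intros HA H1 H2 H3 Hw; apply Csum_eq.
apply is_Csum_ext with
  (fun u => c1 * quad_term w1 u + c2 * quad_term w2 u + c3 * quad_term w3 u)%C.
{ intros [[a x] [b y]] Hu; unfold quad_term; rewrite (Hw a x b y Hu).
  rewrite !RtoC_plus, !RtoC_mult; ring. }
apply is_Csum_plus; [apply is_Csum_plus|]; apply is_Csum_scal; now apply is_Csum_quad.
Qed.

Lemma quad_sum_ext A w w' : (forall a x b y, w a x b y = w' a x b y) ->
  quad_sum A w = quad_sum A w'.
Proof. intros H; apply Csum_ext; intros [[a x] [b y]] _; unfold quad_term; now rewrite H. Qed.

Lemma tame_mono (w : weight) i1 i2 i3 i4 : (i1 <= 2)%nat -> (i2 <= 2)%nat -> (i3 <= 2)%nat -> (i4 <= 2)%nat ->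
  (forall a x b y, w a x b y = INR a ^ i1 * INR x ^ i2 * (INR b ^ i3 * INR y ^ i4)) -> tame w.
Proof.
intros H1 H2 H3 H4 E a x b y Ha Hx Hb Hy; rewrite E.
assert (P : forall n i, (1 <= n)%nat -> (i <= 2)%nat -> 0 <= INR n ^ i <= INR n ^ 2).
{ intros n i Hn Hi; split; [apply pow_le, pos_INR|].
  apply Rle_pow; trivial; now apply (le_INR 1). }
destruct (P a i1 Ha H1), (P x i2 Hx H2), (P b i3 Hb H3), (P y i4 Hy H4).
rewrite Rabs_pos_eq by (repeat apply Rmult_le_pos; trivial).
rewrite !Rpow_mult_distr.
repeat apply Rmult_le_compat; trivial; repeat apply Rmult_le_pos; trivial.
Qed.

Definition quad_xlt (u : quad) : Prop := pos4 u /\ (snd (fst u) < snd (snd u))%nat.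

(** a x + b y = (a - b) x + b (x + y). *)
Lemma quad_sum_shear f : tame f ->
  quad_sum quad_lt (fun a x b y => f (a - b) x b (x + y))%nat = quad_sum quad_xlt f.
Proof.
intros Hf.
apply (quad_sum_reindex
  (fun u => let '((a, x), (b, y)) := u in ((a - b, x), (b, x + y)))%nat
  (fun u => let '((a, x), (b, y)) := u in ((a + b, x), (b, y - x)))%nat); trivial.
- intros u Hu; apply Hu.
- intros [[a x] [b y]]; unfold quad_lt, quad_xlt, pos4, pos2; simpl; intros H.
  split; [lia|split].
  + repeat (f_equal; try lia).
  + do 2 f_equal; nia.
- intros [[a x] [b y]]; unfold quad_lt, quad_xlt, pos4, pos2; simpl; intros H.
  split; [lia|repeat (f_equal; try lia)].
Qed.

(** The exponent is also invariant under (a, x, b, y) -> (y, b, x, a), which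
   turns b < a into x < y just as the shear does. *)
Lemma quad_sum_transpose f : tame f ->
  quad_sum quad_lt (fun a x b y => f y b x a)%nat = quad_sum quad_xlt f.
Proof.
intros Hf.
apply (quad_sum_reindex
  (fun u => let '((a, x), (b, y)) := u in ((y, b), (x, a)))
  (fun u => let '((a, x), (b, y)) := u in ((y, b), (x, a)))); trivial.
- intros u Hu; apply Hu.
- intros [[a x] [b y]]; unfold quad_lt, quad_xlt, pos4, pos2; simpl; intros H.
  repeat split; try lia; do 2 f_equal; lia.
- intros [[a x] [b y]]; unfold quad_lt, quad_xlt, pos4, pos2; simpl; intros H.
  repeat split; lia.
Qed.

Lemma quad_sum_exchange f : tame f ->
  quad_sum pos4 (fun a x b y => f x a y b)%nat = quad_sum pos4 f.
Proof.
intros Hf.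
apply (quad_sum_reindex
  (fun u => let '((a, x), (b, y)) := u in ((x, a), (y, b)))
  (fun u => let '((a, x), (b, y)) := u in ((x, a), (y, b)))); trivial.
- intros [[a x] [b y]]; unfold pos4, pos2; simpl; intros H.
  repeat split; try lia; do 2 f_equal; lia.
- intros [[a x] [b y]]; unfold pos4, pos2; simpl; intros H; repeat split; lia.
Qed.

Lemma quad_sum_split f : tame f -> tame (fun a x b y => f b y a x) ->
  quad_sum pos4 f
  = (quad_sum quad_lt f + (quad_sum quad_lt (fun a x b y => f b y a x) + quad_sum quad_eq f))%C.
Proof.
intros Hf Hf'.
rewrite (quad_sum_reindex (fun u => (snd u, fst u)) (fun u => (snd u, fst u)) quad_lt
  (fun u => pos4 u /\ (fst (fst u) < fst (snd u))%nat) f (fun a x b y => f b y a x)); trivial.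
- apply Csum_eq.
  apply (is_Csum_split _ (fun u => (fst (snd u) < fst (fst u))%nat)).
  { apply is_Csum_quad; trivial; intros u Hu; apply Hu. }
  apply (is_Csum_split _ (fun u => (fst (fst u) < fst (snd u))%nat)).
  + apply (is_Csum_iff (fun u => pos4 u /\ (fst (fst u) < fst (snd u))%nat)).
    * intros u; intuition lia.
    * apply is_Csum_quad; trivial; intros u Hu; apply Hu.
  + apply (is_Csum_iff quad_eq).
    * intros u; unfold quad_eq; intuition lia.
    * apply is_Csum_quad; trivial; intros u Hu; apply Hu.
- intros u Hu; apply Hu.
- intros [[a x] [b y]]; unfold quad_lt, pos4, pos2; simpl; intros H.
  repeat split; try lia; do 2 f_equal; lia.
- intros [[a x] [b y]]; unfold quad_lt, pos4, pos2; simpl; intros H; repeat split; lia.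
Qed.

(** On the diagonal a = b, the terms with x + y = d share the exponent a d. *)
Lemma quad_sum_diagonal w (g : nat -> nat -> R) : tame w ->
  (forall a d, (1 <= a)%nat -> (1 <= d)%nat ->
     Rsum_list (fun x => w a x a (d - x)%nat) (seq 1 (d - 1)) = g a d) ->
  is_Csum pos2 (fun p => g (fst p) (snd p) * q ^ (fst p * snd p))%C (quad_sum quad_eq w).
Proof.
intros Hw Hg.
apply (is_Csum_fiber (fun u : quad => (fst (fst u), snd (fst u) + snd (snd u))%nat)
  quad_eq pos2 (quad_term w)).
- intros [[a x] [b y]]; unfold quad_eq, pos4, pos2; simpl; lia.
- apply is_Csum_quad; trivial; intros u Hu; apply Hu.
- intros [a d] [Ha Hd]; simpl in *.
  set (L := map (fun x => ((a, x), (a, d - x)%nat)) (seq 1 (d - 1))).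
  replace (g a d * q ^ (a * d))%C with (Csum_list (quad_term w) L).
  + apply (is_Csum_iff (fun u => In u L)).
    * intros [[a' x] [b y]]; unfold L, quad_eq, pos4, pos2; rewrite in_map_iff; simpl; split.
      -- intros (x' & E & Hx); apply in_seq in Hx; injection E as <- <- <- <-.
         repeat split; try lia; f_equal; lia.
      -- intros [H E]; injection E as -> E; exists x; rewrite in_seq.
         split; [|lia]; repeat f_equal; lia.
    * apply is_Csum_finite, NoDup_map_NoDup_ForallPairs; [|apply seq_NoDup].
      intros x x' _ _ E; congruence.
  + rewrite <- Hg by trivial; unfold L; rewrite Csum_list_map.
    apply Csum_list_factor; intros x Hx; apply in_seq in Hx; unfold quad_term.
    do 2 f_equal; nia.
Qed.

Lemma diagonal_eq w c0 c1 c2 c3 i0 j0 i1 j1 i2 j2 i3 j3 : tame w ->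
  (forall a d, (1 <= a)%nat -> (1 <= d)%nat ->
     Rsum_list (fun x => w a x a (d - x)%nat) (seq 1 (d - 1))
     = c0 * (INR a ^ i0 * INR d ^ j0) + c1 * (INR a ^ i1 * INR d ^ j1)
       + c2 * (INR a ^ i2 * INR d ^ j2) + c3 * (INR a ^ i3 * INR d ^ j3)) ->
  quad_sum quad_eq w
  = (c0 * lambert i0 j0 q + c1 * lambert i1 j1 q + c2 * lambert i2 j2 q + c3 * lambert i3 j3 q)%C.
Proof.
intros Hw Hg; apply quad_sum_diagonal in Hg; trivial.
apply (is_Csum_unique _ _ _ _ Hg).
apply is_Csum_ext with (fun p => c0 * lambert_term i0 j0 q p + c1 * lambert_term i1 j1 q p
  + c2 * lambert_term i2 j2 q p + c3 * lambert_term i3 j3 q p)%C.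
{ intros p _; unfold lambert_term; rewrite !RtoC_plus, !RtoC_mult, !RtoC_pow; ring. }
apply is_Csum_plus; [apply is_Csum_plus; [apply is_Csum_plus|]|];
apply is_Csum_scal; now apply is_Csum_lambert.
Qed.

Lemma Rsum_seq_poly (f : nat -> R) (F : nat -> R) n :
  F 0%nat = 0 -> (forall k, f (S k) = F (S k) - F k) -> Rsum_list f (seq 1 n) = F n.
Proof.
intros H0 HS; induction n as [|n IH]; [now rewrite H0|].
rewrite seq_S, Rsum_list_app, IH; unfold Rsum_list; simpl; rewrite HS; ring.
Qed.

(** The sum of a b over all quadruples is evaluated without ever listing its
   terms: shear and transposition express the sums over a > b through each
   other, and exchanging (a, b) with (x, y) is a second relation; all that is
   left is the diagonal a = b. *)
Theorem lambert_sqr :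
  (12 * lambert 1 0 q ^ 2)%C = (5 * lambert 3 0 q - 6 * lambert 2 1 q + lambert 1 0 q)%C.
Proof.
set (ab := (fun a x b y => INR a * INR b) : weight).
set (xy := (fun a x b y => INR x * INR y) : weight).
set (aa := (fun a x b y => INR a ^ 2) : weight).
set (bb := (fun a x b y => INR b ^ 2) : weight).
set (xx := (fun a x b y => INR x ^ 2) : weight).
set (yy := (fun a x b y => INR y ^ 2) : weight).
assert (Tab : tame ab) by (apply (tame_mono _ 1 0 1 0); try lia; intros; unfold ab; ring).
assert (Txy : tame xy) by (apply (tame_mono _ 0 1 0 1); try lia; intros; unfold xy; ring).
assert (Taa : tame aa) by (apply (tame_mono _ 2 0 0 0); try lia; intros; unfold aa; ring).
assert (Tbb : tame bb) by (apply (tame_mono _ 0 0 2 0); try lia; intros; unfold bb; ring).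
assert (Txx : tame xx) by (apply (tame_mono _ 0 2 0 0); try lia; intros; unfold xx; ring).
assert (Tyy : tame yy) by (apply (tame_mono _ 0 0 0 2); try lia; intros; unfold yy; ring).
assert (Pl : forall u, quad_lt u -> pos4 u) by (intros u Hu; apply Hu).
assert (Hlt : forall a x b y, quad_lt ((a, x), (b, y)) -> INR (a - b) = INR a - INR b).
{ intros a x b y [_ H]; simpl in H; apply minus_INR; lia. }
(* The relations from shear and transposition, for the weights xy, b^2 and a^2. *)
assert (Rxy : quad_sum quad_lt ab = (1 * quad_sum quad_lt xx + 1 * quad_sum quad_lt xy + 0 * quad_sum quad_lt xy)%C).
{
  rewrite (quad_sum_ext quad_lt _ (fun a x b y => xy y b x a)) by (intros; unfold ab, xy; ring).
  rewrite (quad_sum_transpose xy Txy), <- (quad_sum_shear xy Txy).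
  apply quad_sum_lin; trivial; intros a x b y _; unfold xy, xx; rewrite plus_INR; ring. }
assert (Rbb : quad_sum quad_lt xx = quad_sum quad_lt bb).
{ change (quad_sum quad_lt xx) with (quad_sum quad_lt (fun a x b y => bb y b x a)).
  now rewrite (quad_sum_transpose bb Tbb), <- (quad_sum_shear bb Tbb). }
assert (Raa : quad_sum quad_lt yy
  = (1 * quad_sum quad_lt aa + (-2)%R * quad_sum quad_lt ab + 1 * quad_sum quad_lt bb)%C).
{ change (quad_sum quad_lt yy) with (quad_sum quad_lt (fun a x b y => aa y b x a)).
  rewrite (quad_sum_transpose aa Taa), <- (quad_sum_shear aa Taa).
  apply quad_sum_lin; trivial.
  intros a x b y Hu; unfold aa, ab, bb; rewrite (Hlt a x b y Hu); ring. }
assert (Sab := quad_sum_split ab Tab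
  ltac:(apply (tame_mono _ 1 0 1 0); try lia; intros; unfold ab; ring)).
rewrite (quad_sum_ext quad_lt (fun a x b y => ab b y a x) ab) in Sab by (intros; unfold ab; ring).
assert (Sxy := quad_sum_split xy Txy
  ltac:(apply (tame_mono _ 0 1 0 1); try lia; intros; unfold xy; ring)).
rewrite (quad_sum_ext quad_lt (fun a x b y => xy b y a x) xy) in Sxy by (intros; unfold xy; ring).
assert (Saa : quad_sum pos4 aa = (quad_sum quad_lt aa + (quad_sum quad_lt bb + quad_sum quad_eq aa))%C)
  by now apply quad_sum_split.
assert (Sxx : quad_sum pos4 xx = (quad_sum quad_lt xx + (quad_sum quad_lt yy + quad_sum quad_eq xx))%C)
  by now apply quad_sum_split.
(* The relations from the exchange of (a, b) with (x, y). *)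
assert (X1 : quad_sum pos4 xy = quad_sum pos4 ab) by (rewrite <- (quad_sum_exchange ab Tab); easy).
assert (X2 : quad_sum pos4 xx = quad_sum pos4 aa) by (rewrite <- (quad_sum_exchange aa Taa); easy).
(* Sums of x (d - x), of x^2 and of 1 over 0 < x < d. *)
assert (Dxy : quad_sum quad_eq xy = ((/ 6)%R * lambert 0 3 q + (- / 6)%R * lambert 0 1 q
  + 0%R * lambert 0 0 q + 0%R * lambert 0 0 q)%C).
{ apply diagonal_eq; trivial; intros a d Ha Hd; unfold xy.
  set (F := fun (D : R) n => D * (INR n * (INR n + 1) / 2) - INR n * (INR n + 1) * (2 * INR n + 1) / 6).
  transitivity (Rsum_list (fun x => INR x * (INR d - INR x)) (seq 1 (d - 1))).
  - apply Rsum_list_eq_in; intros x Hx; apply in_seq in Hx; rewrite minus_INR by lia; easy.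
  - rewrite (Rsum_seq_poly _ (F (INR d))).
    + unfold F; rewrite minus_INR by lia; simpl; field.
    + unfold F; simpl; field.
    + intros k; unfold F; rewrite S_INR; field. }
assert (Dxx : quad_sum quad_eq xx = ((/ 3)%R * lambert 0 3 q + (- / 2)%R * lambert 0 2 q
  + (/ 6)%R * lambert 0 1 q + 0%R * lambert 0 0 q)%C).
{ apply diagonal_eq; trivial; intros a d Ha Hd; unfold xx.
  rewrite (Rsum_seq_poly _ (fun n => INR n * (INR n + 1) * (2 * INR n + 1) / 6)).
  - rewrite minus_INR by lia; simpl; field.
  - simpl; field.
  - intros k; rewrite S_INR; field. }
assert (Daa : quad_sum quad_eq aa = (1%R * lambert 2 1 q + (-1)%R * lambert 2 0 q
  + 0%R * lambert 0 0 q + 0%R * lambert 0 0 q)%C).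
{ apply diagonal_eq; trivial; intros a d Ha Hd; unfold aa.
  rewrite (Rsum_seq_poly _ (fun n => INR n * INR a ^ 2)).
  - rewrite minus_INR by lia; simpl; ring.
  - simpl; ring.
  - intros k; rewrite S_INR; ring. }
assert (Hprod : quad_sum pos4 ab = (lambert 1 0 q ^ 2)%C).
{ apply Csum_eq.
  replace (lambert 1 0 q ^ 2)%C with (lambert 1 0 q * lambert 1 0 q)%C by ring.
  apply is_Csum_ext with (fun u => lambert_term 1 0 q (fst u) * lambert_term 1 0 q (snd u))%C.
  { intros [[a x] [b y]] _; unfold lambert_term, quad_term, ab; simpl fst; simpl snd.
    rewrite Cpow_add_r, RtoC_mult; simpl (_ ^ 1)%C; simpl (_ ^ 0)%C; ring. }
  assert (Sl : summable pos2 (fun p => Cmod (lambert_term 1 0 q p))).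
  { apply summable_le with (lambert_bound 1 0 (Cmod q)).
    - intros p Hp; apply Cmod_lambert_term; trivial; lra.
    - apply summable_lambert_bound; split; [apply Cmod_ge_0|trivial]. }
  apply (is_Csum_prod pos2 pos2); trivial; now apply is_Csum_lambert. }
rewrite (lambert_sym 0 3), (lambert_sym 0 1) in Dxy by trivial.
rewrite (lambert_sym 0 3), (lambert_sym 0 2), (lambert_sym 0 1) in Dxx by trivial.
rewrite X1, Sab in Sxy; rewrite X2, Saa in Sxx.
rewrite <- Hprod, Sab.
assert (Dab : quad_sum quad_eq ab = quad_sum quad_eq aa).
{ apply Csum_ext; intros [[a x] [b y]] [_ E]; simpl in E; subst b.
  unfold quad_term, ab, aa; do 2 f_equal; simpl; ring. }
rewrite Dab in *; clearbody ab xy aa bb xx yy.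
set (Aab := quad_sum quad_lt ab) in *; set (Axy := quad_sum quad_lt xy) in *.
set (Aaa := quad_sum quad_lt aa) in *; set (Abb := quad_sum quad_lt bb) in *.
set (Axx := quad_sum quad_lt xx) in *; set (Ayy := quad_sum quad_lt yy) in *.
assert (H1 : (2 * Abb)%C = (quad_sum quad_eq xy - quad_sum quad_eq aa)%C).
{ apply Ceq_minus; assert (Q := proj1 (Ceq_minus _ _) Sxy); rewrite <- Q, Rxy, Rbb; ring. }
assert (H2 : (2 * Aab)%C = (Abb + quad_sum quad_eq xx - quad_sum quad_eq aa)%C).
{ apply Ceq_minus; assert (Q := proj1 (Ceq_minus _ _) Sxx); rewrite <- Q, Raa, Rbb.
  ring. }
replace (12 * (Aab + (Aab + quad_sum quad_eq aa)))%C
  with (6 * (2 * (2 * Aab)) + 12 * quad_sum quad_eq aa)%C by ring.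
rewrite H2.
replace (6 * (2 * (Abb + quad_sum quad_eq xx - quad_sum quad_eq aa)) + 12 * quad_sum quad_eq aa)%C
  with (6 * (2 * Abb) + 12 * quad_sum quad_eq xx)%C by ring.
rewrite H1, Dxy, Dxx, Daa, !RtoC_opp, !RtoC_inv by lra.
field; repeat split; apply RtoC_neq_0; lra.
Qed.

End Quadruples.

(** Ramanujan's equation; in terms of Lambert series it is [lambert_sqr]. *)
Theorem cderiv_E2 tau : 0 < Im tau ->
  cderiv E2 tau (2 * PI * Ci * ((E2 tau ^ 2 - E4 tau) / 12))%C.
Proof.
intros Ht.
apply (cderiv_ext_near (fun w => 1 - 24 * lambert 1 0 (qexp w))%C _ _ _ (Im tau)); trivial.
{ intros w Hw; apply Im_near in Hw; symmetry; apply E2_lambert; lra. }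
assert (Hq := Cmod_qexp_lt_1 tau Ht).
replace (2 * PI * Ci * ((E2 tau ^ 2 - E4 tau) / 12))%C
  with (0 - 24 * (2 * PI * Ci * lambert 2 1 (qexp tau)))%C.
- apply cderiv_minus; [apply cderiv_const|].
  now apply cderiv_scal, cderiv_lambert.
- rewrite E2_lambert, E4_lambert by trivial.
  assert (R := lambert_sqr (qexp tau) Hq).
  set (l := lambert 1 0 (qexp tau)) in *.
  replace ((1 - 24 * l) ^ 2)%C with (1 - 48 * l + 48 * (12 * l ^ 2))%C by ring.
  rewrite R; field; apply RtoC_neq_0; lra.
Qed.

(** * The transformation of E2 under SL_2(Z) *)

(** Both sums satisfy a fixed point equation obtained by shifting the index. *)
Lemma is_Csum_geom q : Cmod q < 1 -> is_Csum (fun _ => True) (fun n => q ^ n)%C (/ (1 - q))%C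
  /\ is_Csum (fun _ => True) (fun n => INR n * q ^ n)%C (q / (1 - q) ^ 2)%C.
Proof.
intros Hq; assert (Hq0 := Cmod_ge_0 q).
assert (N1 : (1 - q)%C <> 0).
{ apply Cminus_eq_contra; intros E; rewrite <- E, Cmod_1 in Hq; lra. }
assert (HS : forall k, is_Csum (fun _ => True) (fun n => INR n ^ k * q ^ n)%C
  (Csum (fun _ => True) (fun n => INR n ^ k * q ^ n)%C)).
{ intros k; apply summable_is_Csum.
  apply summable_le with (fun n => INR n ^ k * Cmod q ^ n); [|now apply summable_pow_geom].
  intros n _; rewrite Cmod_mult, !Cmod_pow, Cmod_R, Rabs_pos_eq by apply pos_INR; lra. }
assert (Shift : forall (f : nat -> C) s, is_Csum (fun _ => True) (fun n => f (S n)) s ->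
  is_Csum (fun _ => True) f (f 0%nat + s)%C).
{ intros f s Hs; apply is_Csum_add.
  apply is_Csum_ext with (fun n => f (S (pred n))); [intros [|n] H; [tauto|easy]|].
  apply (is_Csum_reindex pred _ (fun _ => True) (fun n => f (S n))); trivial.
  - intros [|i] [|j]; intros; lia.
  - intros j _; exists (S j); split; lia. }
assert (Sg := HS 0%nat); assert (Ss := HS 1%nat).
set (g := Csum _ (fun n => INR n ^ 0 * q ^ n)%C) in *.
set (s := Csum _ (fun n => INR n ^ 1 * q ^ n)%C) in *.
assert (Eg : g = (1 + q * g)%C).
{ apply (is_Csum_unique _ _ _ _ Sg).
  replace (1 + q * g)%C with ((INR 0 ^ 0 * q ^ 0) + q * g)%C by (simpl; ring).
  apply (Shift (fun n => INR n ^ 0 * q ^ n)%C).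
  eapply is_Csum_ext; [|apply (is_Csum_scal _ q _ _ Sg)]; intros n _; simpl; ring. }
assert (Es : s = (0 + (q * s + q * g))%C).
{ apply (is_Csum_unique _ _ _ _ Ss).
  replace (0 + (q * s + q * g))%C with ((INR 0 ^ 1 * q ^ 0) + (q * s + q * g))%C by (simpl; ring).
  apply (Shift (fun n => INR n ^ 1 * q ^ n)%C).
  eapply is_Csum_ext; [|apply is_Csum_plus; [apply (is_Csum_scal _ q _ _ Ss)|apply (is_Csum_scal _ q _ _ Sg)]].
  intros n _; rewrite S_INR, RtoC_plus; simpl; ring. }
assert (Eg' : g = (/ (1 - q))%C).
{ replace g with ((g - q * g) / (1 - q))%C by (field; trivial).
  rewrite Eg at 1; field; trivial. }
assert (Es' : s = (q / (1 - q) ^ 2)%C).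
{ replace s with ((s - q * s) / (1 - q))%C by (field; trivial).
  rewrite Es at 1; rewrite Eg'; field; trivial. }
rewrite <- Eg', <- Es'; split; [eapply is_Csum_ext; [|exact Sg]|eapply is_Csum_ext; [|exact Ss]];
intros n _; simpl; ring.
Qed.

Lemma qexp_mul_nat n z : qexp (INR n * z) = (qexp z ^ n)%C.
Proof.
induction n as [|n IH]; [simpl; rewrite Cmult_0_l; apply qexp_0|].
rewrite S_INR, RtoC_plus; replace ((INR n + 1) * z)%C with (z + INR n * z)%C by ring.
rewrite qexp_plus, IH; easy.
Qed.

Definition pos1 (n : nat) : Prop := (1 <= n)%nat.

Lemma pos1_neq_0 n : pos1 n <-> n <> 0%nat.
Proof. unfold pos1; lia. Qed.

Lemma is_Csum_geom2 tau : 0 < Im tau ->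
  is_Csum pos1 (fun x => geom2 (INR x * tau)) (lambert 1 0 (qexp tau)).
Proof.
intros Ht; assert (Hq := Cmod_qexp_lt_1 tau Ht).
apply (is_Csum_fiber snd pos2 pos1 (lambert_term 1 0 (qexp tau))).
- intros p Hp; apply Hp.
- now apply is_Csum_lambert.
- intros x Hx; unfold geom2; rewrite qexp_mul_nat; set (Q := (qexp tau ^ x)%C).
  assert (HQ : Cmod Q < 1).
  { unfold Q; rewrite Cmod_pow; destruct x as [|x]; [unfold pos1 in Hx; lia|].
    apply pow_lt_1_compat; [split; [apply Cmod_ge_0|trivial]|lia]. }
  apply is_Csum_ext with (fun p => INR (fst p) * Q ^ fst p)%C.
  { intros [a y] [_ E]; simpl in E; subst y; unfold lambert_term, Q; simpl fst; simpl snd.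
    rewrite (Nat.mul_comm a x), Cpow_mult_r; simpl; ring. }
  apply (is_Csum_reindex fst _ pos1 (fun n => INR n * Q ^ n)%C).
  + intros [a y] [[Ha _] _]; trivial.
  + intros [a y] [b z] [_ E] [_ E']; simpl in *; congruence.
  + intros a Ha; exists (a, x); repeat split; trivial.
  + assert (S1 : is_Csum pos1 (fun n => INR n * Q ^ n)%C (Csum pos1 (fun n => INR n * Q ^ n)%C)).
    { apply summable_is_Csum, (summable_sub _ (fun _ => True)); [easy|].
      apply summable_le with (fun n => INR n ^ 1 * Cmod Q ^ n).
      - intros n _; rewrite Cmod_mult, Cmod_pow, Cmod_R, Rabs_pos_eq by apply pos_INR; simpl; lra.
      - apply summable_pow_geom; split; [apply Cmod_ge_0|trivial]. }
    rewrite (is_Csum_unique _ _ _ _ (proj2 (is_Csum_geom Q HQ))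
      (is_Csum_add _ 0%nat _ (is_Csum_iff _ _ _ _ pos1_neq_0 S1))).
    simpl INR; rewrite Cmult_0_l, Cplus_0_l; trivial.
Qed.

Lemma is_Csum_Z_even (f : Z -> C) t : (forall c, f (- c)%Z = f c) ->
  is_Csum pos1 (fun n => f (Z.of_nat n)) t -> is_Csum (fun c => c <> 0%Z) f (2 * t)%C.
Proof.
intros Hf Ht; replace (2 * t)%C with (t + t)%C by ring.
assert (E : forall c, f (Z.of_nat (Z.abs_nat c)) = f c).
{ intros c; rewrite Zabs2Nat.id_abs; destruct (Z.abs_eq_or_opp c) as [-> | ->]; trivial. }
apply (is_Csum_split _ (fun c => (0 < c)%Z)).
- apply is_Csum_ext with (fun c => f (Z.of_nat (Z.abs_nat c))); [auto|].
  apply (is_Csum_reindex Z.abs_nat _ pos1 (fun n => f (Z.of_nat n))); trivial; unfold pos1.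
  + intros; lia.
  + intros; lia.
  + intros j Hj; exists (Z.of_nat j); lia.
- apply is_Csum_ext with (fun c => f (Z.of_nat (Z.abs_nat c))); [auto|].
  apply (is_Csum_reindex Z.abs_nat _ pos1 (fun n => f (Z.of_nat n))); trivial; unfold pos1.
  + intros; lia.
  + intros; lia.
  + intros j Hj; exists (- Z.of_nat j)%Z; lia.
Qed.

Lemma geom2_opp z : geom2 (- z) = geom2 z.
Proof.
unfold geom2; rewrite qexp_opp; assert (Hq := qexp_neq_0 z).
destruct (Ceq_dec (qexp z) 1) as [E|E].
- rewrite E; do 3 f_equal; field; apply C1_nz.
- field; repeat split; trivial; apply Cminus_eq_contra; auto.
Qed.

Lemma is_Csum_geom2_Z tau : 0 < Im tau ->
  is_Csum (fun c => c <> 0%Z) (fun c => geom2 (IZR c * tau)) (2 * lambert 1 0 (qexp tau))%C.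
Proof.
intros Ht; apply is_Csum_Z_even.
- intros c; rewrite opp_IZR, RtoC_opp; rewrite <- geom2_opp; f_equal; ring.
- eapply is_Csum_ext; [|now apply is_Csum_geom2]; intros n _; simpl; now rewrite <- INR_IZR_INZ.
Qed.

(** |c tau + d|^2 is a positive definite quadratic form in (c, d), with uniform
   bounds when tau stays in a vertical strip above a fixed height. *)
Lemma lattice_lower x0 y0 : 0 < y0 -> exists M, 0 < M /\
  forall (tau : C) (c d : R), Rabs (Re tau) <= x0 -> y0 <= Im tau ->
  c ^ 2 + d ^ 2 <= M * Cmod (c * tau + d) ^ 2.
Proof.
intros Hy; exists (2 + (1 + 2 * x0 ^ 2) / y0 ^ 2).
assert (Hy2 : 0 < y0 ^ 2) by now apply pow_lt.
assert (Hx2 := pow2_ge_0 x0).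
assert (Hq : 0 <= (1 + 2 * x0 ^ 2) / y0 ^ 2) by (apply Rdiv_le_0_compat; lra).
split; [lra|].
intros tau c d Hre Him.
rewrite Cmod2_alt, re_plus, im_plus, re_scal_l, im_scal_l, re_RtoC, im_RtoC, Rplus_0_r.
set (x := Re tau) in *; set (y := Im tau) in *.
assert (X : x ^ 2 <= x0 ^ 2) by (rewrite <- (pow2_abs x); apply pow_incr; split; [apply Rabs_pos|trivial]).
assert (Y : y0 ^ 2 <= y ^ 2) by (apply pow_incr; lra).
assert (C2 := pow2_ge_0 c).
assert (H1 : c ^ 2 * (1 + 2 * x0 ^ 2) <= (1 + 2 * x0 ^ 2) / y0 ^ 2 * (c * y) ^ 2).
{ replace ((1 + 2 * x0 ^ 2) / y0 ^ 2 * (c * y) ^ 2) with (c ^ 2 * (1 + 2 * x0 ^ 2) * (y ^ 2 / y0 ^ 2)) by (field; lra).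
  assert (1 <= y ^ 2 / y0 ^ 2) by (apply Rle_div_r; lra).
  assert (0 <= c ^ 2 * (1 + 2 * x0 ^ 2)) by nra; nra. }
assert (H2 : d ^ 2 <= 2 * (c * x + d) ^ 2 + 2 * c ^ 2 * x ^ 2).
{ assert (P := pow2_ge_0 (2 * c * x + d)); nra. }
assert (H3 : c ^ 2 * x ^ 2 <= c ^ 2 * x0 ^ 2) by nra.
assert (P := pow2_ge_0 (c * x + d)).
assert (Q := pow2_ge_0 (c * y)).
assert (0 <= (1 + 2 * x0 ^ 2) / y0 ^ 2 * (c * x + d) ^ 2) by nra.
nra.
Qed.

Lemma lattice_neq_0 tau (c d : R) : 0 < Im tau -> c <> 0 \/ d <> 0 -> (c * tau + d)%C <> 0.
Proof.
intros Ht Hcd E.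
assert (E1 := f_equal Re E); assert (E2 := f_equal Im E).
rewrite re_plus, re_scal_l, re_RtoC, re_RtoC in E1.
rewrite im_plus, im_scal_l, !im_RtoC in E2.
assert (c = 0) by (apply Rmult_eq_reg_r with (Im tau); lra); subst c.
destruct Hcd; lra.
Qed.

(** 1/x^2 and the telescoping 1/(x - 1/2) - 1/(x + 1/2) differ by O(x^-4), which
   makes the double series absolutely convergent. *)
Definition eis (tau : C) (c d : Z) : C :=
  (/ (IZR c * tau + IZR d) ^ 2
   - (/ (IZR c * tau + (IZR d - / 2)%R) - / (IZR c * tau + (IZR d + 1 - / 2)%R)))%C.

Definition tele (tau : C) (c d : Z) : C :=
  (/ (IZR c * tau + (IZR d - / 2)%R) - / (IZR c * tau + (IZR d + 1 - / 2)%R))%C.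

Lemma IZR_neq_0 c : c <> 0%Z -> IZR c <> 0.
Proof. apply eq_IZR_contrapositive. Qed.

Lemma IZR_sqr_ge_1 c : c <> 0%Z -> 1 <= IZR c ^ 2.
Proof.
intros H; replace (IZR c ^ 2) with (IZR (c * c)) by (rewrite mult_IZR; ring).
apply IZR_le; nia.
Qed.

Lemma tele_eq tau c d : 0 < Im tau -> c <> 0%Z ->
  tele tau c d = (/ ((IZR c * tau + (IZR d - / 2)%R) * (IZR c * tau + (IZR d + 1 - / 2)%R)))%C.
Proof.
intros Ht Hc; apply IZR_neq_0 in Hc; unfold tele.
assert (H1 := lattice_neq_0 tau (IZR c) (IZR d - / 2) Ht (or_introl Hc)).
assert (H2 := lattice_neq_0 tau (IZR c) (IZR d + 1 - / 2) Ht (or_introl Hc)).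
replace (IZR c * tau + (IZR d + 1 - / 2)%R)%C with ((IZR c * tau + (IZR d - / 2)%R) + 1)%C in *.
2:{ rewrite <- Cplus_assoc, <- RtoC_plus; do 2 f_equal; ring. }
field; split; trivial.
Qed.

Lemma eis_eq tau c d : 0 < Im tau -> c <> 0%Z ->
  eis tau c d = (- / 4 * / ((IZR c * tau + IZR d) ^ 2 *
    ((IZR c * tau + (IZR d - / 2)%R) * (IZR c * tau + (IZR d + 1 - / 2)%R))))%C.
Proof.
intros Ht Hc; unfold eis; fold (tele tau c d); rewrite tele_eq by trivial.
apply IZR_neq_0 in Hc.
assert (H0 := lattice_neq_0 tau (IZR c) (IZR d) Ht (or_introl Hc)).
assert (H1 := lattice_neq_0 tau (IZR c) (IZR d - / 2) Ht (or_introl Hc)).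
assert (H2 := lattice_neq_0 tau (IZR c) (IZR d + 1 - / 2) Ht (or_introl Hc)).
assert (N2 : RtoC 2 <> 0) by (apply RtoC_neq_0; lra).
replace (IZR c * tau + (IZR d + 1 - / 2)%R)%C with ((IZR c * tau + IZR d) + / 2)%C in *.
2:{ rewrite <- RtoC_inv, <- Cplus_assoc, <- RtoC_plus by lra; do 2 f_equal; field. }
replace (IZR c * tau + (IZR d - / 2)%R)%C with ((IZR c * tau + IZR d) - / 2)%C in *.
2:{ rewrite RtoC_minus, RtoC_inv by lra; ring. }
set (x := (IZR c * tau + IZR d)%C) in *.
assert (H1' : (2 * x - 1)%C <> 0).
{ intros E; apply H1; replace (x - / 2)%C with (/ 2 * (2 * x - 1))%C by (field; trivial); rewrite E; ring. }
assert (H2' : (2 * x + 1)%C <> 0).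
{ intros E; apply H2; replace (x + / 2)%C with (/ 2 * (2 * x + 1))%C by (field; trivial); rewrite E; ring. }
rewrite Cmult_comm in H1', H2'.
field; repeat split; trivial; apply RtoC_neq_0; lra.
Qed.

(** The lattice bound is applied at d, d - 1/2 and d + 1/2; for c <> 0 the product
   is at least of order (c^2 + d^2)^2 >= c^2 (1 + d^2), which factors. *)
Lemma summable_eis tau : 0 < Im tau ->
  summable (fun cd => fst cd <> 0%Z /\ True) (fun cd => Cmod (eis tau (fst cd) (snd cd))).
Proof.
intros Ht; destruct (lattice_lower (Rabs (Re tau)) (Im tau) Ht) as (M & HM & HL).
assert (HL' : forall c d : R, c ^ 2 + d ^ 2 <= M * Cmod (c * tau + d) ^ 2)
  by (intros; apply HL; lra).
apply summable_le with (fun cd => M ^ 2 * (/ (1 + IZR (fst cd) ^ 2) * / (1 + IZR (snd cd) ^ 2))).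
- intros [c d] [Hc _]; simpl fst in *; simpl snd.
  rewrite eis_eq by trivial.
  assert (Hc1 := IZR_sqr_ge_1 c Hc); apply IZR_neq_0 in Hc.
  assert (H0 := lattice_neq_0 tau (IZR c) (IZR d) Ht (or_introl Hc)).
  assert (H1 := lattice_neq_0 tau (IZR c) (IZR d - / 2) Ht (or_introl Hc)).
  assert (H2 := lattice_neq_0 tau (IZR c) (IZR d + 1 - / 2) Ht (or_introl Hc)).
  assert (L0 := HL' (IZR c) (IZR d)); assert (L1 := HL' (IZR c) (IZR d - / 2)).
  assert (L2 := HL' (IZR c) (IZR d + 1 - / 2)).
  apply Cmod_gt_0 in H0; apply Cmod_gt_0 in H1; apply Cmod_gt_0 in H2.
  rewrite Cmod_mult, Cmod_inv, !Cmod_mult, Cmod_pow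
    by (apply Cmult_neq_0; [apply Cpow_nz|apply Cmult_neq_0]; now apply Cmod_gt_0).
  rewrite Cmod_opp, Cmod_inv, Cmod_R, Rabs_pos_eq by (try lra; apply RtoC_neq_0; lra).
  set (x0 := Cmod (IZR c * tau + IZR d)) in *.
  set (x1 := Cmod (IZR c * tau + (IZR d - / 2)%R)) in *.
  set (x2 := Cmod (IZR c * tau + (IZR d + 1 - / 2)%R)) in *.
  set (C2 := IZR c ^ 2) in *; set (D := IZR d) in *.
  assert (D2 := pow2_ge_0 D).
  assert (K1 : (C2 + D ^ 2) <= 2 * (M * x1 ^ 2)).
  { assert (P := pow2_ge_0 (D - 1)).
    replace ((D - / 2) ^ 2) with (D ^ 2 - D + / 4) in L1 by field.
    replace ((D - 1) ^ 2) with (D ^ 2 - 2 * D + 1) in P by ring. lra. }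
  assert (K2 : (C2 + D ^ 2) <= 2 * (M * x2 ^ 2)).
  { assert (P := pow2_ge_0 (D + 1)).
    replace ((D + 1 - / 2) ^ 2) with (D ^ 2 + D + / 4) in L2 by field.
    replace ((D + 1) ^ 2) with (D ^ 2 + 2 * D + 1) in P by ring; lra. }
  assert (K3 : (C2 + D ^ 2) <= 2 * (M * (x1 * x2))).
  { apply Rsqr_incr_0; [|nra|nra]; unfold Rsqr.
    replace (2 * (M * (x1 * x2)) * (2 * (M * (x1 * x2))))
      with ((2 * (M * x1 ^ 2)) * (2 * (M * x2 ^ 2))) by ring.
    apply Rmult_le_compat; lra. }
  rewrite <- Rinv_mult, <- Rinv_mult.
  apply (Rmult_le_reg_r (4 * (x0 ^ 2 * (x1 * x2)))).
  { repeat apply Rmult_lt_0_compat; lra. }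
  rewrite Rinv_l by (apply Rgt_not_eq; repeat apply Rmult_lt_0_compat; lra).
  apply (Rmult_le_reg_r ((1 + C2) * (1 + D ^ 2))); [nra|].
  replace (M ^ 2 * / ((1 + C2) * (1 + D ^ 2)) * (4 * (x0 ^ 2 * (x1 * x2))) * ((1 + C2) * (1 + D ^ 2)))
    with (2 * ((M * x0 ^ 2) * (2 * (M * (x1 * x2))))) by (field; lra).
  apply Rle_trans with (2 * ((C2 + D ^ 2) * (C2 + D ^ 2))); [nra|].
  apply Rmult_le_compat_l; [lra|]; apply Rmult_le_compat; lra.
- apply summable_scal; [apply pow_le; lra|].
  apply (summable_sub _ (fun cd => True /\ True)); [easy|].
  apply (summable_prod (fun _ => True) (fun _ => True) (fun c => / (1 + IZR c ^ 2)) (fun c => / (1 + IZR c ^ 2)));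
  try exact summable_Z_inv_sq;
  intros c _; apply Rlt_le, Rinv_0_lt_compat; assert (P := pow2_ge_0 (IZR c)); lra.
Qed.

Lemma summable_tele_d tau c : 0 < Im tau -> c <> 0%Z ->
  summable (fun _ => True) (fun d => Cmod (tele tau c d)).
Proof.
intros Ht Hc.
apply summable_le with (fun d => Cmod (/ (IZR c * tau + IZR d) ^ 2) + Cmod (eis tau c d)).
- intros d _.
  replace (tele tau c d) with (/ (IZR c * tau + IZR d) ^ 2 + - eis tau c d)%C
    by (unfold eis, tele; ring).
  rewrite <- (Cmod_opp (eis tau c d)); apply Cmod_triangle.
- apply summable_plus; [apply summable_shift_sq|].
  apply (summable_inj (fun d => (c, d)) _ _ _ ) with (2 := fun i j _ _ (E : (c, i) = (c, j)) =>
    f_equal snd E) (3 := summable_eis tau Ht); simpl; auto.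
Qed.

Lemma summable_inv_sq_c tau d : 0 < Im tau ->
  summable (fun c => c <> 0%Z) (fun c => Cmod (/ (IZR c * tau + IZR d) ^ 2)).
Proof.
intros Ht; destruct (lattice_lower (Rabs (Re tau)) (Im tau) Ht) as (M & HM & HL).
apply summable_le with (fun c => (2 * M) * / (1 + IZR c ^ 2)).
- intros c Hc; assert (Hc1 := IZR_sqr_ge_1 c Hc); apply IZR_neq_0 in Hc.
  assert (H0 := lattice_neq_0 tau (IZR c) (IZR d) Ht (or_introl Hc)).
  assert (L0 := HL tau (IZR c) (IZR d) ltac:(lra) ltac:(lra)).
  rewrite Cmod_inv, Cmod_pow by now apply Cpow_nz.
  apply Cmod_gt_0 in H0; set (x := Cmod _) in *.
  apply (Rmult_le_reg_r (x ^ 2)); [now apply pow_lt|]; rewrite Rinv_l by (apply pow_nonzero; lra).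
  apply (Rmult_le_reg_r (1 + IZR c ^ 2)); [lra|].
  replace (2 * M * / (1 + IZR c ^ 2) * x ^ 2 * (1 + IZR c ^ 2)) with (2 * (M * x ^ 2)) by (field; lra).
  assert (P := pow2_ge_0 (IZR d)); lra.
- apply summable_scal; [lra|]; apply (summable_sub _ (fun _ => True)); [easy|apply summable_Z_inv_sq].
Qed.

Lemma summable_tele_c tau d : 0 < Im tau ->
  summable (fun c => c <> 0%Z) (fun c => Cmod (tele tau c d)).
Proof.
intros Ht.
apply summable_le with (fun c => Cmod (/ (IZR c * tau + IZR d) ^ 2) + Cmod (eis tau c d)).
- intros c _.
  replace (tele tau c d) with (/ (IZR c * tau + IZR d) ^ 2 + - eis tau c d)%C
    by (unfold eis, tele; ring).
  rewrite <- (Cmod_opp (eis tau c d)); apply Cmod_triangle.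
- apply summable_plus; [now apply summable_inv_sq_c|].
  apply (summable_inj (fun c => (c, d)) _ _ _ ) with (2 := fun i j _ _ (E : (i, d) = (j, d)) =>
    f_equal fst E) (3 := summable_eis tau Ht); simpl; auto.
Qed.

Definition Zrange (N : nat) : list Z :=
  map (fun k => (Z.of_nat k - Z.of_nat N)%Z) (seq 0 (2 * N + 1)).

Lemma Zrange_In N d : In d (Zrange N) <-> (Z.abs d <= Z.of_nat N)%Z.
Proof.
unfold Zrange; rewrite in_map_iff; split.
- intros (k & <- & Hk); apply in_seq in Hk; lia.
- intros H; exists (Z.to_nat (d + Z.of_nat N)); rewrite in_seq; lia.
Qed.

Lemma Zrange_NoDup N : NoDup (Zrange N).
Proof.
apply NoDup_map_NoDup_ForallPairs; [|apply seq_NoDup]; intros i j _ _ E; lia.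
Qed.

Lemma Zrange_exhaust (L : list Z) : exists N0, forall N, (N0 <= N)%nat -> incl L (Zrange N).
Proof.
induction L as [|d L (N0 & H)]; [exists 0%nat; intros N _ i []|].
exists (N0 + Z.to_nat (Z.abs d))%nat; intros N HN i [<-|Hi].
- apply Zrange_In; lia.
- apply (H N); trivial; lia.
Qed.

Definition Clim_seq (u : nat -> C) (s : C) : Prop :=
  forall eps, 0 < eps -> exists N0, forall N, (N0 <= N)%nat -> Cmod (u N - s) < eps.

Lemma Clim_seq_unique u s t : Clim_seq u s -> Clim_seq u t -> s = t.
Proof.
intros Hs Ht; apply Ceq_eps; intros eps He.
destruct (Hs (eps / 2)) as (N1 & H1); [lra|]; destruct (Ht (eps / 2)) as (N2 & H2); [lra|].
specialize (H1 (N1 + N2)%nat ltac:(lia)); specialize (H2 (N1 + N2)%nat ltac:(lia)).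
replace (s - t)%C with (- (u (N1 + N2)%nat - s) + (u (N1 + N2)%nat - t))%C by ring.
eapply Rle_trans; [apply Cmod_triangle|]; rewrite Cmod_opp; lra.
Qed.

Lemma Clim_seq_bound u s K N0 : 0 <= K ->
  (forall N, (N0 <= N)%nat -> Cmod (u N - s) <= K * / (INR N + / 2)) -> Clim_seq u s.
Proof.
intros HK H eps He; destruct (nfloor_ex (K / eps)) as (N1 & H1); [now apply Rdiv_le_0_compat|].
exists (N0 + S N1)%nat; intros N HN.
assert (HN1 : INR N1 + 1 <= INR N) by (rewrite <- S_INR; apply le_INR; lia).
assert (P := pos_INR N1).
eapply Rle_lt_trans; [apply H; lia|].
apply (Rmult_lt_reg_r (INR N + / 2)); [lra|].
rewrite Rmult_assoc, Rinv_l, Rmult_1_r by lra.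
replace K with (K / eps * eps) by (field; lra); rewrite Rmult_comm.
apply Rmult_lt_compat_l; lra.
Qed.

Lemma is_Csum_Z_limit (f : Z -> C) s : is_Csum (fun _ => True) f s ->
  Clim_seq (fun N => Csum_list f (Zrange N)) s.
Proof.
intros Hs eps He; destruct (proj1 (is_Csum_eps _ _ _) Hs eps He) as (L0 & _ & H).
destruct (Zrange_exhaust L0) as (N0 & HN); exists N0; intros N H'.
apply H; [apply Zrange_NoDup|now apply Forall_forall|auto].
Qed.

Lemma Csum_list_telescope (g : Z -> C) N :
  Csum_list (fun d => g d - g (d + 1)%Z)%C (Zrange N)
  = (g (- Z.of_nat N)%Z - g (Z.of_nat N + 1)%Z)%C.
Proof.
assert (K : forall n a, Csum_list (fun d => g d - g (d + 1)%Z)%C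
  (map (fun k => (Z.of_nat k + a)%Z) (seq 0 n)) = (g a - g (Z.of_nat n + a)%Z)%C).
{ induction n as [|n IH]; intros a.
  { change (Z.of_nat 0 + a)%Z with a; unfold Csum_list; simpl; ring. }
  rewrite seq_S, map_app, Csum_list_app, IH, Nat.add_0_l; simpl map.
  rewrite Csum_list_single.
  replace (Z.of_nat (S n) + a)%Z with (Z.of_nat n + a + 1)%Z by lia; ring. }
unfold Zrange; rewrite (map_ext _ (fun k => (Z.of_nat k + - Z.of_nat N)%Z)) by (intros; lia).
rewrite K; f_equal; f_equal; lia.
Qed.

Lemma Csum_list_tele tau c N : Csum_list (tele tau c) (Zrange N)
  = (/ (IZR c * tau - (INR N + / 2)%R) - / (IZR c * tau + (INR N + / 2)%R))%C.
Proof.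
rewrite (Csum_list_ext (fun _ => True) (tele tau c)
  (fun d => (fun d => / (IZR c * tau + (IZR d - / 2)%R))%C d
    - (fun d => / (IZR c * tau + (IZR d - / 2)%R))%C (d + 1)%Z)%C);
  [|intros d _; unfold tele; now rewrite plus_IZR|now apply Forall_forall].
rewrite (Csum_list_telescope (fun d => / (IZR c * tau + (IZR d - / 2)%R))%C).
rewrite plus_IZR, opp_IZR, <- INR_IZR_INZ.
replace (- INR N - / 2) with (- (INR N + / 2)) by ring; rewrite RtoC_opp.
now replace (INR N + 1 - / 2) with (INR N + / 2) by field.
Qed.

(** The telescoping part contributes nothing to the rows, by [is_Csum_tele_row];
   its column sums are what prevents E2 from being modular. *)
Definition tele_col (tau : C) (d : Z) : C := Csum (fun c => c <> 0%Z) (fun c => tele tau c d).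

Lemma is_Csum_tele_col tau d : 0 < Im tau ->
  is_Csum (fun c => c <> 0%Z) (fun c => tele tau c d) (tele_col tau d).
Proof. intros Ht; now apply summable_is_Csum, summable_tele_c. Qed.

Lemma is_Csum_tele_row tau c : 0 < Im tau -> c <> 0%Z ->
  is_Csum (fun _ => True) (tele tau c) 0.
Proof.
intros Ht Hc.
assert (S : is_Csum (fun _ => True) (tele tau c) (Csum (fun _ => True) (tele tau c)))
  by now apply summable_is_Csum, summable_tele_d.
replace (RtoC 0) with (Csum (fun _ => True) (tele tau c)); trivial.
apply (Clim_seq_unique _ _ _ (is_Csum_Z_limit _ _ S)).
set (z := (IZR c * tau)%C).
destruct (nfloor_ex (2 * Cmod z)) as (N0 & HN0); [assert (P := Cmod_ge_0 z); lra|].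
apply (Clim_seq_bound _ _ 4 (Datatypes.S N0)); [lra|]; intros N HN; rewrite Csum_list_tele.
assert (HNr : 2 * Cmod z < INR N) by (apply le_INR in HN; rewrite S_INR in HN; lra).
assert (Pz := Cmod_ge_0 z).
assert (B : forall x : R, INR N + / 2 <= Rabs x -> Cmod (/ (z + x)) <= 2 * / (INR N + / 2)).
{ intros x Hx.
  assert (H1 : (INR N + / 2) / 2 <= Cmod (z + x)).
  { assert (T := Cmod_triangle (z + x) (- z)); rewrite Cmod_opp in T.
    replace (z + x + - z)%C with (RtoC x) in T by ring; rewrite Cmod_R in T; lra. }
  rewrite Cmod_inv by (apply Cmod_gt_0; lra).
  replace (2 * / (INR N + / 2)) with (/ ((INR N + / 2) / 2)) by (field; lra).
  apply Rinv_le_contravar; lra. }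
assert (B1 := B (- (INR N + / 2))); rewrite Rabs_Ropp, Rabs_pos_eq, RtoC_opp in B1 by lra.
assert (B2 := B (INR N + / 2)); rewrite Rabs_pos_eq in B2 by lra.
specialize (B1 (Rle_refl _)); specialize (B2 (Rle_refl _)).
fold z; replace (/ (z - (INR N + / 2)%R) - / (z + (INR N + / 2)%R) - 0)%C
  with (/ (z + - (INR N + / 2)%R) + - / (z + (INR N + / 2)%R))%C by (unfold Cminus; ring).
eapply Rle_trans; [apply Cmod_triangle|]; rewrite Cmod_opp; lra.
Qed.

Lemma Im_opp_inv tau : 0 < Im tau -> 0 < Im (- / tau).
Proof.
destruct tau as [x y]; simpl; intros H.
replace (- (- y / (x * (x * 1) + y * (y * 1)))) with (y / (x ^ 2 + y ^ 2)) by (simpl; field; nra).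
apply Rdiv_lt_0_compat; trivial; assert (P := pow2_ge_0 x); assert (0 < y ^ 2) by (apply pow_lt; trivial); lra.
Qed.

Lemma Cneq_0_Im tau : 0 < Im tau -> tau <> 0.
Proof. intros H E; rewrite E in H; simpl in H; lra. Qed.

(** Each row is a squared cosecant series, evaluated by [Zsum_sq_eq]. *)
Lemma eis_rows tau : 0 < Im tau ->
  is_Csum (fun cd => fst cd <> 0%Z /\ True) (fun cd => eis tau (fst cd) (snd cd))
    (- (4 * PI ^ 2) * (2 * lambert 1 0 (qexp tau)))%C.
Proof.
intros Ht.
assert (S := summable_is_Csum _ _ (summable_eis tau Ht)).
match type of S with is_Csum ?A ?f ?s => assert (S' : is_Csum (fun c => c <> 0%Z)
  (fun c => - (4 * PI ^ 2) * geom2 (IZR c * tau))%C s) end.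
{ apply (is_Csum_fiber fst _ _ _ (fun c => - (4 * PI ^ 2) * geom2 (IZR c * tau))%C _ (fun p Hp => proj1 Hp) S).
  intros c Hc; cbv beta.
  apply (is_Csum_reindex_snd c (fun c => c <> 0%Z) (fun c d => eis tau c d)); trivial.
  replace (- (4 * PI ^ 2) * geom2 (IZR c * tau))%C with (Zsum_sq (IZR c * tau) - 0)%C.
  - apply is_Csum_minus; [apply is_Csum_Zsum_sq|now apply is_Csum_tele_row].
  - rewrite Zsum_sq_eq; [ring|].
    destruct (Z.lt_total c 0) as [H|[H|H]]; [|easy|].
    + intros E; apply (qexp_neq_1 (- (IZR c * tau))); [|rewrite qexp_opp, E; field; apply C1_nz].
      rewrite im_opp, im_scal_l; apply IZR_lt in H; nra.
    + apply qexp_neq_1; rewrite im_scal_l; apply IZR_lt in H; nra. }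
rewrite <- (is_Csum_unique _ _ _ _ S' (is_Csum_scal _ _ _ _ (is_Csum_geom2_Z tau Ht))); trivial.
Qed.

(** In the columns, c tau + d = tau (c + d / tau) turns the squared cosecant series
   into those attached to - / tau; the excluded terms c = 0 add up to the value
   given by [is_Csum_zeta2]. *)
Lemma eis_cols tau : 0 < Im tau ->
  is_Csum (fun _ => True) (tele_col tau)
    (/ tau ^ 2 * (- (4 * PI ^ 2) * (2 * lambert 1 0 (qexp (- / tau))))
     + PI ^ 2 / 3 * (/ tau ^ 2 - 1)
     + 4 * PI ^ 2 * (2 * lambert 1 0 (qexp tau)))%C.
Proof.
intros Ht; assert (Ht0 := Cneq_0_Im tau Ht); assert (Ht' := Im_opp_inv tau Ht).
set (col := fun d => Csum (fun c => c <> 0%Z) (fun c => / (IZR c * tau + IZR d) ^ 2)%C).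
assert (Hcol : forall d, is_Csum (fun c => c <> 0%Z) (fun c => / (IZR c * tau + IZR d) ^ 2)%C (col d))
  by (intros d; now apply summable_is_Csum, summable_inv_sq_c).
assert (S : is_Csum (fun _ => True) (fun d => col d - tele_col tau d)%C
  (- (4 * PI ^ 2) * (2 * lambert 1 0 (qexp tau)))%C).
{ apply (is_Csum_fiber snd (fun cd => fst cd <> 0%Z /\ True) (fun _ => True)
    (fun cd => eis tau (fst cd) (snd cd))); trivial; [now apply eis_rows|].
  intros d _; cbv beta.
  apply (is_Csum_reindex_fst d (fun c => c <> 0%Z) (fun c d => eis tau c d)).
  apply is_Csum_minus; [apply Hcol|now apply is_Csum_tele_col]. }
assert (Ecol0 : col 0%Z = (/ tau ^ 2 * (PI ^ 2 / 3))%C).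
{ apply (is_Csum_unique _ _ _ _ (Hcol 0%Z)).
  apply is_Csum_ext with (fun c => / tau ^ 2 * / IZR c ^ 2)%C.
  - intros c Hc; rewrite Cplus_0_r; assert (IZR c <> 0 :> C).
    { now apply RtoC_neq_0, IZR_neq_0. }
    field; split; trivial.
  - apply is_Csum_scal, is_Csum_zeta2. }
assert (Ecol : forall d, d <> 0%Z ->
  col d = (/ tau ^ 2 * (- (4 * PI ^ 2) * geom2 (IZR d * - / tau)) - / IZR d ^ 2)%C).
{ intros d Hd.
  assert (Hd0 : RtoC (IZR d) <> 0) by (intros E; apply RtoC_inj in E; now apply (IZR_neq_0 d)).
  assert (F : is_Csum (fun _ => True) (fun c => / (IZR c * tau + IZR d) ^ 2)%C
    (/ tau ^ 2 * Zsum_sq (IZR d / tau))%C).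
  { apply is_Csum_ext with (fun c => / tau ^ 2 * / (IZR d / tau + IZR c) ^ 2)%C;
      [|apply is_Csum_scal, is_Csum_Zsum_sq].
    intros c _.
    assert (H0 := lattice_neq_0 tau (IZR c) (IZR d) Ht (or_intror (IZR_neq_0 d Hd))).
    replace (IZR d / tau + IZR c)%C with ((IZR c * tau + IZR d) / tau)%C by (field; trivial).
    field; split; trivial. }
  assert (E := is_Csum_unique _ _ _ _ F (is_Csum_add _ 0%Z _ (Hcol d))); cbv beta in E.
  rewrite Cmult_0_l, Cplus_0_l in E.
  replace (col d) with (/ IZR d ^ 2 + col d - / IZR d ^ 2)%C by ring.
  rewrite <- E, Zsum_sq_eq.
  - replace (IZR d * - / tau)%C with (- (IZR d / tau))%C by (unfold Cdiv; ring).
    rewrite geom2_opp; ring.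
  - destruct (Z.lt_total d 0) as [H|[H|H]]; [|easy|].
    + replace (IZR d / tau)%C with (- IZR d * - / tau)%C by (unfold Cdiv; ring).
      rewrite <- RtoC_opp; apply qexp_neq_1; rewrite im_scal_l; apply IZR_lt in H; nra.
    + intros E'; apply (qexp_neq_1 (- (IZR d / tau)));
        [|rewrite qexp_opp, E'; field; apply C1_nz].
      replace (- (IZR d / tau))%C with (IZR d * - / tau)%C by (unfold Cdiv; ring).
      rewrite im_scal_l; apply IZR_lt in H; nra. }
assert (Tcol : is_Csum (fun _ => True) col (/ tau ^ 2 * (PI ^ 2 / 3)
  + (/ tau ^ 2 * (- (4 * PI ^ 2) * (2 * lambert 1 0 (qexp (- / tau)))) - PI ^ 2 / 3))%C).
{ rewrite <- Ecol0; apply is_Csum_add.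
  apply is_Csum_ext with (fun d => / tau ^ 2 * (- (4 * PI ^ 2) * geom2 (IZR d * - / tau)) - / IZR d ^ 2)%C.
  { intros d Hd; now rewrite Ecol. }
  apply is_Csum_minus; [|apply is_Csum_zeta2].
  apply is_Csum_scal, is_Csum_scal; now apply is_Csum_geom2_Z. }
apply is_Csum_ext with (fun d => col d - (col d - tele_col tau d))%C; [intros; ring|].
assert (U := is_Csum_minus _ _ _ _ _ Tcol S).
match type of U with is_Csum _ _ ?a => match goal with |- is_Csum _ _ ?b => replace b with a; trivial end end.
field; repeat split; trivial; apply RtoC_neq_0; lra.
Qed.

(** Up to a constant factor this is tau times the sum of the [tele_col]; the factor
   tau makes it invariant under scalings of tau. *)
Definition E2_defect (tau : C) : C := (/ tau * E2 (- / tau) - tau * E2 tau)%C.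

Lemma is_Csum_tele_defect tau : 0 < Im tau ->
  is_Csum (fun _ => True) (tele_col tau) (PI ^ 2 / 3 * (E2_defect tau / tau))%C.
Proof.
intros Ht; assert (Ht0 := Cneq_0_Im tau Ht); assert (Ht' := Im_opp_inv tau Ht).
assert (S := eis_cols tau Ht); unfold E2_defect; rewrite !E2_lambert by trivial.
match type of S with is_Csum _ _ ?a => match goal with |- is_Csum _ _ ?b => replace b with a; trivial end end.
field; repeat split; trivial; apply RtoC_neq_0; lra.
Qed.

Lemma is_Csum_tele_partial tau N : 0 < Im tau ->
  is_Csum (fun c => c <> 0%Z)
    (fun c => / (IZR c * tau - (INR N + / 2)%R) - / (IZR c * tau + (INR N + / 2)%R))%C
    (Csum_list (tele_col tau) (Zrange N)).
Proof.
intros Ht.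
apply is_Csum_ext with (fun c => Csum_list (fun d => tele tau c d) (Zrange N)).
{ intros c _; apply Csum_list_tele. }
apply (is_Csum_list _ (fun d c => tele tau c d)); intros d _; now apply is_Csum_tele_col.
Qed.

(** The symmetric partial sums only depend on the ratio of tau and N + 1/2. *)
Lemma E2_defect_scale k tau : 0 < Im tau ->
  E2_defect (INR (2 * k + 1) * tau) = E2_defect tau.
Proof.
intros Ht; set (m := (2 * k + 1)%nat).
assert (Hm : 0 < INR m) by (apply lt_0_INR; unfold m; lia).
assert (Hm0 : RtoC (INR m) <> 0) by (apply RtoC_neq_0; lra).
assert (Ht0 := Cneq_0_Im tau Ht).
assert (Ht' : 0 < Im (INR m * tau)) by (rewrite im_scal_l; nra).
assert (P0 : RtoC PI <> 0) by (apply RtoC_neq_0; assert (P := PI_RGT_0); lra).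
assert (H1 := is_Csum_Z_limit _ _ (is_Csum_tele_defect tau Ht)).
assert (H2 := is_Csum_Z_limit _ _ (is_Csum_tele_defect _ Ht')).
set (s := (PI ^ 2 / 3 * (E2_defect tau / tau))%C) in *.
set (s' := (PI ^ 2 / 3 * (E2_defect (INR m * tau) / (INR m * tau)))%C) in *.
assert (E : forall N, Csum_list (tele_col (INR m * tau)) (Zrange (m * N + k))
  = (/ INR m * Csum_list (tele_col tau) (Zrange N))%C).
{ intros N.
  apply (is_Csum_unique _ _ _ _ (is_Csum_tele_partial (INR m * tau) (m * N + k) Ht')).
  eapply is_Csum_ext; [|apply is_Csum_scal, (is_Csum_tele_partial tau N Ht)].
  intros c Hc; cbv beta.
  replace (INR (m * N + k) + / 2) with (INR m * (INR N + / 2)).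
  2:{ unfold m; rewrite !plus_INR, !mult_INR, plus_INR, mult_INR; simpl; field. }
  rewrite RtoC_mult; apply IZR_neq_0 in Hc.
  assert (N1 := lattice_neq_0 tau (IZR c) (- (INR N + / 2)) Ht (or_introl Hc)).
  assert (N2 := lattice_neq_0 tau (IZR c) (INR N + / 2) Ht (or_introl Hc)).
  rewrite RtoC_opp in N1; fold (IZR c * tau - (INR N + / 2)%R)%C in N1.
  set (h := RtoC (INR N + / 2)) in *; set (x := RtoC (INR m)) in *.
  replace (IZR c * (x * tau) - x * h)%C with (x * (IZR c * tau - h))%C by ring.
  replace (IZR c * (x * tau) + x * h)%C with (x * (IZR c * tau + h))%C by ring.
  field; repeat split; trivial. }
assert (Es : s' = (/ INR m * s)%C).
{ apply (Clim_seq_unique (fun N => / INR m * Csum_list (tele_col tau) (Zrange N))%C).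
  - intros eps He; destruct (H2 eps He) as (N0 & HN); exists N0; intros N HN0.
    rewrite <- E; apply HN; unfold m; nia.
  - intros eps He; destruct (H1 (INR m * eps)) as (N0 & HN); [now apply Rmult_lt_0_compat|].
    exists N0; intros N HN0.
    replace (_ - _)%C with (/ INR m * (Csum_list (tele_col tau) (Zrange N) - s))%C by ring.
    rewrite Cmod_mult, Cmod_inv, Cmod_R, Rabs_pos_eq by (trivial; lra).
    apply (Rmult_lt_reg_l (INR m)); trivial; rewrite <- Rmult_assoc, Rinv_r by lra.
    rewrite Rmult_1_l; auto. }
assert (N3 : RtoC 3 <> 0) by (apply RtoC_neq_0; lra).
replace (E2_defect (INR m * tau)) with (INR m * tau * (3 / PI ^ 2 * s'))%C
  by (unfold s'; field; repeat split; trivial).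
rewrite Es; unfold s; field; repeat split; trivial.
Qed.

Lemma cderiv_opp_inv (tau : C) : tau <> 0 -> cderiv (fun w => - / w)%C tau (/ tau ^ 2)%C.
Proof.
intros H; assert (D := cderiv_opp _ _ _ (cderiv_inv _ _ _ H (cderiv_id tau))).
replace (/ tau ^ 2)%C with (- (- (1) / tau ^ 2))%C; trivial; field; trivial.
Qed.

Lemma cderiv_E2_defect tau : 0 < Im tau -> exists l, cderiv E2_defect tau l.
Proof.
intros Ht; assert (Ht0 := Cneq_0_Im tau Ht); assert (Ht' := Im_opp_inv tau Ht).
eexists; apply cderiv_minus; apply cderiv_mult.
- apply (cderiv_inv (fun w => w) tau 1); [trivial|apply cderiv_id].
- apply (cderiv_comp E2); [now apply cderiv_E2|now apply cderiv_opp_inv].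
- apply cderiv_id.
- now apply cderiv_E2.
Qed.

(** Invariance under the multiplications by (2 n + 3) / (2 n + 1), which tend
   to 1, forces the derivative to vanish. *)
Lemma cderiv_E2_defect_0 tau : 0 < Im tau -> cderiv E2_defect tau 0.
Proof.
intros Ht; destruct (cderiv_E2_defect tau Ht) as (l & Hl).
assert (Ht0 := Cneq_0_Im tau Ht).
replace (RtoC 0) with l; trivial; apply Cmod_eq_0, Rle_antisym; [|apply Cmod_ge_0].
apply Rnot_lt_le; intros P.
destruct (Hl (Cmod l / 2)) as (d & Hd & Hw); [lra|].
destruct (nfloor_ex (2 * Cmod tau / d)) as (n & Hn).
{ apply Rlt_le, Rdiv_lt_0_compat; trivial.
  assert (0 < Cmod tau) by (apply Cmod_gt_0; trivial); lra. }
set (x := INR (2 * n + 1)).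
assert (Hx : INR n + 1 <= x).
{ unfold x; rewrite plus_INR, mult_INR; simpl; assert (Q := pos_INR n); lra. }
assert (Hx0 : 0 < x) by (assert (Q := pos_INR n); lra).
assert (HxC : RtoC x <> 0) by (apply RtoC_neq_0; lra).
set (h := ((2 / x)%R * tau)%C).
assert (E : E2_defect (tau + h) = E2_defect tau).
{ set (s := ((/ x)%R * tau)%C).
  assert (Hs : 0 < Im s).
  { unfold s; rewrite im_scal_l; apply Rmult_lt_0_compat; trivial; now apply Rinv_0_lt_compat. }
  transitivity (E2_defect s).
  - rewrite <- (E2_defect_scale (n + 1) s Hs); f_equal; unfold h, s.
    rewrite Cmult_assoc, <- RtoC_mult.
    replace (tau + (2 / x)%R * tau)%C with ((1 + 2 / x)%R * tau)%C by (rewrite RtoC_plus; ring).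
    do 2 f_equal; replace (INR (2 * (n + 1) + 1)) with (x + 2).
    + field; lra.
    + unfold x; rewrite !plus_INR, !mult_INR, plus_INR; simpl; ring.
  - rewrite <- (E2_defect_scale n s Hs); f_equal; unfold s; fold x.
    rewrite Cmult_assoc, <- RtoC_mult, Rinv_r by lra; ring. }
assert (Hh : Cmod h = 2 / x * Cmod tau).
{ unfold h; rewrite Cmod_mult, Cmod_R, Rabs_pos_eq; trivial; apply Rlt_le, Rdiv_lt_0_compat; lra. }
assert (Ptau : 0 < Cmod tau) by now apply Cmod_gt_0.
assert (Hh0 : 0 < Cmod h).
{ rewrite Hh; apply Rmult_lt_0_compat; trivial; apply Rdiv_lt_0_compat; lra. }
specialize (Hw (tau + h)%C); rewrite E in Hw.
replace (tau + h - tau)%C with h in Hw by ring.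
replace (E2_defect tau - E2_defect tau - h * l)%C with (- (h * l))%C in Hw by ring.
rewrite Cmod_opp, Cmod_mult in Hw.
assert (Hlt : Cmod h < d).
{ rewrite Hh; apply (Rmult_lt_reg_r x); trivial.
  replace (2 / x * Cmod tau * x) with (2 * Cmod tau / d * d) by (field; lra).
  rewrite Rmult_comm; apply Rmult_lt_compat_l; lra. }
specialize (Hw Hlt); nra.
Qed.

(** Riemann sums of the decreasing function 1 / (1 + x^2) at the points c / M. *)
Lemma atan_sum_bounds M K : 0 < M ->
  atan (INR (S K) / M) - atan (/ M) <= Rsum_list (fun c => M / (INR c ^ 2 + M ^ 2)) (seq 1 K)
    <= atan (INR K / M).
Proof.
intros HM.
assert (Step : forall x, 0 <= x -> exists c, x <= c <= x + 1 /\
  atan ((x + 1) / M) - atan (x / M) = M / (c ^ 2 + M ^ 2)).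
{ intros x Hx.
  destruct (MVT_gen (fun t => atan (t / M)) x (x + 1) (fun t => M / (t ^ 2 + M ^ 2))) as (c & Hc & E).
  - intros t _; auto_derive; trivial; unfold Rsqr; field; repeat split; try lra; nra.
  - intros t _; apply derivable_continuous_pt; exists (M / (t ^ 2 + M ^ 2)).
    apply is_derive_Reals; auto_derive; trivial; unfold Rsqr; field; repeat split; try lra; nra.
  - rewrite Rmin_left, Rmax_right in Hc by lra; exists c; split; trivial.
    rewrite E; ring. }
assert (Mono : forall a b, 0 <= a <= b -> M / (b ^ 2 + M ^ 2) <= M / (a ^ 2 + M ^ 2)).
{ intros a b Hab; apply Rmult_le_compat_l; [lra|]; apply Rinv_le_contravar; [nra|].
  assert (a ^ 2 <= b ^ 2) by (apply pow_incr; lra); lra. }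
induction K as [|K IH].
- unfold Rsum_list; simpl; unfold Rdiv; rewrite Rmult_1_l, Rmult_0_l, atan_0; lra.
- rewrite seq_S, Rsum_list_app; change (1 + K)%nat with (S K).
  change (Rsum_list (fun c => M / (INR c ^ 2 + M ^ 2)) [S K]) with (M / (INR (S K) ^ 2 + M ^ 2) + 0).
  destruct (Step (INR K) (pos_INR K)) as (c1 & Hc1 & E1).
  destruct (Step (INR (S K)) (pos_INR (S K))) as (c2 & Hc2 & E2).
  assert (Q := pos_INR K); rewrite <- !S_INR in *.
  assert (Q' := pos_INR (S K)).
  assert (A1 := Mono c1 (INR (S K)) ltac:(lra)).
  assert (A2 := Mono (INR (S K)) c2 ltac:(lra)).
  lra.
Qed.

Lemma atan_le_id x : 0 <= x -> atan x <= x.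
Proof.
intros Hx; destruct (MVT_gen atan 0 x (fun t => / (1 + t ^ 2))) as (c & _ & E).
- intros t _; apply is_derive_Reals, derivable_pt_lim_atan.
- intros t _; apply derivable_continuous_pt; exists (/ (1 + t ^ 2)); apply derivable_pt_lim_atan.
- rewrite atan_0, !Rminus_0_r in E; rewrite E.
  assert (P := pow2_ge_0 c).
  assert (/ (1 + c ^ 2) <= / 1) by (apply Rinv_le_contravar; lra); rewrite Rinv_1 in *; nra.
Qed.

Lemma atan_sum_near M K : 0 < M -> (1 <= K)%nat ->
  Rabs (Rsum_list (fun c => M / (INR c ^ 2 + M ^ 2)) (seq 1 K) - PI / 2) <= / M + M / INR K.
Proof.
intros HM HK; assert (HK' : 0 < INR K) by (apply lt_0_INR; lia).
assert (B := atan_sum_bounds M K HM); assert (B1 := atan_bound (INR K / M)).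
assert (HM' : 0 < / M) by now apply Rinv_0_lt_compat.
assert (B2 := atan_le_id (/ M) ltac:(lra)).
assert (HMK : 0 < M / INR K) by now apply Rdiv_lt_0_compat.
assert (B3 := atan_le_id (M / INR K) ltac:(lra)).
assert (B4 : atan (INR K / M) <= atan (INR (S K) / M)).
{ apply Rlt_le, atan_increasing; apply Rmult_lt_compat_r; trivial; rewrite S_INR; lra. }
assert (B5 : atan (M / INR K) = PI / 2 - atan (INR K / M)).
{ replace (M / INR K) with (/ (INR K / M)) by (field; lra).
  apply atan_inv; now apply Rdiv_lt_0_compat. }
apply Rabs_le; lra.
Qed.

(** At tau = i the partial sums over d are arctangent Riemann sums. *)
Lemma E2_defect_i : E2_defect Ci = (- (6 * Ci / PI))%C.
Proof.
assert (Hi : 0 < Im Ci) by (simpl; lra).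
assert (HP := PI_RGT_0).
assert (P0 : RtoC PI <> 0) by (apply RtoC_neq_0; lra).
assert (N3 : RtoC 3 <> 0) by (apply RtoC_neq_0; lra).
assert (H1 := is_Csum_Z_limit _ _ (is_Csum_tele_defect Ci Hi)).
set (s := (PI ^ 2 / 3 * (E2_defect Ci / Ci))%C) in *.
assert (Bound : forall N, Cmod (Csum_list (tele_col Ci) (Zrange N) + 2 * PI) <= 8 * / (INR N + / 2)).
{ intros N; set (M := INR N + / 2).
  assert (HM : 0 < M) by (unfold M; assert (Q := pos_INR N); lra).
  set (g := fun c : Z => RtoC (-2 * (M / (IZR c ^ 2 + M ^ 2)))).
  assert (Sg : is_Csum (fun c => c <> 0%Z) g (Csum_list (tele_col Ci) (Zrange N))).
  { eapply is_Csum_ext; [|apply (is_Csum_tele_partial Ci N Hi)]; intros c Hc; cbv beta; fold M.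
    unfold g; apply injective_projections; simpl; field; nra. }
  assert (Sp : summable pos1 (fun n => Cmod (g (Z.of_nat n)))).
  { apply summable_le with (fun n => (4 * M) * / (1 + INR n ^ 2)).
    - intros n Hn; unfold g; rewrite Cmod_R, <- INR_IZR_INZ.
      assert (Hn1 : 1 <= INR n) by (apply (le_INR 1); exact Hn).
      rewrite Rabs_mult, (Rabs_left1 (-2)), Rabs_pos_eq by (try lra; apply Rlt_le, Rdiv_lt_0_compat; nra).
      replace (- -2 * (M / (INR n ^ 2 + M ^ 2))) with (2 * M * / (INR n ^ 2 + M ^ 2)) by (unfold Rdiv; ring).
      replace (4 * M * / (1 + INR n ^ 2)) with (2 * M * / ((1 + INR n ^ 2) / 2)) by (field; nra).
      apply Rmult_le_compat_l; [lra|]; apply Rinv_le_contravar; nra.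
    - apply summable_scal; [lra|]; apply (summable_sub _ (fun _ => True)); [easy|apply summable_nat_inv_sq]. }
  assert (St := summable_is_Csum _ _ Sp); set (t := Csum pos1 _) in *.
  assert (Ev : forall c, g (- c)%Z = g c).
  { intros c; unfold g; rewrite opp_IZR; do 3 f_equal; f_equal; ring. }
  rewrite (is_Csum_unique _ _ _ _ Sg (is_Csum_Z_even g t Ev St)).
  assert (T : Cmod (t + PI) <= 4 * / M).
  { apply le_epsilon; intros e He.
    destruct (proj1 (is_Csum_eps _ _ _) St (e / 2)) as (L0 & HA0 & HL); [lra|].
    destruct (nfloor_ex (4 * M / e)) as (K1 & HK1); [apply Rlt_le, Rdiv_lt_0_compat; lra|].
    set (K := S (list_max L0 + K1)).
    assert (HK : 4 * M / e < INR K).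
    { unfold K; rewrite S_INR, plus_INR; assert (Q := pos_INR (list_max L0)); lra. }
    assert (HKp : 0 < INR K) by (assert (0 < 4 * M / e) by (apply Rdiv_lt_0_compat; lra); lra).
    assert (HL1 : Cmod (Csum_list (fun n => g (Z.of_nat n)) (seq 1 K) - t) < e / 2).
    { apply HL; [apply seq_NoDup| |].
      - apply Forall_forall; intros n Hn; apply in_seq in Hn; unfold pos1; lia.
      - intros n Hn; apply in_seq; rewrite Forall_forall in HA0; specialize (HA0 n Hn).
        assert (Hm := proj1 (list_max_le L0 (list_max L0)) (Nat.le_refl _)).
        rewrite Forall_forall in Hm; specialize (Hm n Hn); unfold pos1, K in *; lia. }
    set (R0 := Rsum_list (fun c => M / (INR c ^ 2 + M ^ 2)) (seq 1 K)).
    assert (ER : Csum_list (fun n => g (Z.of_nat n)) (seq 1 K) = (R0 * RtoC (-2))%C).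
    { apply Csum_list_factor; intros n _; unfold g; rewrite <- INR_IZR_INZ, RtoC_mult; ring. }
    assert (HR : Cmod (R0 * RtoC (-2) + PI) <= 2 * (/ M + M / INR K)).
    { replace (R0 * RtoC (-2) + PI)%C with (RtoC (-2 * (R0 - PI / 2))).
      - rewrite Cmod_R, Rabs_mult, (Rabs_left1 (-2)) by lra.
        assert (B := atan_sum_near M K HM ltac:(unfold K; lia)); fold R0 in B; lra.
      - rewrite <- RtoC_mult, <- RtoC_plus; f_equal; field. }
    assert (HMK : M / INR K < e / 4).
    { apply (Rmult_lt_reg_r (INR K)); trivial.
      replace (M / INR K * INR K) with (4 * M / e * (e / 4)) by (field; lra).
      rewrite (Rmult_comm (e / 4)); apply Rmult_lt_compat_r; lra. }
    rewrite ER in HL1.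
    replace (t + PI)%C with (- (R0 * RtoC (-2) - t) + (R0 * RtoC (-2) + PI))%C by ring.
    eapply Rle_trans; [apply Cmod_triangle|]; rewrite Cmod_opp.
    assert (0 < / M) by (now apply Rinv_0_lt_compat); lra. }
  replace (2 * t + 2 * PI)%C with (2 * (t + PI))%C by ring.
  rewrite Cmod_mult, Cmod_R, Rabs_pos_eq by lra; lra. }
assert (Es : s = (- (2 * PI))%C).
{ apply (Clim_seq_unique _ _ _ H1), (Clim_seq_bound _ _ 8 0); [lra|]; intros N _.
  replace (_ - _)%C with (Csum_list (tele_col Ci) (Zrange N) + 2 * PI)%C by ring; apply Bound. }
replace (E2_defect Ci) with (Ci * (3 / PI ^ 2 * s))%C
  by (unfold s; field; repeat split; trivial; apply Ci_nz).
rewrite Es; field; trivial.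
Qed.

(** E2_defect is constant because its derivative vanishes. *)
Theorem E2_inv tau : 0 < Im tau ->
  E2 (- / tau) = (tau ^ 2 * E2 tau + 6 / (PI * Ci) * tau)%C.
Proof.
intros Ht; assert (Ht0 := Cneq_0_Im tau Ht).
assert (P0 : RtoC PI <> 0) by (apply RtoC_neq_0; assert (P := PI_RGT_0); lra).
assert (E : E2_defect tau = E2_defect Ci).
{ apply Ceq_minus, Cmod_eq_0, Rle_antisym; [|apply Cmod_ge_0].
  replace 0 with (2 * 0 * Cmod (tau - Ci)) by ring.
  replace tau with (Ci + (tau - Ci))%C at 1 by ring.
  apply (cderiv_bound E2_defect (fun _ => RtoC 0)); intros t Ht'; split; [|rewrite Cmod_0; lra].
  apply cderiv_E2_defect_0.
  rewrite im_plus, im_scal_l; unfold Cminus; rewrite im_plus, im_opp.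
  replace (Im Ci) with 1 by easy; nra. }
rewrite E2_defect_i in E; unfold E2_defect in E.
replace (E2 (- / tau)) with (tau * (/ tau * E2 (- / tau) - tau * E2 tau) + tau ^ 2 * E2 tau)%C
  by (field; trivial).
rewrite E.
replace (6 / (PI * Ci))%C with (6 * (/ Ci) / PI)%C by (field; split; trivial; apply Ci_nz).
rewrite Ci_inv; field; trivial.
Qed.

Lemma E2_shift tau n : E2 (tau + IZR n) = E2 tau.
Proof. unfold E2; now rewrite qexp_shift. Qed.

Definition mobius (M : mat2) (tau : C) : C :=
  ((IZR (m_a M) * tau + IZR (m_b M)) / (IZR (m_c M) * tau + IZR (m_d M)))%C.

Definition autj (M : mat2) (tau : C) : C := (IZR (m_c M) * tau + IZR (m_d M))%C.

Lemma SL2Z_row M : SL2Z M -> IZR (m_c M) <> 0 \/ IZR (m_d M) <> 0.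
Proof.
unfold SL2Z; intros H; destruct (Z.eq_dec (m_c M) 0) as [E|E]; [right|left];
apply IZR_neq_0; trivial; intros E'; rewrite E, E' in H; lia.
Qed.

Lemma autj_neq_0 M tau : SL2Z M -> 0 < Im tau -> autj M tau <> 0.
Proof. intros HM Ht; apply lattice_neq_0; trivial; now apply SL2Z_row. Qed.

Lemma Im_div (z w : C) : w <> 0 -> Im (z / w) = Im (z * Cconj w) / Cmod w ^ 2.
Proof.
intros H; assert (Hw : Cmod w <> 0) by (apply Rgt_not_eq, Cmod_gt_0; trivial).
assert (E : (z / w)%C = ((/ Cmod w ^ 2)%R * (z * Cconj w))%C).
{ assert (N : (w * Cconj w)%C <> 0).
  { rewrite <- Cmod2_conj; apply RtoC_neq_0, pow_nonzero; trivial. }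
  assert (N' : Cconj w <> 0) by (intros E; apply N; rewrite E; ring).
  rewrite RtoC_inv, Cmod2_conj by (now apply pow_nonzero).
  field; split; trivial. }
rewrite E, im_scal_l; field; trivial.
Qed.

Lemma Im_mobius M tau : SL2Z M -> 0 < Im tau -> Im (mobius M tau) = Im tau / Cmod (autj M tau) ^ 2.
Proof.
intros HM Ht; unfold mobius; fold (autj M tau); rewrite Im_div by now apply autj_neq_0.
f_equal; unfold autj; destruct tau as [x y]; simpl.
unfold SL2Z in HM; apply (f_equal IZR) in HM; rewrite minus_IZR, !mult_IZR in HM.
transitivity ((IZR (m_a M) * IZR (m_d M) - IZR (m_b M) * IZR (m_c M)) * y); [ring|rewrite HM; ring].
Qed.

Lemma Im_mobius_pos M tau : SL2Z M -> 0 < Im tau -> 0 < Im (mobius M tau).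
Proof.
intros HM Ht; rewrite Im_mobius by trivial; apply Rdiv_lt_0_compat; trivial.
apply pow_lt, Cmod_gt_0; now apply autj_neq_0.
Qed.

(** By Euclid's algorithm on the bottom row, using only translations and S. *)
Theorem E2_mobius M tau : SL2Z M -> 0 < Im tau ->
  E2 (mobius M tau) = (autj M tau ^ 2 * E2 tau + 6 / (PI * Ci) * IZR (m_c M) * autj M tau)%C.
Proof.
remember (Z.abs_nat (m_c M)) as k eqn:Hk; revert M tau Hk.
induction k as [k IH] using lt_wf_ind; intros [a b c d] tau Hk HM Ht; simpl in Hk.
unfold SL2Z in HM; simpl in HM; unfold mobius, autj; simpl.
destruct (Z.eq_dec c 0) as [->|Hc].
- assert (Had : (a = 1 /\ d = 1 \/ a = -1 /\ d = -1)%Z).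
  { assert (a * d = 1)%Z by lia; destruct (Z.eq_mul_1 a d H) as [->| ->]; lia. }
  destruct Had as [[-> ->]|[-> ->]].
  + replace ((1 * tau + IZR b) / (0 * tau + 1))%C with (tau + IZR b)%C by (field; apply C1_nz).
    rewrite E2_shift; ring.
  + replace ((RtoC (-1) * tau + IZR b) / (0 * tau + RtoC (-1)))%C with (tau + IZR (- b))%C.
    * rewrite E2_shift; ring.
    * rewrite opp_IZR, RtoC_opp; field; apply RtoC_neq_0; lra.
- set (n := (- (d / c))%Z).
  assert (Hn : (Z.abs (c * n + d) < Z.abs c)%Z).
  { assert (E := Z.div_mod d c Hc); replace (c * n + d)%Z with (d mod c)%Z by (unfold n; lia).
    assert (B1 := Z.mod_pos_bound d c); assert (B2 := Z.mod_neg_bound d c); lia. }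
  set (M' := Mat2 (a * n + b) (- a) (c * n + d) (- c)).
  set (w := (tau + IZR (- n))%C).
  assert (Hw : 0 < Im w) by (unfold w; rewrite im_plus, im_RtoC, Rplus_0_r; trivial).
  assert (Hw0 := Cneq_0_Im w Hw); assert (Hs := Im_opp_inv w Hw).
  assert (HM' : SL2Z M') by (unfold SL2Z; simpl; nia).
  assert (Q := IH (Z.abs_nat (c * n + d)) ltac:(lia) M' (- / w)%C eq_refl HM' Hs).
  assert (J := autj_neq_0 (Mat2 a b c d) tau HM Ht); unfold autj in J; simpl in J.
  assert (Etau : tau = (w + IZR n)%C) by (unfold w; rewrite opp_IZR, RtoC_opp; ring).
  assert (Ej : autj M' (- / w) = (- (IZR c * tau + IZR d) / w)%C).
  { unfold autj, M'; simpl; rewrite Etau, plus_IZR, mult_IZR, opp_IZR, !RtoC_plus, RtoC_mult, RtoC_opp.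
    field; trivial. }
  assert (Em : mobius M' (- / w) = ((IZR a * tau + IZR b) / (IZR c * tau + IZR d))%C).
  { unfold mobius; fold (autj M' (- / w)); rewrite Ej; unfold M'; simpl m_a; simpl m_b.
    rewrite plus_IZR, mult_IZR, opp_IZR, !RtoC_plus, RtoC_mult, RtoC_opp.
    rewrite Etau in *; field; repeat split; trivial. }
  rewrite <- Em, Q, Ej, E2_inv by trivial.
  replace (E2 w) with (E2 tau) by (unfold w; now rewrite E2_shift).
  unfold M'; simpl m_c; rewrite plus_IZR, mult_IZR, RtoC_plus, RtoC_mult.
  set (e := E2 tau); set (kk := (6 / (PI * Ci))%C); clearbody e kk.
  rewrite Etau; clear -Hw0; clearbody w; field; trivial.
Qed.

(** * Cosets of Gamma_inf *)

Lemma mat2_eq M M' : m_a M = m_a M' -> m_b M = m_b M' -> m_c M = m_c M' -> m_d M = m_d M' -> M = M'.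
Proof. destruct M, M'; simpl; congruence. Qed.

Lemma mat2_mul_assoc A B D : mat2_mul A (mat2_mul B D) = mat2_mul (mat2_mul A B) D.
Proof. apply mat2_eq; simpl; ring. Qed.

Lemma mat2_inv_mul A B : SL2Z A -> mat2_mul (mat2_inv A) (mat2_mul A B) = B.
Proof.
unfold SL2Z; intros H; apply mat2_eq; simpl;
match goal with |- _ = ?x => transitivity ((m_a A * m_d A - m_b A * m_c A) * x)%Z end;
try ring; rewrite H; ring.
Qed.

Lemma SL2Z_mul A B : SL2Z A -> SL2Z B -> SL2Z (mat2_mul A B).
Proof.
unfold SL2Z; simpl; intros HA HB.
transitivity ((m_a A * m_d A - m_b A * m_c A) * (m_a B * m_d B - m_b B * m_c B))%Z;
[ring|rewrite HA, HB; ring].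
Qed.

Lemma Gamma_inf_SL2Z h : Gamma_inf h -> SL2Z h.
Proof.
induction 1 as [| | |h h' _ IH _ IH'|h _ IH]; try reflexivity.
- now apply SL2Z_mul.
- unfold SL2Z in *; simpl; lia.
Qed.

Lemma Gamma_inf_T_pow n : Gamma_inf (Mat2 1 n 0 1).
Proof.
induction n as [|n IH|n IH] using Z.peano_ind; [constructor| |].
- replace (Mat2 1 (Z.succ n) 0 1) with (mat2_mul (Mat2 1 1 0 1) (Mat2 1 n 0 1))
    by (unfold mat2_mul, mat2_inv; cbn [m_a m_b m_c m_d]; f_equal; lia).
  constructor; [constructor|trivial].
- replace (Mat2 1 (Z.pred n) 0 1) with (mat2_mul (mat2_inv (Mat2 1 1 0 1)) (Mat2 1 n 0 1))
    by (unfold mat2_mul, mat2_inv; cbn [m_a m_b m_c m_d]; f_equal; lia).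
  constructor; [apply Gamma_inf_inv; constructor|trivial].
Qed.

Lemma coset_mul h M : Gamma_inf h -> Gamma_inf_coset (mat2_mul h M) = Gamma_inf_coset M.
Proof.
intros Hh; extensionality M'; apply propositional_extensionality; split.
- intros (h' & H & ->); exists (mat2_mul h' h); split; [now constructor|apply mat2_mul_assoc].
- intros (h' & H & ->); exists (mat2_mul h' (mat2_inv h)); split.
  + constructor; trivial; now constructor.
  + rewrite <- mat2_mul_assoc, mat2_inv_mul; trivial; now apply Gamma_inf_SL2Z.
Qed.

Lemma coset_repr_spec X : is_coset X -> SL2Z (coset_repr X) /\ X = Gamma_inf_coset (coset_repr X).
Proof.
intros (M & HM & ->).
assert (H : Gamma_inf_coset M (coset_repr (Gamma_inf_coset M))).
{ unfold coset_repr; apply epsilon_spec; exists M, mat2_one; split; [constructor|].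
  apply mat2_eq; unfold mat2_mul, mat2_one; cbn [m_a m_b m_c m_d]; ring. }
destruct H as (h & Hh & E); rewrite E; split.
- apply SL2Z_mul; trivial; now apply Gamma_inf_SL2Z.
- symmetry; now apply coset_mul.
Qed.

(** Two elements of SL_2(Z) with the same bottom row differ by a translation, which
   is in Gamma_inf. *)
Lemma coset_repr_inj X Y : is_coset X -> is_coset Y ->
  m_c (coset_repr X) = m_c (coset_repr Y) -> m_d (coset_repr X) = m_d (coset_repr Y) -> X = Y.
Proof.
intros HX HY Ec Ed; destruct (coset_repr_spec X HX) as (SX & EX), (coset_repr_spec Y HY) as (SY & EY).
transitivity (Gamma_inf_coset (coset_repr X)); [exact EX|].
transitivity (Gamma_inf_coset (coset_repr Y)); [|symmetry; exact EY].
clear EX EY; revert SX SY Ec Ed; generalize (coset_repr X) (coset_repr Y); clear.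
intros [a b c d] [a' b' c' d']; unfold SL2Z; simpl; intros H H' <- <-.
replace (Mat2 a' b' c d) with (mat2_mul (Mat2 1 (a * b' - a' * b) 0 1) (Mat2 a b c d)).
- symmetry; apply coset_mul, Gamma_inf_T_pow.
- unfold mat2_mul; cbn [m_a m_b m_c m_d]; f_equal; try ring.
  + transitivity (a + (a * (b' * c) - a' * (b * c)))%Z; [ring|].
    replace (b' * c)%Z with (a' * d - 1)%Z by lia; replace (b * c)%Z with (a * d - 1)%Z by lia; ring.
  + transitivity (b + (a * d * b' - b * (a' * d)))%Z; [ring|].
    replace (a * d)%Z with (1 + b * c)%Z by lia; replace (a' * d)%Z with (1 + b' * c)%Z by lia; ring.
Qed.

Definition row_bound (M : mat2) : R := / (1 + IZR (m_c M) ^ 2) * / (1 + IZR (m_d M) ^ 2).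

Lemma row_bound_pos M : 0 < row_bound M.
Proof.
unfold row_bound; apply Rmult_lt_0_compat; apply Rinv_0_lt_compat;
[assert (P := pow2_ge_0 (IZR (m_c M)))|assert (P := pow2_ge_0 (IZR (m_d M)))]; lra.
Qed.

Lemma summable_row_bound : summable is_coset (fun X => row_bound (coset_repr X)).
Proof.
apply (summable_inj (fun X => (m_c (coset_repr X), m_d (coset_repr X))) is_coset
  (fun cd => True /\ True) (fun cd => / (1 + IZR (fst cd) ^ 2) * / (1 + IZR (snd cd) ^ 2))).
- auto.
- intros X Y HX HY E; injection E as E1 E2; now apply coset_repr_inj.
- apply (summable_prod (fun _ => True) (fun _ => True) (fun c => / (1 + IZR c ^ 2)) (fun c => / (1 + IZR c ^ 2)));
  try exact summable_Z_inv_sq;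
  intros c _; apply Rlt_le, Rinv_0_lt_compat; assert (P := pow2_ge_0 (IZR c)); lra.
Qed.

(** * Termwise differentiation of Poincare series *)

(** For a = 0 and b = k these are the terms of the Poincare series of q^N of weight
   k. The family is closed under differentiation, and b - a, which governs
   convergence, never decreases. *)
Definition pterm (N a b : nat) (M : mat2) (tau : C) : C :=
  (IZR (m_c M) ^ a * (/ autj M tau) ^ b * qexp (mobius M tau) ^ N)%C.

Lemma cderiv_autj M tau : cderiv (autj M) tau (IZR (m_c M)).
Proof.
assert (D := cderiv_plus _ _ _ _ _ (cderiv_scal (IZR (m_c M)) _ _ _ (cderiv_id tau))
  (cderiv_const (IZR (m_d M)) tau)).
now rewrite Cmult_1_r, Cplus_0_r in D.
Qed.

Lemma cderiv_inv_autj M tau : SL2Z M -> 0 < Im tau ->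
  cderiv (fun w => / autj M w)%C tau (- IZR (m_c M) * (/ autj M tau) ^ 2)%C.
Proof.
intros HM Ht; assert (J := autj_neq_0 M tau HM Ht).
replace (- IZR (m_c M) * (/ autj M tau) ^ 2)%C with (- IZR (m_c M) / autj M tau ^ 2)%C
  by (field; trivial).
apply cderiv_inv; trivial; apply cderiv_autj.
Qed.

Lemma cderiv_mobius M tau : SL2Z M -> 0 < Im tau ->
  cderiv (mobius M) tau ((/ autj M tau) ^ 2)%C.
Proof.
intros HM Ht; assert (J := autj_neq_0 M tau HM Ht).
assert (D := cderiv_mult _ _ _ _ _ (cderiv_plus _ _ _ _ _
  (cderiv_scal (IZR (m_a M)) _ _ _ (cderiv_id tau)) (cderiv_const (IZR (m_b M)) tau))
  (cderiv_inv_autj M tau HM Ht)).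
cbv beta in D; unfold mobius.
match type of D with cderiv _ _ ?x => replace ((/ autj M tau) ^ 2)%C with x; [exact D|] end.
assert (E : (IZR (m_a M) * IZR (m_d M) - IZR (m_b M) * IZR (m_c M))%C = 1).
{ unfold SL2Z in HM; rewrite <- !RtoC_mult, <- RtoC_minus, <- !mult_IZR, <- minus_IZR, HM; easy. }
transitivity ((IZR (m_a M) * IZR (m_d M) - IZR (m_b M) * IZR (m_c M)) * (/ autj M tau) ^ 2)%C;
  [|rewrite E; ring].
unfold autj in *; field; trivial.
Qed.

Lemma cderiv_pterm N a b M tau : SL2Z M -> 0 < Im tau ->
  cderiv (pterm N a b M) tau
    (- INR b * pterm N (S a) (S b) M tau + 2 * PI * Ci * INR N * pterm N a (S (S b)) M tau)%C.
Proof.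
intros HM Ht; assert (J := autj_neq_0 M tau HM Ht).
assert (D1 := cderiv_scal (IZR (m_c M) ^ a) _ _ _ (cderiv_pow _ _ _ b (cderiv_inv_autj M tau HM Ht))).
assert (D2 := cderiv_pow _ _ _ N (cderiv_comp qexp _ _ _ _ (cderiv_qexp (mobius M tau)) (cderiv_mobius M tau HM Ht))).
assert (D := cderiv_mult _ _ _ _ _ D1 D2); cbv beta in D.
unfold pterm at 1.
match type of D with cderiv _ _ ?x => match goal with |- cderiv _ _ ?y => replace y with x; [exact D|] end end.
unfold pterm; set (j := (/ autj M tau)%C); set (q := qexp (mobius M tau)).
assert (Ej : (INR b * j ^ (b - 1) * (- IZR (m_c M) * j ^ 2))%C = (- INR b * IZR (m_c M) * j ^ S b)%C).
{ destruct b as [|b]; [simpl; ring|]; replace (S b - 1)%nat with b by lia; simpl; ring. }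
assert (Eq : (INR N * q ^ (N - 1) * (j ^ 2 * (2 * PI * Ci * q)))%C = (INR N * (2 * PI * Ci) * q ^ N * j ^ 2)%C).
{ destruct N as [|n]; [simpl; ring|]; replace (S n - 1)%nat with n by lia; simpl; ring. }
rewrite Ej, Eq; simpl; ring.
Qed.

Lemma SL2Z_row_sqr M : SL2Z M -> 1 <= IZR (m_c M) ^ 2 + IZR (m_d M) ^ 2.
Proof.
intros H; assert (P1 := pow2_ge_0 (IZR (m_c M))); assert (P2 := pow2_ge_0 (IZR (m_d M))).
destruct (Z.eq_dec (m_c M) 0) as [E|E].
- destruct (Z.eq_dec (m_d M) 0) as [E'|E']; [|apply IZR_sqr_ge_1 in E'; lra].
  unfold SL2Z in H; rewrite E, E' in H; lia.
- apply IZR_sqr_ge_1 in E; lra.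
Qed.

(** |c / (c w + d)| <= 1 / Im w absorbs the powers of c, |q| <= 1 on the half-plane,
   and four of the remaining factors 1 / (c w + d) give the row bound. *)
Lemma pterm_bound N a b x0 y0 : (a + 4 <= b)%nat -> 0 < y0 -> exists K, 0 <= K /\
  forall M w, SL2Z M -> Rabs (Re w) <= x0 -> y0 <= Im w ->
  Cmod (pterm N a b M w) <= K * row_bound M.
Proof.
intros Hab Hy; destruct (lattice_lower x0 y0 Hy) as (B & HB & HL).
set (e := (b - a - 4)%nat).
exists ((/ y0) ^ a * (B + 1) ^ e * (4 * B ^ 2)).
assert (Hy' : 0 < / y0) by now apply Rinv_0_lt_compat.
split; [repeat apply Rmult_le_pos; try apply pow_le; try lra; apply pow2_ge_0|].
intros M w HM Hre Him.
assert (Hw : 0 < Im w) by lra.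
assert (J := autj_neq_0 M w HM Hw); apply Cmod_gt_0 in J.
assert (L : IZR (m_c M) ^ 2 + IZR (m_d M) ^ 2 <= B * Cmod (autj M w) ^ 2) by now apply HL.
assert (R1 := SL2Z_row_sqr M HM).
assert (Hcj : Rabs (IZR (m_c M)) * / Cmod (autj M w) <= / y0).
{ apply (Rmult_le_reg_r (Cmod (autj M w))); trivial.
  rewrite Rmult_assoc, Rinv_l, Rmult_1_r by lra.
  apply (Rmult_le_reg_l y0); trivial; rewrite <- Rmult_assoc, Rinv_r, Rmult_1_l by lra.
  eapply Rle_trans; [|apply im_le_Cmod].
  unfold autj; rewrite im_plus, im_scal_l, im_RtoC, Rplus_0_r, Rabs_mult, (Rabs_pos_eq (Im w)) by lra.
  assert (P := Rabs_pos (IZR (m_c M))); nra. }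
assert (Hq : Cmod (qexp (mobius M w) ^ N) <= 1).
{ rewrite Cmod_pow, <- (pow1 N); apply pow_incr; split; [apply Cmod_ge_0|].
  apply Rlt_le, Cmod_qexp_lt_1; now apply Im_mobius_pos. }
unfold pterm; rewrite !Cmod_mult, Cmod_pow, Cmod_R, (Cmod_pow (/ autj M w)), Cmod_inv
  by (now apply Cmod_gt_0).
set (j := Cmod (autj M w)) in *; set (c := IZR (m_c M)) in *; set (d := IZR (m_d M)) in *.
assert (Hj2 : (/ j) ^ 2 <= B).
{ rewrite pow_inv; apply (Rmult_le_reg_r (j ^ 2)); [now apply pow_lt|].
  rewrite Rinv_l by (apply pow_nonzero; lra); lra. }
assert (Pj : 0 < / j) by now apply Rinv_0_lt_compat.
assert (Hj1 : / j <= B + 1) by (simpl in Hj2; nra).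
assert (Hj4 : (/ j) ^ 4 <= 4 * B ^ 2 * row_bound M).
{ unfold row_bound; fold c d; rewrite pow_inv, <- Rinv_mult.
  assert (C0 := pow2_ge_0 c); assert (D0 := pow2_ge_0 d).
  apply (Rmult_le_reg_r (j ^ 4)); [now apply pow_lt|].
  rewrite Rinv_l by (apply pow_nonzero; lra).
  apply (Rmult_le_reg_r ((1 + c ^ 2) * (1 + d ^ 2))); [nra|].
  replace (4 * B ^ 2 * / ((1 + c ^ 2) * (1 + d ^ 2)) * j ^ 4 * ((1 + c ^ 2) * (1 + d ^ 2)))
    with ((2 * (B * j ^ 2)) * (2 * (B * j ^ 2))) by (field; lra).
  rewrite Rmult_1_l; apply Rmult_le_compat; lra. }
replace b with (a + (e + 4))%nat at 1 by (unfold e; lia).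
rewrite !pow_add, (Rmult_comm _ ((/ j) ^ a * _)).
replace ((/ j) ^ a * ((/ j) ^ e * (/ j) ^ 4) * Rabs c ^ a)
  with ((Rabs c * / j) ^ a * (/ j) ^ e * (/ j) ^ 4) by (rewrite Rpow_mult_distr; ring).
assert (A1 : (Rabs c * / j) ^ a <= (/ y0) ^ a).
{ apply pow_incr; split; trivial; apply Rmult_le_pos; [apply Rabs_pos|lra]. }
assert (A2 : (/ j) ^ e <= (B + 1) ^ e) by (apply pow_incr; lra).
assert (N1 : 0 <= (Rabs c * / j) ^ a) by (apply pow_le, Rmult_le_pos; [apply Rabs_pos|lra]).
assert (N2 : 0 <= (/ j) ^ e) by (apply pow_le; lra).
assert (N4 : 0 <= (/ j) ^ 4) by (apply pow_le; lra).
replace ((/ y0) ^ a * (B + 1) ^ e * (4 * B ^ 2) * row_bound M)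
  with ((/ y0) ^ a * (B + 1) ^ e * (4 * B ^ 2 * row_bound M) * 1) by ring.
apply Rmult_le_compat; trivial; [|apply Cmod_ge_0|].
- apply Rmult_le_pos; trivial; now apply Rmult_le_pos.
- apply Rmult_le_compat; trivial; [now apply Rmult_le_pos|now apply Rmult_le_compat].
Qed.

Definition coset_sum (f : mat2 -> C -> C) (tau : C) : C :=
  Csum is_coset (fun X => f (coset_repr X) tau).

Definition termwise_deriv (f f' : mat2 -> C -> C) : Prop := forall tau, 0 < Im tau ->
  (forall M, SL2Z M -> cderiv (f M) tau (f' M tau)) /\
  is_Csum is_coset (fun X => f (coset_repr X) tau) (coset_sum f tau) /\
  is_Csum is_coset (fun X => f' (coset_repr X) tau) (coset_sum f' tau) /\
  cderiv (coset_sum f) tau (coset_sum f' tau).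

Definition holomorphic (u : C -> C) : Prop :=
  forall tau, 0 < Im tau -> exists l, cderiv u tau l.

Lemma Re_near tau w r : Cmod (w - tau) < r -> Rabs (Re w) <= Rabs (Re tau) + r.
Proof.
intros H; assert (T := re_le_Cmod (w - tau)).
unfold Cminus in T; rewrite re_plus, re_opp in T.
replace (Re w) with ((Re w + - Re tau) + Re tau) by ring.
eapply Rle_trans; [apply Rabs_triang|]; unfold Cminus in H; lra.
Qed.

(** The first two derivatives are again combinations of [pterm]s, with the same
   kind of bound near tau. *)
Lemma termwise_pterm N a b : (a + 4 <= b)%nat ->
  termwise_deriv (pterm N a b) (fun M tau =>
    - INR b * pterm N (S a) (S b) M tau + 2 * PI * Ci * INR N * pterm N a (S (S b)) M tau)%C.
Proof.
intros Hab tau Ht.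
set (f' := fun a b M w => (- INR b * pterm N (S a) (S b) M w + 2 * PI * Ci * INR N * pterm N a (S (S b)) M w)%C).
set (f'' := fun M w => (- INR b * f' (S a) (S b) M w + 2 * PI * Ci * INR N * f' a (S (S b)) M w)%C).
set (r := Im tau / 2).
assert (Bd : forall g : mat2 -> C -> C, (exists K, 0 <= K /\ forall M w, SL2Z M -> Rabs (Re w) <= Rabs (Re tau) + r -> r <= Im w ->
  Cmod (g M w) <= K * row_bound M) -> exists K, 0 <= K /\ forall M w, SL2Z M -> Cmod (w - tau) < r -> Cmod (g M w) <= K * row_bound M).
{ intros g (K & HK & H); exists K; split; trivial; intros M w HM Hw; apply H; trivial.
  - now apply Re_near.
  - apply Im_near in Hw; unfold r in *; lra. }
assert (Hr : 0 < r) by (unfold r; lra).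
assert (B0 : forall a b, (a + 4 <= b)%nat -> exists K, 0 <= K /\ forall M w, SL2Z M -> Cmod (w - tau) < r ->
  Cmod (pterm N a b M w) <= K * row_bound M) by (intros; apply Bd; now apply pterm_bound).
assert (Lin : forall (c1 c2 : C) g1 g2,
  (exists K, 0 <= K /\ forall M w, SL2Z M -> Cmod (w - tau) < r -> Cmod (g1 M w) <= K * row_bound M) ->
  (exists K, 0 <= K /\ forall M w, SL2Z M -> Cmod (w - tau) < r -> Cmod (g2 M w) <= K * row_bound M) ->
  exists K, 0 <= K /\ forall M w, SL2Z M -> Cmod (w - tau) < r -> Cmod (c1 * g1 M w + c2 * g2 M w) <= K * row_bound M).
{ intros c1 c2 g1 g2 (K1 & P1 & H1) (K2 & P2 & H2); exists (Cmod c1 * K1 + Cmod c2 * K2).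
  assert (Q1 := Cmod_ge_0 c1); assert (Q2 := Cmod_ge_0 c2); split; [nra|].
  intros M w HM Hw; eapply Rle_trans; [apply Cmod_triangle|]; rewrite !Cmod_mult.
  specialize (H1 M w HM Hw); specialize (H2 M w HM Hw); nra. }
assert (B1 : forall a b, (a + 4 <= b)%nat -> exists K, 0 <= K /\ forall M w, SL2Z M -> Cmod (w - tau) < r ->
  Cmod (f' a b M w) <= K * row_bound M).
{ intros; unfold f'; apply Lin; apply B0; lia. }
destruct (B0 a b Hab) as (K0 & P0 & H0).
destruct (B1 a b Hab) as (K1 & P1 & H1).
assert (B2 : exists K, 0 <= K /\ forall M w, SL2Z M -> Cmod (w - tau) < r -> Cmod (f'' M w) <= K * row_bound M).
{ unfold f''; apply Lin; apply B1; lia. }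
destruct B2 as (K2 & P2 & H2).
set (K := K0 + K1 + K2).
assert (Le : forall k M, k <= K -> k * row_bound M <= K * row_bound M).
{ intros k M Hk; apply Rmult_le_compat_r; trivial; apply Rlt_le, row_bound_pos. }
assert (HS : summable is_coset (fun X => K * row_bound (coset_repr X))).
{ apply summable_scal; [unfold K; lra|apply summable_row_bound]. }
assert (Ht0 : Cmod (tau - tau) < r).
{ replace (tau - tau)%C with (RtoC 0) by ring; now rewrite Cmod_0. }
split; [intros M HM; now apply cderiv_pterm|split; [|split]].
- apply summable_is_Csum; eapply summable_le; [|exact HS]; intros X HX; cbv beta.
  eapply Rle_trans; [apply H0; trivial; now apply coset_repr_spec|apply Le; unfold K; lra].
- apply summable_is_Csum; eapply summable_le; [|exact HS]; intros X HX; cbv beta.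
  eapply Rle_trans; [apply H1; trivial; now apply coset_repr_spec|apply Le; unfold K; lra].
- apply (Csum_cderiv is_coset (fun X w => pterm N a b (coset_repr X) w)
    (fun X w => f' a b (coset_repr X) w) (fun X w => f'' (coset_repr X) w)
    (fun X => K * row_bound (coset_repr X)) tau r); trivial.
  intros X w HX Hw; destruct (coset_repr_spec X HX) as (HM & _).
  assert (Hw' : 0 < Im w) by (apply Im_near in Hw; unfold r in *; lra).
  repeat split.
  + now apply cderiv_pterm.
  + unfold f''; apply cderiv_plus; apply cderiv_scal; now apply cderiv_pterm.
  + eapply Rle_trans; [now apply H0|apply Le; unfold K; lra].
  + eapply Rle_trans; [now apply H1|apply Le; unfold K; lra].
  + eapply Rle_trans; [now apply H2|apply Le; unfold K; lra].
Qed.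

Definition termwise (f : mat2 -> C -> C) : Prop := exists f', termwise_deriv f f'.

Lemma termwise_ext f g :
  (forall M tau, SL2Z M -> 0 < Im tau -> f M tau = g M tau) -> termwise f -> termwise g.
Proof.
intros E (f' & H); exists f'; intros tau Ht; destruct (H tau Ht) as (H1 & H2 & H3 & H4).
assert (EX : forall w X, is_coset X -> 0 < Im w -> f (coset_repr X) w = g (coset_repr X) w).
{ intros w X HX Hw; apply E; trivial; now apply coset_repr_spec. }
assert (EP : forall w, 0 < Im w -> coset_sum f w = coset_sum g w).
{ intros w Hw; apply Csum_ext; auto. }
assert (Near : forall w, Cmod (w - tau) < Im tau -> 0 < Im w).
{ intros w Hw; apply Im_near in Hw; lra. }
split; [|split; [|split; [exact H3|]]].
- intros M HM; apply (cderiv_ext_near (f M) _ _ _ (Im tau)); auto.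
- rewrite <- EP by trivial; eapply is_Csum_ext; [|exact H2]; intros X HX; now apply EX.
- apply (cderiv_ext_near (coset_sum f) _ _ _ (Im tau)); auto.
Qed.

Lemma termwise_plus f g : termwise f -> termwise g -> termwise (fun M tau => f M tau + g M tau)%C.
Proof.
intros (f' & Hf) (g' & Hg); exists (fun M tau => f' M tau + g' M tau)%C; intros tau Ht.
assert (E : forall w, 0 < Im w -> (coset_sum f w + coset_sum g w)%C = coset_sum (fun M tau => f M tau + g M tau)%C w).
{ intros w Hw; destruct (Hf w Hw) as (_ & F & _), (Hg w Hw) as (_ & G & _).
  symmetry; exact (Csum_eq _ _ _ (is_Csum_plus _ _ _ _ _ F G)). }
destruct (Hf tau Ht) as (F1 & F2 & F3 & F4), (Hg tau Ht) as (G1 & G2 & G3 & G4).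
assert (E' : (coset_sum f' tau + coset_sum g' tau)%C = coset_sum (fun M tau => f' M tau + g' M tau)%C tau).
{ symmetry; exact (Csum_eq _ _ _ (is_Csum_plus _ _ _ _ _ F3 G3)). }
rewrite <- E, <- E' by trivial; split; [|split; [|split]].
- intros M HM; apply cderiv_plus; auto.
- exact (is_Csum_plus _ _ _ _ _ F2 G2).
- exact (is_Csum_plus _ _ _ _ _ F3 G3).
- apply (cderiv_ext_near (fun w => coset_sum f w + coset_sum g w)%C _ _ _ (Im tau)); trivial.
  + intros w Hw; apply E; apply Im_near in Hw; lra.
  + now apply cderiv_plus.
Qed.

(** The multiplier does not depend on M, so it can be taken out of the sum over the
   cosets; the product rule then needs only its first derivative. *)
Lemma termwise_mul u f : holomorphic u -> termwise f -> termwise (fun M tau => u tau * f M tau)%C.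
Proof.
intros Hu (f' & Hf).
exists (fun M tau => C_derive u tau * f M tau + u tau * f' M tau)%C; intros tau Ht.
assert (E : forall w, 0 < Im w -> (u w * coset_sum f w)%C = coset_sum (fun M tau => u tau * f M tau)%C w).
{ intros w Hw; destruct (Hf w Hw) as (_ & F & _).
  symmetry; exact (Csum_eq _ _ _ (is_Csum_scal _ _ _ _ F)). }
destruct (Hf tau Ht) as (F1 & F2 & F3 & F4), (Hu tau Ht) as (u' & Hu').
rewrite (cderiv_C_derive _ _ _ Hu').
assert (S' := is_Csum_plus _ _ _ _ _ (is_Csum_scal _ u' _ _ F2) (is_Csum_scal _ (u tau) _ _ F3)).
assert (E' : (u' * coset_sum f tau + u tau * coset_sum f' tau)%C
  = coset_sum (fun M tau => C_derive u tau * f M tau + u tau * f' M tau)%C tau).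
{ symmetry; unfold coset_sum at 1; rewrite (cderiv_C_derive _ _ _ Hu').
  exact (Csum_eq _ _ _ S'). }
rewrite <- E, <- E' by trivial; split; [|split; [|split]].
- intros M HM; apply cderiv_mult; auto.
- exact (is_Csum_scal _ _ _ _ F2).
- exact S'.
- apply (cderiv_ext_near (fun w => u w * coset_sum f w)%C _ _ _ (Im tau)); trivial.
  + intros w Hw; apply E; apply Im_near in Hw; lra.
  + now apply cderiv_mult.
Qed.

Definition E2_cocycle : C := (6 / (PI * Ci))%C.

(** The factor is (c tau + d)^-2 times the value of E2 at M tau. *)
Lemma termwise_E2_pow N r a b : (a + 4 <= b)%nat ->
  termwise (fun M tau => (E2 tau + E2_cocycle * IZR (m_c M) * / autj M tau) ^ r * pterm N a b M tau)%C.
Proof.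
revert a b; induction r as [|r IH]; intros a b Hab.
- apply termwise_ext with (pterm N a b); [intros; simpl; ring|].
  eexists; now apply termwise_pterm.
- apply termwise_ext with (fun M tau =>
    E2 tau * ((E2 tau + E2_cocycle * IZR (m_c M) * / autj M tau) ^ r * pterm N a b M tau)
    + E2_cocycle * ((E2 tau + E2_cocycle * IZR (m_c M) * / autj M tau) ^ r * pterm N (S a) (S b) M tau))%C.
  { intros M tau _ _; unfold pterm; simpl; ring. }
  apply termwise_plus.
  + apply (termwise_mul E2); [|now apply IH].
    intros tau Ht; eexists; now apply cderiv_E2.
  + apply (termwise_mul (fun _ => E2_cocycle)); [|apply IH; lia].
    intros tau _; eexists; apply cderiv_const.
Qed.

Lemma termwise_sum (f : nat -> mat2 -> C -> C) n :
  (forall r, (r <= n)%nat -> termwise (f r)) -> termwise (fun M tau => sum_n (fun r => f r M tau) n).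
Proof.
induction n as [|n IH]; intros H.
- apply termwise_ext with (f 0%nat); [intros; now rewrite sum_O|]; apply H; lia.
- apply termwise_ext with (fun M tau => sum_n (fun r => f r M tau) n + f (S n) M tau)%C.
  { intros; now rewrite sum_Sn. }
  apply termwise_plus; [apply IH; intros; apply H; lia|apply H; lia].
Qed.

(** * The seeds phi_n of the Serre derivatives *)

Definition phi_coef (l n r : nat) : C :=
  (Binomial.C n r * (INR (fact (l + n - 1)) / INR (fact (l + n - r - 1))))%C.

Definition phi (l N n : nat) (tau : C) : C :=
  (qexp tau ^ N *
   sum_n (fun r : nat =>
     Binomial.C n r * (INR (fact (l + n - 1)) / INR (fact (l + n - r - 1)))
     * (- (E2 tau / 12)) ^ r * INR N ^ (n - r)) n)%C.

Definition phi_poly (l N n : nat) (x : C) : C :=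
  sum_n (fun r => phi_coef l n r * x ^ r * INR N ^ (n - r))%C n.

Lemma phi_eq l N n tau : phi l N n tau = (qexp tau ^ N * phi_poly l N n (- (E2 tau / 12)))%C.
Proof. reflexivity. Qed.

Lemma slash_eq k f M tau : slash k f M tau = (/ autj M tau ^ k * f (mobius M tau))%C.
Proof. reflexivity. Qed.

Lemma sum_n_C_ext (f g : nat -> C) n :
  (forall r, (r <= n)%nat -> f r = g r) -> @eq C (sum_n f n) (sum_n g n).
Proof. apply sum_n_ext_loc. Qed.

Lemma sum_n_scal_C (c : C) (f : nat -> C) n : sum_n (fun r => c * f r)%C n = (c * sum_n f n)%C.
Proof.
induction n as [|n IH]; [now rewrite !sum_O|].
rewrite !sum_Sn, IH; unfold plus; simpl; ring.
Qed.

Lemma termwise_phi l N n : (4 <= l)%nat -> termwise (slash (l + 2 * n) (phi l N n)).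
Proof.
intros Hl.
apply termwise_ext with (fun M tau => sum_n (fun r =>
  (phi_coef l n r * INR N ^ (n - r) * (- / 12) ^ r) *
  ((E2 tau + E2_cocycle * IZR (m_c M) * / autj M tau) ^ r * pterm N 0 (l + 2 * (n - r)) M tau))%C n).
- intros M tau HM Ht; rewrite slash_eq, phi_eq; unfold phi_poly.
  assert (J := autj_neq_0 M tau HM Ht).
  rewrite Cmult_assoc, <- sum_n_scal_C; apply sum_n_C_ext; intros r Hr.
  rewrite E2_mobius by trivial; fold E2_cocycle.
  replace (- ((autj M tau ^ 2 * E2 tau + E2_cocycle * IZR (m_c M) * autj M tau) / 12))%C
    with ((- / 12) * (autj M tau ^ 2 * (E2 tau + E2_cocycle * IZR (m_c M) * / autj M tau)))%C
    by (field; repeat split; trivial; apply RtoC_neq_0; lra).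
  rewrite !Cpow_mult_l, <- Cpow_mult_r; unfold pterm; simpl (_ ^ 0)%C.
  replace (l + 2 * n)%nat with (2 * r + (l + 2 * (n - r)))%nat by lia.
  set (b := (l + 2 * (n - r))%nat); rewrite Cpow_add_r, Cpow_inv by trivial.
  set (U := (_ + _ * / autj M tau)%C).
  field; repeat split; trivial; now apply Cpow_nz.
- apply termwise_sum; intros r Hr.
  apply (termwise_mul (fun _ => phi_coef l n r * INR N ^ (n - r) * (- / 12) ^ r)%C).
  + intros tau _; eexists; apply cderiv_const.
  + apply termwise_E2_pow; lia.
Qed.

(** Extending the coefficients by zero spares the recursion its boundary cases. *)
Definition phi_coef0 (l n r : nat) : C := if (r <=? n)%nat then phi_coef l n r else 0.

Lemma phi_coef_add l m r :
  phi_coef (S l) (r + m) r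
  = RtoC (INR (fact (r + m)) * INR (fact (l + r + m)) / (INR (fact r) * INR (fact m) * INR (fact (l + m)))).
Proof.
unfold phi_coef, Binomial.C.
replace (r + m - r)%nat with m by lia.
replace (S l + (r + m) - 1)%nat with (l + r + m)%nat by lia.
replace (S l + (r + m) - r - 1)%nat with (l + m)%nat by lia.
assert (F : forall k, INR (fact k) <> 0) by apply INR_fact_neq_0.
rewrite <- RtoC_div, <- RtoC_mult by apply F; f_equal; field; repeat split; apply F.
Qed.

Lemma phi_coef0_le l n r : (r <= n)%nat -> phi_coef0 l n r = phi_coef l n r.
Proof. intros H; unfold phi_coef0; now rewrite (proj2 (Nat.leb_le r n) H). Qed.

Lemma phi_coef0_gt l n r : (n < r)%nat -> phi_coef0 l n r = 0.
Proof. intros H; unfold phi_coef0; now rewrite (proj2 (Nat.leb_gt r n) H). Qed.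

Lemma phi_coef_rec l n r : (1 <= l)%nat ->
  phi_coef0 l (S n) (S r)
  = (phi_coef0 l n (S r) + (INR (l + 2 * n) - INR r) * phi_coef0 l n r)%C.
Proof.
destruct l as [|l]; [lia|intros _].
assert (F : forall k, INR (fact k) <> 0) by apply INR_fact_neq_0.
assert (SS : forall k, INR (fact (S k)) = INR (S k) * INR (fact k)) by (intros; now rewrite fact_simpl, mult_INR).
assert (S0 : forall k, INR (S k) <> 0) by (intros; apply not_0_INR; lia).
destruct (lt_eq_lt_dec r n) as [[H|H]|H].
- rewrite !phi_coef0_le by lia.
  destruct (Nat.le_exists_sub (S r) n H) as (m & -> & _).
  replace (S (m + S r)) with (S r + S m)%nat by lia; rewrite phi_coef_add.
  replace (m + S r)%nat with (S r + m)%nat by lia; rewrite phi_coef_add.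
  replace (S r + m)%nat with (r + S m)%nat by lia; rewrite phi_coef_add.
  rewrite <- RtoC_minus, <- RtoC_mult, <- RtoC_plus; f_equal.
  replace (l + S r + S m)%nat with (S (S (l + r + m))) by lia.
  replace (l + S r + m)%nat with (S (l + r + m)) by lia.
  replace (l + r + S m)%nat with (S (l + r + m)) by lia.
  replace (S r + S m)%nat with (S (S (r + m))) by lia.
  replace (r + S m)%nat with (S (r + m)) by lia.
  replace (l + S m)%nat with (S (l + m)) by lia.
  rewrite !SS, plus_INR, mult_INR.
  assert (R1 : INR (r + m) = INR r + INR m) by apply plus_INR.
  assert (R2 : INR (l + m) = INR l + INR m) by apply plus_INR.
  assert (R3 : INR (l + r + m) = INR l + INR r + INR m) by (rewrite !plus_INR; ring).
  assert (Pr := pos_INR r); assert (Pm := pos_INR m); assert (Pl := pos_INR l).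
  rewrite !S_INR, R1, R2, R3; change (INR 0) with 0.
field; repeat split; try apply F; lra.
- subst r; rewrite phi_coef0_le, phi_coef0_gt, phi_coef0_le by lia.
  assert (K : forall k, phi_coef (S l) k k = RtoC (INR (fact (l + k)) / INR (fact l))).
  { intros k; assert (A := phi_coef_add l 0 k); rewrite !Nat.add_0_r in A; rewrite A; f_equal.
    simpl (fact 0); simpl (INR 1); field; split; apply F. }
  rewrite !K, Cplus_0_l, <- RtoC_minus, <- RtoC_mult; f_equal.
  rewrite Nat.add_succ_r, SS, plus_INR, mult_INR, !S_INR, plus_INR; change (INR 0) with 0; field; apply F.
- rewrite !phi_coef0_gt by lia; ring.
Qed.

Lemma phi_coef_0 l n : (1 <= l)%nat -> phi_coef0 l n 0 = 1.
Proof.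
destruct l as [|l]; [lia|intros _]; rewrite phi_coef0_le by lia.
assert (A := phi_coef_add l n 0); rewrite Nat.add_0_r in A; simpl (0 + n)%nat in A; rewrite A.
simpl (fact 0); simpl (INR 1); f_equal; field; split; apply INR_fact_neq_0.
Qed.

Lemma phi_coef_deriv l n r : (1 <= l)%nat -> (r <= n)%nat ->
  (INR (S r) * phi_coef l (S n) (S r))%C = (INR (S n) * INR (l + n) * phi_coef l n r)%C.
Proof.
destruct l as [|l]; [lia|intros _ H].
destruct (Nat.le_exists_sub r n H) as (m & -> & _).
replace (S (m + r)) with (S r + m)%nat by lia; rewrite phi_coef_add.
replace (m + r)%nat with (r + m)%nat by lia; rewrite phi_coef_add.
rewrite <- !RtoC_mult; f_equal.
replace (l + S r + m)%nat with (S (l + r + m)) by lia.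
replace (S l + (r + m))%nat with (S (l + r + m)) by lia.
replace (S r + m)%nat with (S (r + m)) by lia.
rewrite !fact_simpl, !mult_INR; assert (F : forall k, INR (fact k) <> 0) by apply INR_fact_neq_0.
assert (S0 : INR (S r) <> 0) by (apply not_0_INR; lia).
field; repeat split; trivial.
Qed.

Definition phi_poly' (l N n : nat) (x : C) : C :=
  sum_n (fun r => phi_coef l n r * (INR r * x ^ (r - 1)) * INR N ^ (n - r))%C n.

Lemma cderiv_phi_poly l N n x : cderiv (phi_poly l N n) x (phi_poly' l N n x).
Proof.
assert (K : forall m, cderiv (fun x => sum_n (fun r => phi_coef l n r * x ^ r * INR N ^ (n - r))%C m) x
  (sum_n (fun r => phi_coef l n r * (INR r * x ^ (r - 1)) * INR N ^ (n - r))%C m)); [|apply K].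
assert (T : forall r, cderiv (fun x => phi_coef l n r * x ^ r * INR N ^ (n - r))%C x
  (phi_coef l n r * (INR r * x ^ (r - 1)) * INR N ^ (n - r))%C).
{ intros r.
  apply cderiv_ext with (fun x => (phi_coef l n r * INR N ^ (n - r)) * x ^ r)%C; [intros; ring|].
  replace (phi_coef l n r * (INR r * x ^ (r - 1)) * INR N ^ (n - r))%C
    with ((phi_coef l n r * INR N ^ (n - r)) * (INR r * x ^ (r - 1) * 1))%C by ring.
  apply cderiv_scal, (cderiv_pow (fun w => w)), cderiv_id. }
induction m as [|m IH].
- rewrite sum_O; apply (cderiv_ext (fun x => phi_coef l n 0 * x ^ 0 * INR N ^ (n - 0))%C); [|apply T].
  intros; now rewrite sum_O.
- rewrite sum_Sn.
  apply (cderiv_ext (fun x => sum_n (fun r => phi_coef l n r * x ^ r * INR N ^ (n - r))%C m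
    + phi_coef l n (S m) * x ^ (S m) * INR N ^ (n - S m))%C); [intros; now rewrite sum_Sn|].
  now apply cderiv_plus.
Qed.

Lemma sum_n_shift (f : nat -> C) n : sum_n f (S n) = (f 0%nat + sum_n (fun r => f (S r)) n)%C.
Proof.
induction n as [|n IH]; [rewrite sum_Sn, !sum_O; easy|].
rewrite sum_Sn, IH, sum_Sn; unfold plus; simpl; ring.
Qed.

Lemma sum_n_C_plus (f g : nat -> C) n : sum_n (fun r => f r + g r)%C n = (sum_n f n + sum_n g n)%C.
Proof.
induction n as [|n IH]; [now rewrite !sum_O|].
rewrite !sum_Sn, IH; unfold plus; simpl; ring.
Qed.

Lemma phi_poly_deriv l N n x : (1 <= l)%nat ->
  phi_poly' l N n x = (INR n * (INR l + INR n - 1) * phi_poly l N (n - 1) x)%C.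
Proof.
intros Hl; unfold phi_poly', phi_poly; destruct n as [|n].
- rewrite !sum_O; simpl; ring.
- replace (S n - 1)%nat with n by lia; rewrite <- sum_n_scal_C, sum_n_shift.
  replace (phi_coef l (S n) 0 * (INR 0 * x ^ (0 - 1)) * INR N ^ (S n - 0))%C with (RtoC 0)
    by (simpl INR; ring).
  rewrite Cplus_0_l; apply sum_n_C_ext; intros r Hr.
  replace (S r - 1)%nat with r by lia; replace (S n - S r)%nat with (n - r)%nat by lia.
  transitivity ((INR (S r) * phi_coef l (S n) (S r)) * x ^ r * INR N ^ (n - r))%C; [ring|].
  rewrite phi_coef_deriv by trivial; rewrite plus_INR, RtoC_plus, (S_INR n), RtoC_plus; ring.
Qed.

(** The differential recursion without E4: the operator D sends - E2 / 12 to
   - (E2 / 12)^2 + E4 / 144, and only the first part enters here. *)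
Lemma phi_poly_rec l N n x : (1 <= l)%nat ->
  phi_poly l N (S n) x
  = ((INR N + INR (l + 2 * n) * x) * phi_poly l N n x - x ^ 2 * phi_poly' l N n x)%C.
Proof.
intros Hl.
assert (E0 : forall n, phi_poly l N n x = sum_n (fun r => phi_coef0 l n r * x ^ r * INR N ^ (n - r))%C n).
{ intros k; apply sum_n_C_ext; intros r Hr; now rewrite phi_coef0_le. }
rewrite E0, sum_n_shift.
rewrite (sum_n_C_ext _ (fun r => phi_coef0 l n (S r) * x ^ S r * INR N ^ (n - r)
  + (INR (l + 2 * n) - INR r) * phi_coef0 l n r * x ^ S r * INR N ^ (n - r))%C).
2:{ intros r Hr; rewrite phi_coef_rec by trivial.
    replace (S n - S r)%nat with (n - r)%nat by lia; ring. }
rewrite sum_n_C_plus.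
assert (R1 : (phi_coef0 l (S n) 0 * x ^ 0 * INR N ^ (S n - 0)
  + sum_n (fun r => phi_coef0 l n (S r) * x ^ S r * INR N ^ (n - r)) n)%C = (INR N * phi_poly l N n x)%C).
{ rewrite E0, <- sum_n_scal_C.
  transitivity (sum_n (fun r => phi_coef0 l n r * x ^ r * INR N ^ (S n - r))%C (S n)).
  - rewrite sum_n_shift, !phi_coef_0 by trivial; f_equal.
  - rewrite sum_Sn, (phi_coef0_gt l n (S n)) by lia.
    rewrite (sum_n_C_ext _ (fun r => INR N * (phi_coef0 l n r * x ^ r * INR N ^ (n - r)))%C).
    + unfold plus; simpl; ring.
    + intros r Hr; replace (S n - r)%nat with (S (n - r)) by lia; simpl; ring. }
assert (R2 : sum_n (fun r => (INR (l + 2 * n) - INR r) * phi_coef0 l n r * x ^ S r * INR N ^ (n - r))%C n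
  = (INR (l + 2 * n) * x * phi_poly l N n x - x ^ 2 * phi_poly' l N n x)%C).
{ replace (INR (l + 2 * n) * x * phi_poly l N n x - x ^ 2 * phi_poly' l N n x)%C
    with (INR (l + 2 * n) * x * phi_poly l N n x + - x ^ 2 * phi_poly' l N n x)%C by ring.
  unfold phi_poly, phi_poly'; rewrite <- !sum_n_scal_C, <- sum_n_C_plus.
  apply sum_n_C_ext; intros r Hr; rewrite phi_coef0_le by trivial.
  destruct r as [|r]; [simpl; ring|]; replace (S r - 1)%nat with r by lia; simpl (_ ^ S _)%C; ring. }
rewrite Cplus_assoc, R1, R2; ring.
Qed.

(** By Ramanujan's equation D produces an E4 term proportional to [phi_poly'], hence
   to phi_(n-1) by [phi_poly_deriv]: it is the one that the recursive definition
   of the Serre derivatives subtracts. *)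
Lemma cderiv_phi l N n tau : (1 <= l)%nat -> 0 < Im tau ->
  cderiv (phi l N n) tau
    (2 * PI * Ci * (phi l N (S n) tau + INR (l + 2 * n) / 12 * E2 tau * phi l N n tau
      + INR n * (INR l + INR n - 1) / 144 * E4 tau * phi l N (n - 1) tau))%C.
Proof.
intros Hl Ht.
set (x := fun tau => (- (E2 tau / 12))%C).
assert (N12 : RtoC 12 <> 0) by (apply RtoC_neq_0; lra).
assert (Dx : cderiv x tau (- / 12 * (2 * PI * Ci * ((E2 tau ^ 2 - E4 tau) / 12)))%C).
{ apply cderiv_ext with (fun tau => - / 12 * E2 tau)%C.
  - intros w; unfold x; field; trivial.
  - now apply cderiv_scal, cderiv_E2. }
assert (D := cderiv_mult _ _ _ _ _ (cderiv_pow _ _ _ N (cderiv_qexp tau))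
  (cderiv_comp (phi_poly l N n) x _ _ _ (cderiv_phi_poly l N n (x tau)) Dx)).
apply (cderiv_ext _ (phi l N n)) in D; [|reflexivity].
match type of D with cderiv _ _ ?d => match goal with |- cderiv _ _ ?e => replace e with d; [exact D|] end end.
rewrite !phi_eq; fold (x tau); rewrite phi_poly_rec by trivial.
assert (EN : (INR N * qexp tau ^ (N - 1) * (2 * PI * Ci * qexp tau))%C = (2 * PI * Ci * INR N * qexp tau ^ N)%C).
{ destruct N as [|k]; [simpl; ring|]; replace (S k - 1)%nat with k by lia; simpl; ring. }
rewrite EN.
assert (Q := phi_poly_deriv l N n (x tau) Hl).
set (P' := phi_poly' l N n (x tau)) in *; set (P := phi_poly l N n (x tau)) in *.
transitivity (2 * PI * Ci * qexp tau ^ N * ((INR N + INR (l + 2 * n) * x tau) * P - x tau ^ 2 * P'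
  + INR (l + 2 * n) / 12 * E2 tau * P + / 144 * E4 tau * P'))%C.
- unfold x; field; repeat split; trivial; apply RtoC_neq_0; lra.
- rewrite Q; field; repeat split; trivial; apply RtoC_neq_0; lra.
Qed.

(** * Serre derivatives of Poincare series *)

(** E4 inherits its modularity from E2 through Ramanujan's equation. *)
Lemma E4_mobius M tau : SL2Z M -> 0 < Im tau -> E4 (mobius M tau) = (autj M tau ^ 4 * E4 tau)%C.
Proof.
intros HM Ht; assert (J := autj_neq_0 M tau HM Ht); assert (Hs := Im_mobius_pos M tau HM Ht).
assert (P0 : RtoC PI <> 0) by (apply RtoC_neq_0; assert (P := PI_RGT_0); lra).
assert (D1 := cderiv_comp E2 (mobius M) tau _ _ (cderiv_E2 _ Hs) (cderiv_mobius M tau HM Ht)).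
assert (Dj := cderiv_autj M tau).
assert (D2 := cderiv_plus _ _ _ _ _
  (cderiv_mult _ _ _ _ _ (cderiv_pow _ _ _ 2 Dj) (cderiv_E2 tau Ht))
  (cderiv_scal (E2_cocycle * IZR (m_c M)) _ _ _ Dj)).
apply (cderiv_ext_near _ (fun tau => E2 (mobius M tau)) _ _ (Im tau)) in D2; trivial.
2:{ intros w Hw; symmetry; apply E2_mobius; trivial; apply Im_near in Hw; lra. }
assert (E := cderiv_unique _ _ _ _ D1 D2); clear D1 D2 Dj.
rewrite E2_mobius in E by trivial; fold E2_cocycle in E.
set (j := autj M tau) in *; set (c := RtoC (IZR (m_c M))) in *.
assert (N12 : RtoC 12 <> 0) by (apply RtoC_neq_0; lra).
assert (N2 : RtoC 2 <> 0) by (apply RtoC_neq_0; lra).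
set (s := E4 (mobius M tau)) in *.
assert (Es : s = ((j ^ 2 * E2 tau + E2_cocycle * c * j) ^ 2
  - 6 / (PI * Ci) * j ^ 2 * ((/ j) ^ 2 * (2 * PI * Ci * (((j ^ 2 * E2 tau + E2_cocycle * c * j) ^ 2 - s) / 12))))%C).
{ field; repeat split; trivial; apply Ci_nz. }
rewrite Es, E; unfold E2_cocycle; simpl INR; simpl (2 - 1)%nat.
replace (RtoC (1 + 1)) with (RtoC 2) by (f_equal; ring).
field; repeat split; trivial; apply Ci_nz.
Qed.

(** The non-modular terms of D and of E2 cancel, so that the recursion of the Serre
   derivatives commutes with the slash action; by [cderiv_phi] it sends phi_n and
   phi_(n-1) to phi_(n+1). *)
Lemma slash_phi_step l N n M tau d : (1 <= l)%nat -> SL2Z M -> 0 < Im tau ->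
  cderiv (slash (l + 2 * n) (phi l N n) M) tau d ->
  slash (l + 2 * S n) (phi l N (S n)) M tau
  = (/ (2 * PI * Ci) * d - INR (l + 2 * n) / 12 * E2 tau * slash (l + 2 * n) (phi l N n) M tau
     - INR n * (INR l + INR n - 1) / 144 * E4 tau * slash (l + 2 * (n - 1)) (phi l N (n - 1)) M tau)%C.
Proof.
intros Hl HM Ht Hd.
assert (J := autj_neq_0 M tau HM Ht); assert (Hs := Im_mobius_pos M tau HM Ht).
assert (P0 : RtoC PI <> 0) by (apply RtoC_neq_0; assert (P := PI_RGT_0); lra).
set (k := (l + 2 * n)%nat) in *.
assert (D := cderiv_mult _ _ _ _ _ (cderiv_pow _ _ _ k (cderiv_inv_autj M tau HM Ht))
  (cderiv_comp (phi l N n) (mobius M) tau _ _ (cderiv_phi l N n _ Hl Hs) (cderiv_mobius M tau HM Ht))).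
apply (cderiv_ext_near _ (slash k (phi l N n) M) _ _ (Im tau)) in D; trivial.
2:{ intros w Hw; rewrite slash_eq, Cpow_inv; trivial.
    apply autj_neq_0; trivial; apply Im_near in Hw; lra. }
rewrite (cderiv_unique _ _ _ _ Hd D); clear D Hd.
rewrite !slash_eq; fold k.
rewrite E2_mobius, E4_mobius by trivial.
set (j := autj M tau) in *; set (c := RtoC (IZR (m_c M))) in *.
assert (Hk : (INR k * (/ j) ^ (k - 1) * (- c * (/ j) ^ 2))%C = (- (INR k * c * / j) * (/ j) ^ k)%C).
{ destruct k as [|k']; [simpl; ring|]; replace (S k' - 1)%nat with k' by lia; simpl; ring. }
rewrite Hk.
replace (l + 2 * S n)%nat with (k + 2)%nat by (unfold k; lia).
rewrite <- !Cpow_inv, Cpow_add_r by trivial.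
set (F1 := phi l N (S n) (mobius M tau)); set (F := phi l N n (mobius M tau)).
assert (E0 : (INR n * (/ j) ^ (l + 2 * (n - 1)))%C = (INR n * (j ^ 2 * (/ j) ^ k))%C).
{ destruct n as [|n']; [simpl INR; ring|].
  unfold k; replace (l + 2 * S n')%nat with (2 + (l + 2 * (S n' - 1)))%nat by lia.
  rewrite (Cpow_add_r _ 2); simpl (_ ^ 2)%C; field; trivial. }
set (F0 := phi l N (n - 1) (mobius M tau)).
replace (INR n * (INR l + INR n - 1) / 144 * E4 tau * ((/ j) ^ (l + 2 * (n - 1)) * F0))%C
  with ((INR l + INR n - 1) / 144 * E4 tau * ((INR n * (/ j) ^ (l + 2 * (n - 1))) * F0))%C
  by (unfold Cdiv; ring).
rewrite E0; clear E0 Hk.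
set (jk := ((/ j) ^ k)%C).
field; repeat split; trivial; try apply Ci_nz; apply RtoC_neq_0; lra.
Qed.

(** The step for one coset, summed over all cosets. *)
Lemma serre_step l N n tau : (4 <= l)%nat -> 0 < Im tau ->
  (forall w, 0 < Im w -> serre n l (poincare l (fun z => qexp z ^ N)%C) w = poincare (l + 2 * n) (phi l N n) w) ->
  (forall w, 0 < Im w -> serre (n - 1) l (poincare l (fun z => qexp z ^ N)%C) w
     = poincare (l + 2 * (n - 1)) (phi l N (n - 1)) w) ->
  serre (S n) l (poincare l (fun z => qexp z ^ N)%C) tau = poincare (l + 2 * S n) (phi l N (S n)) tau.
Proof.
intros Hl Ht H1 H0.
set (P := poincare l (fun z => qexp z ^ N)%C) in *.
assert (E : serre (S n) l P tau = (theta (l + 2 * n) (serre n l P) tau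
  - INR n * (INR l + INR n - 1) / 144 * E4 tau * serre (n - 1) l P tau)%C).
{ destruct n as [|n].
  - simpl; rewrite Nat.add_0_r; unfold Cdiv; ring.
  - simpl (S n - 1)%nat; rewrite Nat.sub_0_r; easy. }
rewrite E; unfold theta, Dq.
destruct (termwise_phi l N n Hl) as (f' & Hf).
destruct (Hf tau Ht) as (D1 & S1 & S2 & D2).
destruct (termwise_phi l N (n - 1) Hl) as (f0' & Hf0).
destruct (Hf0 tau Ht) as (_ & S0 & _ & _).
rewrite (cderiv_C_derive (serre n l P) tau (coset_sum f' tau)).
2:{ apply (cderiv_ext_near (coset_sum (slash (l + 2 * n) (phi l N n))) _ _ _ (Im tau)); trivial.
    intros w Hw; symmetry; apply H1; apply Im_near in Hw; lra. }
rewrite H1, H0 by trivial.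
symmetry; apply Csum_eq.
apply is_Csum_ext with (fun X => / (2 * PI * Ci) * f' (coset_repr X) tau
  - INR (l + 2 * n) / 12 * E2 tau * slash (l + 2 * n) (phi l N n) (coset_repr X) tau
  - INR n * (INR l + INR n - 1) / 144 * E4 tau * slash (l + 2 * (n - 1)) (phi l N (n - 1)) (coset_repr X) tau)%C.
- intros X HX; destruct (coset_repr_spec X HX) as (HM & _).
  symmetry; apply slash_phi_step; trivial; [lia|now apply D1].
- apply is_Csum_minus; [apply is_Csum_minus|]; now apply is_Csum_scal.
Qed.

Lemma serre_poincare l N n : (4 <= l)%nat -> forall tau, 0 < Im tau ->
  serre n l (poincare l (fun z => qexp z ^ N)%C) tau = poincare (l + 2 * n) (phi l N n) tau.
Proof.
intros Hl; induction n as [n IH] using lt_wf_ind; destruct n as [|n]; intros tau Ht.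
- simpl (2 * 0)%nat; rewrite Nat.add_0_r; simpl serre; apply Csum_ext; intros X _.
  rewrite !slash_eq, phi_eq; unfold phi_poly; rewrite sum_O; do 2 f_equal.
  assert (A := phi_coef_0 l 0 ltac:(lia)); rewrite phi_coef0_le in A by lia; rewrite A; simpl; ring.
- apply serre_step; trivial; intros w Hw; apply IH; trivial; lia.
Qed.

Theorem theorem4 : forall m N l : nat,
  Nat.Even l -> (4 <= l)%nat -> (2 * m + 2 <= l)%nat ->
  let phi := fun tau : C =>
    (qexp tau ^ N *
     sum_n (fun r : nat =>
       Binomial.C m r * (INR (fact (l + m - 1)) / INR (fact (l + m - r - 1)))
       * (- (E2 tau / 12)) ^ r * INR N ^ (m - r)) m)%C in
  forall tau : C, 0 < Im tau ->
    serre m l (poincare l (fun z => qexp z ^ N)%C) tau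
    = poincare (l + 2 * m) phi tau.
Proof.
intros m N l _ Hl _ phi0 tau Ht; exact (serre_poincare l N m Hl tau Ht).
Qed.
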